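(* Let $q\in\mathbb{C}$ with $\xi:=\Re(q)>0$ and $q\neq 1/2$, and fix a choice of sign $\pm$ (the same choice throughout). Then the equation \[ (M\pm N_q-I)\phi=0 \] has a nonzero solution $\phi\in L^2(m_\xi)$ if and only if there exists a nonzero infinite vector $\Phi=(\Phi_n)_{n\in\mathbb{N}_0}$ of complex numbers such that \[ \sum_{n=0}^\infty |\Phi_n|^2\,\frac{\Gamma(n+2\xi)}{n!}<\infty\qquad\text{and}\qquad A_q^\pm\Phi=D_q\Phi , \] where $A_q^\pm=(a^\pm_{kn}(q))_{k,n\in\mathbb{N}_0}$ and $D_q=(d_{kn}(q))_{k,n\in\mathbb{N}_0}$ are the infinite matrices with entries \[ \begin{aligned} a^\pm_{kn}(q)=\;&\frac{\Gamma(k+n+2\xi)}{k!\,n!}\,2^{-(k+n+2\xi)}\ \pm\ \frac{\Gamma(n+2\xi)\,\Gamma(k+2\xi)}{2^{k+2\xi}}\sum_{\ell=0}^n\frac{(-1)^\ell\,\Gamma(\ell+2q)}{(n-\ell)!\,\Gamma(\ell+2\xi)}\\ &\cdot\left(\sum_{j=0}^{\min\{\ell,k\}}\frac{2^{-j}}{j!\,(\ell-j)!\,(k-j)!\,\Gamma(j+2q)}\;{}_2F_1\!\left(-\ell+j,\,2\xi+j;\,2q+j;\,\tfrac12\right)\right),\\ d_{kn}(q)=\;&\frac{\Gamma(k+2\xi)}{k!}\,\delta_{k,n}. \end{aligned} \] Moreover, if a solution $\Phi=(\Phi_n)$ of this system exists, then the solution of $(M\pm N_q-I)\phi=0$ can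 be written as \[ \phi(t)=\sum_{n=0}^\infty \Phi_n\,L_n^{2\xi-1}(t), \] and vice versa.
   Context: Here $\mathbb{N}_0=\{0,1,2,\dots\}$, $\Gamma$ is the Gamma function, $\delta_{k,n}$ is the Kronecker delta, and $I$ is the identity operator. For $a\in\mathbb{C}$, $m_a$ denotes the absolutely continuous (complex, if $a\notin\mathbb{R}$) measure on $\mathbb{R}^+=(0,\infty)$ with density $dm_a(t)=t^{2a-1}e^{-t}\,dt$. For $\xi>0$, $L^2(m_\xi)$ is the Hilbert space of functions $\phi:\mathbb{R}^+\to\mathbb{C}$ with $\int_0^\infty|\phi(t)|^2\,dm_\xi(t)<\infty$, with scalar product $(f,g)_\xi=\int_0^\infty f(t)\overline{g(t)}\,dm_\xi(t)$. The operators $M$ and $N_q$ (bounded on $L^2(m_\xi)$ when $\xi=\Re(q)>0$, $q\ne1/2$) are defined by \[ M(\psi)(t)=e^{-t}\psi(t),\qquad N_q(\psi)(t)=\int_0^\infty\frac{J_{2q-1}(2\sqrt{st})}{(st)^{q-1/2}}\,\psi(s)\,dm_q(s), \] where $J_\nu$ is the Bessel function of the first kind, $J_\nu(t)=\frac{t^\nu}{2^\nu}\sum_{m=0}^\infty\frac{(-1)^mt^{2m}}{2^{2m}\,m!\,\Gamma(m+\nu+1)}$ for $\Re(\nu)>-1$. The generalised Laguerre polynomials are \[ L_n^{2\xi-1}(t)=\sum_{\ell=0}^n\frac{\Gamma(n+2\xi)}{(n-\ell)!\,\Gamma(\ell+2\xi)}\,\frac{(-1)^\ell}{\ell!}\,t^\ell,\qquad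 n\in\mathbb{N}_0; \] they form an orthogonal basis of $L^2(m_\xi)$ with $(L_n^{2\xi-1},L_m^{2\xi-1})_\xi=\frac{\Gamma(n+2\xi)}{n!}\delta_{n,m}$. Series $\sum_n\Phi_nL_n^{2\xi-1}$ converge in $L^2(m_\xi)$. The hypergeometric function is, for $|z|<1$, \[ {}_2F_1(\alpha,\beta;\gamma;z)=\sum_{i=0}^\infty\frac{\Gamma(\alpha+i)\,\Gamma(\beta+i)\,\Gamma(\gamma)}{\Gamma(\alpha)\,\Gamma(\beta)\,\Gamma(\gamma+i)}\,\frac{z^i}{i!}, \] where the ratio $\Gamma(\alpha+i)/\Gamma(\alpha)$ is understood as the product $\alpha(\alpha+1)\cdots(\alpha+i-1)$ (so the series terminates when $\alpha$ is a non-positive integer). *)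

(* Defs.v *)
From HB Require Import structures.
From mathcomp Require Import all_boot all_order all_algebra.
From mathcomp Require Import all_classical all_reals all_analysis.
From mathcomp.real_closed Require Import complex.

Set Implicit Arguments.
Unset Strict Implicit.
Unset Printing Implicit Defensive.

Import Order.TTheory GRing.Theory Num.Theory.
Import numFieldNormedType.Exports.

Local Open Scope classical_set_scope.
Local Open Scope ring_scope.
Local Open Scope complex_scope.

Section Analysis.
Context {R : realType}.
Implicit Types (a b c z nu q : R[i]) (x t xi : R).

Local Notation Re := (@complex.Re R).
Local Notation Im := (@complex.Im R).

Definition cexp z : R[i] :=
  (expR (Re z))%:C * (cos (Im z) +i* sin (Im z)).

(* Principal power of a positive real base; meaningful only for 0 < x. *)
Definition rpowc x z : R[i] := cexp (z * (ln x)%:C).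

Definition Rpos : set R := `]0, +oo[.

(* Lebesgue integral over (0, +oo), taken separately on the real and the
   imaginary parts. *)
Definition cint (f : R -> R[i]) : R[i] :=
  Rintegral lebesgue_measure Rpos (fun t => Re (f t)) +i*
  Rintegral lebesgue_measure Rpos (fun t => Im (f t)).

(* R[i] gets the topology of its norm through the alias R[i]^o. *)
Definition cseries_cvg (u : nat -> R[i]) (l : R[i]) : Prop :=
  series (u : nat -> R[i]^o) @ \oo --> (l : R[i]^o).

Definition csum (u : nat -> R[i]) : R[i] := limn (series (u : nat -> R[i]^o)).

(* Euler's integral, hence the Gamma function on Re z > 0 only; every argument
   occurring below satisfies this when Re q > 0 (and Re nu > -1). *)
Definition Gamma z : R[i] :=
  cint (fun t => rpowc t (z - 1) * (expR (- t))%:C).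

Definition BesselJ nu t : R[i] :=
  rpowc t nu / rpowc 2 nu *
  csum (fun m => (-1) ^+ m * t%:C ^+ (2 * m) /
                 (2 ^+ (2 * m) * m`!%:R * Gamma (m%:R + nu + 1))).

(* Gamma (a + i) / Gamma a is read as the rising factorial of a. *)
Definition hypergeom21 a b c z : R[i] :=
  csum (fun i => (\prod_(j < i) (a + j%:R)) *
                 (Gamma (b + i%:R) * Gamma c / (Gamma b * Gamma (c + i%:R))) *
                 (z ^+ i / i`!%:R)).

Definition mdens a t : R[i] := rpowc t (2 * a - 1) * (expR (- t))%:C.

Definition mint a (f : R -> R[i]) : R[i] := cint (fun t => f t * mdens a t).

(* The square of the norm of L^2(m_xi); `|f t| is a real element of R[i]. *)
Definition L2norm2 xi (f : R -> R[i]) : \bar R :=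
  (\int[lebesgue_measure]_(t in Rpos)
     (Re `|f t| ^+ 2 * (t `^ (2 * xi - 1) * expR (- t)))%:E)%E.

(* Elements of L^2(m_xi) are represented by functions on R whose values
   outside (0, +oo) are irrelevant. *)
Definition inL2 xi (f : R -> R[i]) : Prop :=
  [/\ measurable_fun Rpos (fun t => Re (f t)),
      measurable_fun Rpos (fun t => Im (f t)) &
      (L2norm2 xi f < +oo)%E].

(* The density of m_xi is positive on (0, +oo), so m_xi-null subsets of
   (0, +oo) are the Lebesgue-null ones. *)
Definition ae_zero (f : R -> R[i]) : Prop :=
  {ae lebesgue_measure, forall t : R, Rpos t -> f t = 0}.

Definition opM (psi : R -> R[i]) (t : R) : R[i] := (expR (- t))%:C * psi t.

Definition opN q (psi : R -> R[i]) (t : R) : R[i] :=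
  mint q (fun s => BesselJ (2 * q - 1) (2 * Num.sqrt (s * t)) /
                   rpowc (s * t) (q - 2^-1) * psi s).

(* The sign is + for sgn = false and - for sgn = true. *)
Definition op_sol (sgn : bool) q (phi : R -> R[i]) : Prop :=
  [/\ inL2 (Re q) phi, ~ ae_zero phi &
      ae_zero (fun t => opM phi t + (-1) ^+ sgn * opN q phi t - phi t)].

Definition Laguerre xi (n : nat) t : R[i] :=
  \sum_(l < n.+1)
    Gamma (n%:R + 2 * xi%:C) / ((n - l)`!%:R * Gamma (l%:R + 2 * xi%:C)) *
    ((-1) ^+ l / l`!%:R) * t%:C ^+ l.

(* phi = \sum_n Phi_n L_n^(2 xi - 1), with convergence in L^2(m_xi). *)
Definition Laguerre_expansion xi (phi : R -> R[i]) (Phi : nat -> R[i]) : Prop :=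
  L2norm2 xi (fun t => phi t - \sum_(n < N) Phi n * Laguerre xi n t)
    @[N --> \oo] --> 0%E.

Definition matA (sgn : bool) q (k n : nat) : R[i] :=
  let xi := Re q in
  Gamma ((k + n)%:R + 2 * xi%:C) / (k`!%:R * n`!%:R) *
    (2 `^ (- ((k + n)%:R + 2 * xi)))%:C
  + (-1) ^+ sgn *
    (Gamma (n%:R + 2 * xi%:C) * Gamma (k%:R + 2 * xi%:C) /
       (2 `^ (k%:R + 2 * xi))%:C *
     \sum_(l < n.+1)
       (-1) ^+ l * Gamma (l%:R + 2 * q) /
         ((n - l)`!%:R * Gamma (l%:R + 2 * xi%:C)) *
       \sum_(j < (minn l k).+1)
         2 ^- j / (j`!%:R * (l - j)`!%:R * (k - j)`!%:R * Gamma (j%:R + 2 * q)) *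
         hypergeom21 (- l%:R + j%:R) (2 * xi%:C + j%:R) (2 * q + j%:R) (2^-1)).

Definition matD q (k n : nat) : R[i] :=
  Gamma (k%:R + 2 * (Re q)%:C) / k`!%:R * (k == n)%:R.

(* w is the product of the infinite matrix A by the infinite vector v, all the
   series involved being convergent. *)
Definition is_mulmv (A : nat -> nat -> R[i]) (v w : nat -> R[i]) : Prop :=
  forall k, cseries_cvg (fun n => A k n * v n) (w k).

(* The argument of Re is a real element of R[i]. *)
Definition weighted_l2 xi (Phi : nat -> R[i]) : Prop :=
  (\sum_(0 <= n <oo)
     (Re (`|Phi n| ^+ 2 * (Gamma (n%:R + 2 * xi%:C) / n`!%:R)))%:E < +oo)%E.

Definition sys_sol (sgn : bool) q (Phi : nat -> R[i]) : Prop :=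
  [/\ exists n, Phi n != 0,
      weighted_l2 (Re q) Phi &
      exists w, is_mulmv (matA sgn q) Phi w /\ is_mulmv (matD q) Phi w].

End Analysis.

(* Main.v *)
(* Both Phi |-> phi and phi |-> Phi are the isometry given by the orthogonal
   basis of Laguerre polynomials, so the point is that taking the scalar
   products of (M +- N_q) phi with the L_k turns the operator into the matrix
   A_q.

   The basis property reduces to a moment problem: a function orthogonal to all
   the L_k vanishes almost everywhere because its product with the weight has an
   exponential moment, hence is determined by its moments.

   The kernel of N_q is an entire function y of x = st, and it solves
   x y'' + 2 q y' + y = 0.  Multiplying this equation by the
   conjugate of y' shows that (|y|^2 + x |y'|^2) / x is nonincreasing, so that
   the kernel is O(1 + st); since 1 + s is in L^2(m_xi), the value N_q phi (t) is
   a continuous functional of phi, with a bound O(1 + t) which is itself in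
   L^2(m_xi).  Hence N_q phi is obtained term by term from the N_q (t^l), each
   of which is e^(-t) times a polynomial by Kummer's transformation, and its
   scalar products with the L_k are finite sums; the Chu-Vandermonde identity
   brings them into the form of the entries of A_q. *)

Require Import Defs.
From HB Require Import structures.
From mathcomp Require Import all_boot all_order all_algebra.
From mathcomp Require Import all_classical all_reals all_analysis.
From mathcomp Require Import measurable_realfun.
From mathcomp Require Import ring lra zify.
From mathcomp.real_closed Require Import complex.

Set Implicit Arguments.
Unset Strict Implicit.
Unset Printing Implicit Defensive.

Import Order.TTheory GRing.Theory Num.Theory.
Import numFieldNormedType.Exports.

Local Open Scope classical_set_scope.
Local Open Scope ring_scope.
Local Open Scope complex_scope.

(** * Rising factorials and binomial sums *)

Section Pochhammer.
Context {F : comNzRingType}.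
Implicit Types (x y : F) (j k m n p : nat).

(** The kernel of N_q is controlled by two bounds with different roles. For fixed [t] its power
    series gives [C_t e^(s/2)]: enough for integrating term by term against monomials, since half of
    the exponential weight is left. But [e^(s/2)] is not in L^2(m_xi), and [C_t] grows exponentially
    with [t], so this bound says nothing about a general [phi], nor about N_q phi as a function of
    [t]. The linear bound separates the variables through [1 + st <= (1 + s) (1 + t)]. It serves for
    everything else: existence of the integral, pointwise convergence along Laguerre expansions,
    measurability and square integrability of N_q phi, and passage to the limit in the scalar
    products. The Laguerre polynomials and the weight of m_xi are real, so the Hilbert space part is
    done for real functions and used on real and imaginary parts. The complex measure m_q enters
    only inside N_q, where its density is dominated by twice that of m_xi. *)

Definition poch x n : F := \prod_(i < n) (x + i%:R).

Lemma poch0 x : poch x 0 = 1. Proof. exact: big_ord0. Qed.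

Lemma pochSr x n : poch x n.+1 = poch x n * (x + n%:R).
Proof. exact: big_ord_recr. Qed.

Lemma pochSl x n : poch x n.+1 = x * poch (x + 1) n.
Proof.
rewrite /poch big_ord_recl addr0; congr (_ * _); apply: eq_bigr => i _.
by rewrite /bump /= -addrA nat1r.
Qed.

Lemma pochD x m n : poch x (m + n) = poch x m * poch (x + m%:R) n.
Proof.
elim: n => [|n IHn]; first by rewrite addn0 poch0 mulr1.
by rewrite addnS !pochSr IHn natrD addrA mulrA.
Qed.

(* Chu-Vandermonde. *)
Lemma poch_vandermonde x m p :
  poch (x + m%:R) p =
  \sum_(j < p.+1) ('C(p, j) * m ^_ j)%:R * poch (x + j%:R) (p - j).
Proof.
elim: p x => [|p IHp] x; first by rewrite big_ord1 /= bin0 ffactn0 !poch0 mulr1.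
rewrite pochSl addrAC IHp mulr_sumr.
(* Split [x + m] as [(x + j) + (m - j)]: the first summand extends the rising factorial, the second
   the falling one. Pascal's rule then recombines the two sums. *)
have stepE (j : 'I_p.+1) :
    (x + m%:R) * (('C(p, j) * m ^_ j)%:R * poch (x + 1 + j%:R) (p - j)) =
    ('C(p, j) * m ^_ j)%:R * poch (x + j%:R) (p.+1 - j) +
    ('C(p, j) * m ^_ j.+1)%:R * poch (x + j.+1%:R) (p.+1 - j.+1).
  rewrite subSS subSn -1?ltnS// pochSl.
  have -> : x + j.+1%:R = x + 1 + j%:R by rewrite -addrA nat1r.
  have -> : x + j%:R + 1 = x + 1 + j%:R by rewrite addrAC.
  rewrite mulrA [in RHS]mulrA -[RHS]mulrDl; congr (_ * _).
  have [jm|mj] := leqP j m; last by rewrite !ffact_small ?muln0 ?mul0r ?mulr0 ?addr0// ltnW.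
  by rewrite ffactnSr !natrM natrB//; ring.
rewrite (eq_bigr _ (fun (j : 'I_p.+1) _ => stepE j)) big_split/=.
rewrite big_ord_recl/= [RHS]big_ord_recl/= !bin0 -addrA; congr (_ + _).
under [X in X + _]eq_bigr do rewrite /bump/= add1n.
rewrite [X in _ + X]big_ord_recr/= [RHS]big_ord_recr/= addrA; congr (_ + _).
  rewrite -big_split/=; apply: eq_bigr => j _.
  by rewrite /bump/= add1n binS mulnDl natrD mulrDl.
by rewrite /bump/= add1n !binn.
Qed.

(** Both sides are [y ^+ j] times the [j]-th derivative of [(1 + y) ^+ k]. *)
Lemma sum_bin_ffact k j y :
  \sum_(r < k.+1) ('C(k, r) * r ^_ j)%:R * y ^+ r =
  (k ^_ j)%:R * y ^+ j * (1 + y) ^+ (k - j).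
Proof.
have [jk|kj] := leqP j k; last first.
  rewrite (ffact_small kj) !mul0r big1// => r _.
  by rewrite (@ffact_small r j) ?muln0 ?mul0r// (leq_trans _ kj)// ltn_ord.
rewrite -(big_mkord xpredT (fun r => ('C(k, r) * r ^_ j)%:R * y ^+ r)).
rewrite (big_cat_nat _ (n := j)) ?leqW//= big1_seq ?add0r; last first.
  move=> r; rewrite mem_index_iota => /andP[_ rj].
  by rewrite ffact_small ?muln0 ?mul0r.
rewrite -{1}[j]add0n big_addn subSn// big_mkord.
rewrite -[1 + y]addrC exprDn mulr_sumr -[RHS](big_mkord xpredT
  (fun i => (k ^_ j)%:R * y ^+ j * (y ^+ (k - j - i) * 1 ^+ i *+ 'C(k - j, i)))).
rewrite big_nat_rev/= add0n big_mkord; apply: eq_bigr => i _.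
have ik : (i <= k - j)%N by rewrite -ltnS.
rewrite subSS subKn// expr1n mulr1 bin_sub// exprD.
(* Multiplied by the factorials of [i] and [k - j - i], both sides become the factorial of [k]. *)
have -> : ('C(k, i + j) * (i + j) ^_ j = k ^_ j * 'C(k - j, i))%N.
  apply/eqP; rewrite -(@eqn_pmul2r (i`! * (k - j - i)`!)); last by rewrite muln_gt0 !fact_gt0.
  have ijk : (i + j <= k)%N by lia.
  have e1 := bin_fact ijk; have e2 := bin_fact ik.
  have e3 := ffact_fact (leq_addl i j); have e4 := ffact_fact jk.
  have e5 : (k - (i + j) = k - j - i)%N by lia.
  rewrite addnK in e3; rewrite e5 in e1.
  apply/eqP; rewrite -[RHS]mulnA [('C(k - j, i) * _)%N]e2 e4 -{}e1 -{}e3; lia.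
by rewrite natrM -mulr_natr; ring.
Qed.

End Pochhammer.

(** * Dominated convergence, Cauchy-Schwarz and completeness of L^2 over a general measure *)

Section IntegrationGeneral.
Context d {T : measurableType d} {R : realType}.
Variables (mu : {measure set T -> \bar R}) (D : set T).
Hypothesis mD : measurable D.

Lemma Rintegral_dominated_cvg (f_ : nat -> T -> R) (f g : T -> R) :
  (forall n, measurable_fun D (f_ n)) ->
  (forall x, D x -> f_ ^~ x @ \oo --> f x) ->
  mu.-integrable D (EFin \o g) ->
  (forall n x, D x -> `|f_ n x| <= g x) ->
  mu.-integrable D (EFin \o f) /\
  (\int[mu]_(x in D) f_ n x) @[n --> \oo] --> \int[mu]_(x in D) f x.
Proof.
move=> mf_ f_f ig fg.
have mf : measurable_fun D f by exact: measurable_fun_cvg f_f.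
have [intf _ cv] : [/\ mu.-integrable D (EFin \o f),
    [sequence (\int[mu]_(x in D) `|(f_ n x)%:E - (EFin \o f) x|)%E]_n @ \oo --> 0%E &
    [sequence (\int[mu]_(x in D) (f_ n x)%:E)%E]_n @ \oo -->
    (\int[mu]_(x in D) (EFin \o f) x)%E].
  apply: (dominated_convergence mD _ _ _ ig).
  - by move=> n; exact/measurable_EFinP.
  - exact/measurable_EFinP.
  - by apply: aeW => x Dx; apply: cvg_EFin; [exact: nearW|exact: f_f].
  - by apply: aeW => x n Dx; rewrite lee_fin fg.
split => //; apply: fine_cvg; rewrite fineK; first exact: cv.
exact: (integrable_fin_num mD intf).
Qed.

Lemma integrable_le (f g : T -> R) : measurable_fun D f ->
  (forall x, D x -> `|f x| <= g x) -> mu.-integrable D (EFin \o g) ->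
  mu.-integrable D (EFin \o f).
Proof.
move=> mf fg; apply: le_integrable => //; first exact/measurable_EFinP.
by move=> x Dx /=; rewrite lee_fin (le_trans (fg x Dx))// ler_norm.
Qed.

Lemma integrable_measurable (f : T -> R) :
  mu.-integrable D (EFin \o f) -> measurable_fun D f.
Proof. by move=> /(measurable_int mu)/measurable_EFinP. Qed.

Lemma integrable_ge0P (f : T -> R) : measurable_fun D f ->
  (forall x, D x -> 0 <= f x) ->
  mu.-integrable D (EFin \o f) <-> (\int[mu]_(x in D) (f x)%:E < +oo)%E.
Proof.
move=> mf f0; have e : (\int[mu]_(x in D) (f x)%:E = \int[mu]_(x in D) `|(EFin \o f) x|)%E.
  by apply: eq_integral => x /set_mem Dx /=; rewrite ger0_norm// f0.
split => [/integrableP[_]|h]; first by rewrite e.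
by apply/integrableP; split; [exact/measurable_EFinP|rewrite -e].
Qed.

Lemma EFin_Rintegral (f : T -> R) : mu.-integrable D (EFin \o f) ->
  (\int[mu]_(x in D) (f x)%:E)%E = (\int[mu]_(x in D) f x)%:E.
Proof. by move=> fi; rewrite fineK//; exact: (integrable_fin_num mD fi). Qed.

(** Evaluate at the minimum [b / a]. If [a = 0] the function is affine, and for [b != 0] the point
    [(c + 1) / (2 * b)] gives it the value -1. *)
Lemma sqr_le_of_quadratic_ge0 (a b c : R) : 0 <= a -> 0 <= c ->
  (forall x, 0 <= a * x ^+ 2 - 2 * b * x + c) -> b ^+ 2 <= a * c.
Proof.
move=> a0 c0 h; have [a00|an0] := eqVneq a 0.
  have [->|bn0] := eqVneq b 0; first by rewrite expr0n mulr_ge0.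
  have := h ((c + 1) / (2 * b)).
  by have -> : a * ((c + 1) / (2 * b)) ^+ 2 - 2 * b * ((c + 1) / (2 * b)) + c = - 1;
    [rewrite a00; field|lra].
have ap : 0 < a by rewrite lt_def an0.
have := h (b / a).
have -> : a * (b / a) ^+ 2 - 2 * b * (b / a) + c = c - b ^+ 2 / a by field.
by rewrite subr_ge0 ler_pdivrMr// mulrC.
Qed.

(** The discriminant criterion applies to the integral of [(y |f| - |g|)^2 w] as a quadratic in [y].
    With absolute values inside, the lemma also provides the integrability of the signed product. *)
Lemma Rintegral_cauchy_schwarz (f g w : T -> R) :
  measurable_fun D f -> measurable_fun D g -> measurable_fun D w ->
  (forall x, D x -> 0 <= w x) ->
  mu.-integrable D (EFin \o (fun x => f x ^+ 2 * w x)) ->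
  mu.-integrable D (EFin \o (fun x => g x ^+ 2 * w x)) ->
  mu.-integrable D (EFin \o (fun x => `|f x| * `|g x| * w x)) /\
  (\int[mu]_(x in D) (`|f x| * `|g x| * w x)) ^+ 2 <=
  (\int[mu]_(x in D) (f x ^+ 2 * w x)) * (\int[mu]_(x in D) (g x ^+ 2 * w x)).
Proof.
move=> mf mg mw w0 i_f ig.
have ifg : mu.-integrable D (EFin \o (fun x => `|f x| * `|g x| * w x)).
  apply: (@integrable_le _ (fun x => f x ^+ 2 * w x + g x ^+ 2 * w x)).
  - by do 2 apply: measurable_funM => //; exact: measurableT_comp.
  - move=> x Dx; rewrite !normrM !normr_id (ger0_norm (w0 x Dx)) -mulrDl.
    apply: ler_wpM2r; first exact: w0.
    rewrite -(real_normK (num_real (f x))) -(real_normK (num_real (g x))).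
    by have := sqr_ge0 (`|f x| - `|g x|); nra.
  - exact: (integrableD mD i_f ig).
split => //; apply: sqr_le_of_quadratic_ge0.
- by apply: Rintegral_ge0 => x Dx; rewrite mulr_ge0 ?sqr_ge0 ?w0.
- by apply: Rintegral_ge0 => x Dx; rewrite mulr_ge0 ?sqr_ge0 ?w0.
move=> y; set A := \int[mu]_(x in D) (f x ^+ 2 * w x).
have -> : A * y ^+ 2 - 2 * (\int[mu]_(x in D) (`|f x| * `|g x| * w x)) * y +
   \int[mu]_(x in D) (g x ^+ 2 * w x) =
   \int[mu]_(x in D) (y ^+ 2 * (f x ^+ 2 * w x) - (2 * y) * (`|f x| * `|g x| * w x)
     + g x ^+ 2 * w x).
  have i1 : mu.-integrable D (EFin \o (fun x => y ^+ 2 * (f x ^+ 2 * w x))).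
    exact: (integrableZl mD _ i_f).
  have i2 : mu.-integrable D (EFin \o (fun x => (2 * y) * (`|f x| * `|g x| * w x))).
    exact: (integrableZl mD _ ifg).
  rewrite RintegralD//; last exact: (integrableB mD i1 i2).
  by rewrite RintegralB// !RintegralZl// /A; ring.
apply: Rintegral_ge0 => x Dx.
rewrite -(real_normK (num_real (f x))) -(real_normK (num_real (g x))).
have -> : y ^+ 2 * (`|f x| ^+ 2 * w x) - 2 * y * (`|f x| * `|g x| * w x) + `|g x| ^+ 2 * w x
  = (y * `|f x| - `|g x|) ^+ 2 * w x by ring.
by rewrite mulr_ge0 ?sqr_ge0 ?w0.
Qed.

(* Riesz-Fischer: along a rapidly Cauchy subsequence [n_] the series of
   [4 ^ j * (u (n_ j.+1) - u (n_ j)) ^ 2] has a finite integral, whence almost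
   everywhere convergence; Fatou's lemma turns it into convergence in L^2. *)
Lemma L2_complete (u : nat -> T -> R) :
  (forall n, measurable_fun D (u n)) ->
  (forall e : R, 0 < e -> exists N, forall m n, (N <= m)%N -> (N <= n)%N ->
     (\int[mu]_(x in D) ((u m x - u n x) ^+ 2)%:E <= e%:E)%E) ->
  exists v : T -> R, measurable_fun D v /\
    forall e : R, 0 < e -> exists N, forall n, (N <= n)%N ->
     (\int[mu]_(x in D) ((v x - u n x) ^+ 2)%:E <= e%:E)%E.
Proof.
move=> mu_ cu.
(* With [8 ^- j] as the bound on squared distances, the factor [4 ^+ j] still leaves the summable
   [2 ^- j]. *)
have c8 (j : nat) : 0 < ((8 : R) ^+ j)^-1 by rewrite invr_gt0 exprn_gt0.
have [N HN] := choice (fun j => cu _ (c8 j)).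
(* Summing the successors of the [N i] gives a nondecreasing sequence above both [N j] and [j]. *)
pose n_ j := (\sum_(i < j.+1) (N i).+1)%N.
have nN j : (N j <= n_ j)%N by rewrite /n_ big_ord_recr/= (leq_trans _ (leq_addl _ _)).
have jn j : (j <= n_ j)%N.
  by rewrite /n_; elim: j => // j IHj; rewrite big_ord_recr/= addnS ltnS (leq_trans IHj)// leq_addr.
have n_mono i j : (i <= j)%N -> (n_ i <= n_ j)%N.
  move=> /subnK <-; elim: (j - i)%N => //= k; rewrite addSn => /leq_trans; apply.
  by rewrite /n_ [leqRHS]big_ord_recr/= leq_addr.
have md m n : measurable_fun D (fun x => (u m x - u n x) ^+ 2).
  by apply: measurable_funX; exact: measurable_funB.
pose G x := (\sum_(0 <= j <oo) (4 ^+ j * (u (n_ j.+1) x - u (n_ j) x) ^+ 2)%:E)%E.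
have mt j : measurable_fun D (fun x => (4 ^+ j * (u (n_ j.+1) x - u (n_ j) x) ^+ 2)%:E).
  by apply/measurable_EFinP; exact: measurable_funM.
have t0 j x : (0 <= (4 ^+ j * (u (n_ j.+1) x - u (n_ j) x) ^+ 2)%:E)%E.
  by rewrite lee_fin mulr_ge0 ?sqr_ge0 ?exprn_ge0.
have mG : measurable_fun D G by exact: ge0_emeasurable_sum.
have G0 x : (0 <= G x)%E by apply: nneseries_ge0.
have iG : mu.-integrable D G.
  apply/integrableP; split => //.
  under eq_integral do rewrite gee0_abs//.
  rewrite /G integral_nneseries//.
  apply: (@le_lt_trans _ _ (\sum_(0 <= i <oo) (2 / (2 ^ i.+1)%:R)%:E)%E); last first.
    exact: (le_lt_trans (epsilon_trick0 _ _) (ltry _)).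
  apply: lee_nneseries => [i _ _|j _]; first exact: integral_ge0.
  under eq_integral do rewrite EFinM.
  rewrite ge0_integralZl_EFin ?exprn_ge0//; last 2 first.
  - by move=> x _; rewrite lee_fin sqr_ge0.
  - exact/measurable_EFinP.
  apply: (@le_trans _ _ ((4 ^+ j)%:E * (((8 : R) ^+ j)^-1)%:E)%E).
    apply: lee_wpmul2l; first by rewrite lee_fin exprn_ge0.
    by apply: HN; [exact: leq_trans (nN j) (n_mono _ _ (leqnSn j))|exact: nN].
  rewrite -EFinM lee_fin natrX exprS invfM mulrA divff ?mul1r//.
  rewrite (_ : (8 : R) = 4 * 2); last by rewrite -natrM.
  by rewrite exprMn invfM mulrA divff ?mul1r// expf_neq0.
have aeu : {ae mu, forall x, D x -> cvgn (fun j => u (n_ j) x)}.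
  have := integrable_ae mD iG; apply: filterS => x Gfin Dx.
  pose del j := u (n_ j.+1) x - u (n_ j) x.
  have delE k : \sum_(0 <= j < k) del j = u (n_ k) x - u (n_ 0) x.
    by rewrite telescope_sumr.
  have cd : cvgn (series del).
    apply: normed_cvg; apply: nondecreasing_is_cvgn.
      apply: nondecreasing_series => k _ _; exact: normr_ge0.
    exists (2 + fine (G x)) => _ [k _ <-].
    rewrite /series/=.
    (* For [x = 2 ^+ j * |del j|] this is termwise [x <= 1 + 2 ^+ j * x ^+ 2]; both resulting series
       converge, the second to [G x]. *)
    apply: (@le_trans _ _ (\sum_(0 <= j < k) ((2 : R) / (2 ^ j.+1)%:R + 4 ^+ j * del j ^+ 2))).
      apply: ler_sum_nat => j _.
      rewrite natrX exprS invfM mulrA divff ?mul1r//.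
      have p2 : 0 < (2 : R) ^+ j by rewrite exprn_gt0.
      rewrite (_ : (4 : R) = 2 * 2); last by rewrite -natrM.
      rewrite exprMn -(ler_pM2l p2) mulrDr divff ?gt_eqF// -(real_normK (num_real (del j))).
      set a := `|del j|; have a0 : 0 <= a by exact: normr_ge0.
      have -> : 2 ^+ j * (2 ^+ j * 2 ^+ j * a ^+ 2) = 2 ^+ j * (2 ^+ j * a) ^+ 2 by ring.
      have p1 : 1 <= (2 : R) ^+ j by rewrite exprn_ege1// ler1n.
      have : 0 <= (2 ^+ j * a) ^+ 2 by exact: sqr_ge0.
      by have := sqr_ge0 (2 ^+ j * a - 1); nra.
    rewrite big_split/= lerD//.
      have := @epsilon_trick0 R 2 xpredT; rewrite -lee_fin => /(_ (ler0n _ _)).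
      apply: le_trans; rewrite -sumEFin.
      by apply: nneseries_lim_ge => i _ _; rewrite lee_fin divr_ge0.
    rewrite -lee_fin fineK ?Gfin// -sumEFin.
    by apply: nneseries_lim_ge => i _ _; exact: t0.
  suff -> : (fun j => u (n_ j) x) = (fun k => series del k + u (n_ 0) x).
    by apply: is_cvgD => //; exact: is_cvg_cst.
  by apply/funext => k; rewrite /series/= delE subrK.
(* The upper limit is measurable on all of [D], including the points where the subsequence
   diverges. *)
pose v x := fine (limn_esup (fun j => (u (n_ j) x)%:E)).
have mv : measurable_fun D v.
  apply: (measurableT_comp (fine_measurable measurableT)).
  by apply: measurable_fun_limn_esup => j; exact/measurable_EFinP.
have aev : {ae mu, forall x, D x -> (fun j => u (n_ j) x) @ \oo --> v x}.
  move: aeu; apply: filterS => x /[apply] /cvg_ex[l ul].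
  suff -> : v x = l by [].
  have ul' : (fun j => (u (n_ j) x)%:E) @ \oo --> l%:E.
    by apply: cvg_EFin => //; exact: nearW.
  by rewrite /v is_cvg_limn_esupE; [rewrite (cvg_lim _ ul')|apply/cvg_ex; exists l%:E].
exists v; split => // e e0; have [M HM] := cu e e0; exists M => n Mn.
pose h k x := ((u (n_ (M + k)%N) x - u n x) ^+ 2)%:E.
have mh k : measurable_fun D (h k) by exact/measurable_EFinP.
(* Fatou's lemma along the subsequence shifted by [M]: all its indices are at least [M], so the
   Cauchy bound [HM] holds for every term. *)
apply: (@le_trans _ _ (\int[mu]_(x in D) limn_einf (h ^~ x))%E).
  apply: ae_ge0_le_integral => //.
  - by move=> x _; rewrite lee_fin sqr_ge0.
  - by apply/measurable_EFinP; apply: measurable_funX; exact: measurable_funB.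
  - move=> x Dx; rewrite limn_einf_lim; apply: lime_ge; first exact: is_cvg_einfs.
    apply: nearW => k; apply: le_ereal_inf_tmp => _ [m /= _ <-].
    by rewrite lee_fin sqr_ge0.
  - under eq_fun do rewrite limn_einf_lim.
    apply: (emeasurable_fun_cvg (fun k x => einfs (h ^~ x) k)).
      by move=> k; exact: measurable_fun_einfs.
    by move=> x Dx; exact: is_cvg_einfs.
  - move: aev; apply: filterS => x /[apply] cx.
    have cx' : h ^~ x @ \oo --> ((v x - u n x) ^+ 2)%:E.
      apply: cvg_EFin; first exact: nearW.
      have cM : (fun k => u (n_ (M + k)%N) x) @ \oo --> v x.
        rewrite -(cvg_shiftn M) in cx.
        by rewrite (_ : (fun k => _) = (fun k => u (n_ (k + M)%N) x))//; apply/funext => k; rewrite addnC.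
      have c1 : (fun k => u (n_ (M + k)%N) x - u n x) @ \oo --> v x - u n x.
        by apply: cvgB => //; exact: cvg_cst.
      exact: (cvgM c1 c1).
    by rewrite is_cvg_limn_einfE ?(cvg_lim _ cx')//; apply/cvg_ex; eexists; exact: cx'.
apply: (le_trans (fatou mu mD mh _)).
  by move=> k x Dx; rewrite lee_fin sqr_ge0.
rewrite limn_einf_lim; apply: lime_le; first exact: is_cvg_einfs.
apply: nearW => k; apply: (@le_trans _ _ (\int[mu]_(x in D) h k x)%E).
  by apply: ereal_inf_lbound; exists k => /=.
by apply: HM => //; rewrite (leq_trans _ (jn _))// leq_addr.
Qed.

End IntegrationGeneral.

(** * Integrals over the positive half-line *)

Section HalfLine.
Context {R : realType}.
Implicit Types (a b p t : R).
Local Notation mu := (@lebesgue_measure R).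
Local Notation ible f := (mu.-integrable Rpos (EFin \o f)).

Lemma measurable_Rpos : measurable (Rpos : set (measurableTypeR R)).
Proof. exact: measurable_itv. Qed.
Hint Resolve measurable_Rpos : core.

Lemma RposE t : Rpos t = (0 < t) :> Prop.
Proof. by rewrite /Rpos/= in_itv/= andbT. Qed.

Lemma continuous_measurable_Rpos (f : R -> R) :
  (forall t, 0 < t -> {for t, continuous f}) -> measurable_fun Rpos f.
Proof.
move=> cf; apply: open_continuous_measurable_fun; first exact: interval_open.
by move=> t /set_mem; rewrite RposE => /cf.
Qed.

Lemma is_derive_continuous (F : R -> R) (x d : R) :
  is_derive x 1 F d -> {for x, continuous F}.
Proof. by move=> [dF _]; exact/differentiable_continuous/derivable1_diffP. Qed.

(** The half-line is exhausted by the compact intervals [[1/(n+2), n+2]]; the shift by 2 makes them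
    nondegenerate already for [n = 0]. *)
Let lo (n : nat) : R := n.+2%:R^-1.
Let hi (n : nat) : R := n.+2%:R.

Let lo_gt0 n : 0 < lo n. Proof. by rewrite invr_gt0. Qed.

Let lo_hi n : lo n < hi n.
Proof.
by rewrite /lo /hi (@lt_trans _ _ 1)// ?ltr1n// invf_lt1 ?ltr0n// ltr1n.
Qed.

Let mem_exhaust t : 0 < t -> \forall n \near \oo, `[lo n, hi n]%classic t.
Proof.
move=> t0; near=> n; rewrite /= in_itv/=; apply/andP; split.
  have : t^-1 <= n%:R by near: n; exact: nbhs_infty_ger.
  move=> h; rewrite /lo -[leRHS]invrK lef_pV2 ?posrE ?invr_gt0//.
  by rewrite (le_trans h)// ler_nat !leqW.
have : t <= n%:R by near: n; exact: nbhs_infty_ger.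
by move=> h; rewrite (le_trans h)// ler_nat !leqW.
Unshelve. all: by end_near. Qed.

Let FTC_compact (F f : R -> R) n :
  (forall t, 0 < t -> is_derive t 1 F (f t)) ->
  (forall t, 0 < t -> {for t, continuous f}) ->
  (\int[mu]_(t in Rpos) ((f \_ `[lo n, hi n]) t)%:E = (F (hi n))%:E - (F (lo n))%:E)%E.
Proof.
move=> dF cf.
have pos t : `[lo n, hi n]%classic t -> 0 < t.
  by rewrite /= in_itv/= => /andP[+ _]; exact: lt_le_trans.
rewrite -[LHS](_ : (\int[mu]_(t in Rpos `&` `[lo n, hi n]) (f t)%:E)%E = _); last first.
  by rewrite integral_mkcondr; apply: eq_integral => t _; rewrite restrict_EFin.
rewrite setIidr; last by move=> t /pos; rewrite RposE.
apply: continuous_FTC2 => //.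
- apply: continuous_in_subspaceT => t /set_mem/pos t0; exact: cf.
- split.
  + move=> t; rewrite in_itv/= => /andP[lt _].
    by have [] := dF t (lt_trans (lo_gt0 n) lt).
  + apply: cvg_at_right_filter; exact: (is_derive_continuous (dF _ (lo_gt0 n))).
  + apply: cvg_at_left_filter.
    exact: (is_derive_continuous (dF _ (lt_trans (lo_gt0 n) (lo_hi n)))).
- move=> t; rewrite in_itv/= => /andP[lt _]; rewrite derive1E.
  by have [_] := dF t (lt_trans (lo_gt0 n) lt).
Qed.

Let patch_cvg (f : R -> R) t : 0 < t -> (fun n => (f \_ `[lo n, hi n]) t) @ \oo --> f t.
Proof.
move=> t0; apply: cvg_near_cst.
apply: filterS (mem_exhaust t0) => n tn.
by rewrite patchE mem_set.
Qed.

Let measurable_patch (f : R -> R) n : measurable_fun Rpos f ->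
  measurable_fun Rpos (f \_ `[lo n, hi n]).
Proof.
move=> mf; apply/measurable_restrict => //.
by apply: measurable_funS mf => //; exact: subIsetr.
Qed.

(** On each interval of the exhaustion the integral is a difference of two values of [F], hence at
    most [B + B]; Fatou's lemma passes to the limit. *)
Lemma integrable_bounded_primitive (F f : R -> R) (B : R) :
  (forall t, 0 < t -> is_derive t 1 F (f t)) ->
  (forall t, 0 < t -> {for t, continuous f}) ->
  (forall t, 0 < t -> 0 <= f t) ->
  (forall t, 0 < t -> `|F t| <= B) -> ible f.
Proof.
move=> dF cf f0 FB; have mf := continuous_measurable_Rpos cf.
apply/(integrable_ge0P mu mf); first by move=> t; rewrite RposE; exact: f0.
apply: (@le_lt_trans _ _ (B + B)%:E); last exact: ltry.
pose h n t := ((f \_ `[lo n, hi n]) t)%:E.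
have h0 n t : Rpos t -> (0 <= h n t)%E.
  rewrite RposE => t0; rewrite lee_fin patchE; case: ifP => // _; exact: f0.
have mh n : measurable_fun Rpos (h n) by apply/measurable_EFinP; exact: measurable_patch.
have -> : (\int[mu]_(t in Rpos) (f t)%:E = \int[mu]_(t in Rpos) limn_einf (h ^~ t))%E.
  apply: eq_integral => t /set_mem; rewrite RposE => t0.
  have ct : h ^~ t @ \oo --> (f t)%:E.
    by apply: cvg_EFin; [exact: nearW|exact: patch_cvg].
  by rewrite is_cvg_limn_einfE ?(cvg_lim _ ct)//; apply/cvg_ex; eexists; exact: ct.
apply: (le_trans (fatou mu measurable_Rpos mh h0)).
rewrite limn_einf_lim; apply: lime_le; first exact: is_cvg_einfs.
apply: nearW => n; apply: (@le_trans _ _ (\int[mu]_(t in Rpos) h n t)%E).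
  by apply: ereal_inf_lbound; exists n => /=.
rewrite (FTC_compact _ dF cf) -EFinB lee_fin.
rewrite (le_trans (ler_norm _))// (le_trans (ler_normB _ _))// lerD// FB//.
Qed.

Lemma Rintegral_FTC_Rpos (F f : R -> R) (A B : R) :
  (forall t, 0 < t -> is_derive t 1 F (f t)) ->
  (forall t, 0 < t -> {for t, continuous f}) ->
  ible f -> F t @[t --> 0^'+] --> A -> F t @[t --> +oo] --> B ->
  \int[mu]_(t in Rpos) f t = B - A.
Proof.
move=> dF cf i_f FA FB; have mf := integrable_measurable i_f.
have [_ c1] : ible f /\ (\int[mu]_(t in Rpos) (f \_ `[lo n, hi n]) t) @[n --> \oo] -->
    \int[mu]_(t in Rpos) f t.
  refine (Rintegral_dominated_cvg measurable_Rpos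
    (f_ := fun n => f \_ `[lo n, hi n]) (g := fun t => `|f t|) _ _ _ _).
  - by move=> n; exact: measurable_patch.
  - by move=> t; rewrite RposE; exact: patch_cvg.
  - exact: (integrable_norm i_f).
  - by move=> n t _; rewrite patchE; case: ifP => // _; rewrite normr0.
have c2 : (fun n => F (hi n) - F (lo n)) @ \oo --> B - A.
  apply: cvgB.
    move/cvg_pinftyP: FB; apply.
    apply/cvgryPge => r; near=> n.
    have : r <= n%:R by near: n; exact: nbhs_infty_ger.
    by move=> h; rewrite (le_trans h)// ler_nat !leqW.
  move/cvg_at_rightP: FA; apply; split; first exact: lo_gt0.
  apply/cvgrPdist_le => e e0; near=> n.
  rewrite sub0r normrN ger0_norm ?invr_ge0// -[leRHS]invrK lef_pV2 ?posrE ?invr_gt0//.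
  have : e^-1 <= n%:R by near: n; exact: nbhs_infty_ger.
  by move=> h; rewrite (le_trans h)// ler_nat !leqW.
have e : (fun n => \int[mu]_(t in Rpos) (f \_ `[lo n, hi n]) t) =
    (fun n => F (hi n) - F (lo n)).
  by apply/funext => n; rewrite /Rintegral (FTC_compact _ dF cf).
by rewrite e in c1; exact: (cvg_unique _ c1 c2).
Unshelve. all: by end_near. Qed.

Lemma powR_le_expR p b : 0 < b -> 0 < p ->
  exists2 C, 0 < C & forall t, 0 < t -> (1 + t) `^ p <= C * expR (b * t).
Proof.
(* This constant comes from [ln u < u] at [u = (1 + t) / (p / b)], where [p * u] is
   [b * (1 + t)]. *)
move=> b0 p0; exists (expR (b + p * ln (p / b))); first exact: expR_gt0.
move=> t t0; have t1 : 0 < 1 + t by rewrite addr_gt0.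
rewrite /powR gt_eqF// -expRD ler_expR.
have pb : 0 < p / b by rewrite divr_gt0.
have bp : 0 < (1 + t) / (p / b) by rewrite divr_gt0.
have -> : ln (1 + t) = ln ((1 + t) / (p / b)) + ln (p / b).
  by rewrite -lnM ?posrE// divfK// gt_eqF.
have := ln_sublinear bp; set l := ln _ => h.
have : p * l <= p * ((1 + t) / (p / b)) by rewrite ler_pM2l// ltW.
have -> : p * ((1 + t) / (p / b)) = b * (1 + t).
  by field; rewrite !gt_eqF.
by set m := ln (p / b); lra.
Qed.

Lemma continuous_powR_expR a b t : 0 < t ->
  {for t, continuous (fun t => t `^ a * expR (- (b * t)))}.
Proof.
move=> t0; apply: cvgM.
  exact: (is_derive_continuous (is_derive1_powR a t0)).
apply: (@continuous_comp _ _ _ (fun t => - (b * t)) expR); last exact: continuous_expR.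
by apply: cvgN; apply: cvgMl_tmp; exact: cvg_id.
Qed.

(** One comparison handles both ends of the half-line: [H] is [(t / (1 + t))^a], bounded by 1, and
    its derivative [a t^(a-1) / (1 + t)^(a+1)] dominates the integrand up to a constant by
    [powR_le_expR]. *)
Lemma integrable_powR_expR a b : 0 < a -> 0 < b ->
  ible (fun t => t `^ (a - 1) * expR (- (b * t))).
Proof.
move=> a0 b0; have a1 : 0 < a + 1 by rewrite addr_gt0.
have [C C0 HC] := powR_le_expR b0 a1.
pose H t := expR (a * (ln t - ln (1 + t))).
pose h t := expR (a * (ln t - ln (1 + t))) * (a * (t^-1 - (1 + t)^-1)).
have dH t : 0 < t -> is_derive t 1 H (h t).
  move=> t0; have t1 : 0 < 1 + t by rewrite addr_gt0.
  rewrite /H /h.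
  apply: is_derive1_comp.
  have d1 : is_derive t (1 : R) (fun x : R => 1 + x) 1.
    by apply: is_derive_eq; rewrite add0r mulr1.
  have d2 : is_derive t (1 : R) (fun x : R => ln (1 + x)) (1 + t)^-1.
    by apply: (is_derive_eq (is_derive1_comp (is_derive1_ln t1) d1)); rewrite mulr1.
  have d3 : is_derive t (1 : R) (fun x : R => ln x - ln (1 + x)) (t^-1 - (1 + t)^-1).
    exact: (is_deriveB (is_derive1_ln t0) d2).
  exact: (is_deriveZ a d3).
have ch t : 0 < t -> {for t, continuous h}.
  move=> t0; have t1 : 0 < 1 + t by rewrite addr_gt0.
  have c0 : {for t, continuous (fun t => 1 + t : R)} by apply: cvgD; [exact: cvg_cst|exact: cvg_id].
  apply: cvgM; first exact: (is_derive_continuous (dH t t0)).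
  apply: cvgMl_tmp; apply: cvgB; first by apply: cvgV; [rewrite gt_eqF|exact: cvg_id].
  by apply: cvgV; [rewrite gt_eqF|exact: c0].
have le1 t : 0 < t -> ln t - ln (1 + t) <= 0.
  by move=> t0; rewrite subr_le0 ler_ln ?posrE ?addr_gt0// lerDr.
have h0 t : 0 < t -> 0 <= h t.
  move=> t0; rewrite mulr_ge0 ?expR_ge0// mulr_ge0 ?(ltW a0)// subr_ge0.
  by rewrite lef_pV2 ?posrE ?addr_gt0// lerDr.
have ih : ible h.
  apply: (integrable_bounded_primitive (B := 1) dH ch h0) => t t0.
  by rewrite ger0_norm ?expR_ge0// -[leRHS]expR0 ler_expR pmulr_rle0// le1.
apply: (integrable_le measurable_Rpos (g := fun t => (C / a) * h t)).
- by apply: continuous_measurable_Rpos => t t0; exact: continuous_powR_expR.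
- move=> t; rewrite RposE => t0; have t1 : 0 < 1 + t by rewrite addr_gt0.
  rewrite ger0_norm ?mulr_ge0 ?powR_ge0 ?expR_ge0//.
  have -> : t `^ (a - 1) = t `^ a / t.
    by rewrite powRB ?powRr1 ?(ltW t0)//; apply/implyP => _; rewrite gt_eqF.
  have -> : h t = t `^ a / (1 + t) `^ a * (a * (t^-1 - (1 + t)^-1)).
    by rewrite /h mulrBr expRB /powR !gt_eqF.
  have := HC t t0; rewrite powRD ?powRr1 ?(ltW t1)//; last first.
    by apply/implyP => _; rewrite gt_eqF.
  have P0 : 0 < t `^ a by exact: powR_gt0.
  have Q0 : 0 < (1 + t) `^ a by exact: powR_gt0.
  rewrite expRN; set P := t `^ a; set Q := (1 + t) `^ a; set E := expR _ => QE.
  have E0 : 0 < E by exact: expR_gt0.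
  have -> : C / a * (P / Q * (a * (t^-1 - (1 + t)^-1))) = P / t * (C / (Q * (1 + t))).
    by field; rewrite !gt_eqF.
  rewrite ler_pM2l ?divr_gt0// -[leRHS]invrK lef_pV2 ?posrE ?invr_gt0 ?divr_gt0 ?mulr_gt0//.
  by rewrite invf_div ler_pdivrMr// [E * _]mulrC.
- exact: (integrableZl measurable_Rpos (C / a) ih).
Qed.

Lemma powR_expR_cvgy a b : 0 < a -> 0 < b ->
  t `^ a * expR (- (b * t)) @[t --> +oo] --> (0 : R).
Proof.
move=> a0 b0; have a1 : 0 < a + 1 by rewrite addr_gt0.
have [C C0 HC] := powR_le_expR b0 a1.
apply/cvgrPdist_le => e e0; near=> t.
have t0 : 0 < t by near: t; apply: nbhs_pinfty_gt; rewrite num_real.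
have t1 : 0 < 1 + t by rewrite addr_gt0.
rewrite sub0r normrN ger0_norm ?mulr_ge0 ?powR_ge0 ?expR_ge0//.
have tC : C / e <= t by near: t; apply: nbhs_pinfty_ge; rewrite num_real.
have h1 : t `^ a <= (1 + t) `^ a.
  by apply: ge0_ler_powR; rewrite ?nnegrE ?ltW// ltrDr.
have := HC t t0; rewrite powRD ?powRr1 ?(ltW t1)//; last first.
  by apply/implyP => _; rewrite gt_eqF.
rewrite expRN ler_pdivrMr ?expR_gt0// => h2.
rewrite ler_pdivrMr// in tC.
rewrite -(ler_pM2r t1) (@le_trans _ _ ((1 + t) `^ a * (1 + t)))//.
  by rewrite ler_pM2r.
rewrite (le_trans h2)//; set E := expR _.
have E0 : 0 < E by exact: expR_gt0.
nra.
Unshelve. all: by end_near. Qed.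

End HalfLine.
#[export] Hint Resolve measurable_Rpos : core.

(** * Complex-valued sequences, series and integrals *)

Section ComplexIntegral.
Context {R : realType}.
Local Notation mu := (@lebesgue_measure R).
Local Notation ible f := (mu.-integrable Rpos (EFin \o f)).
Local Notation Re := (@complex.Re R).
Local Notation Im := (@complex.Im R).
Implicit Types (f g : R -> R[i]) (z : R[i]) (t : R).

Lemma cReM z1 z2 : Re (z1 * z2) = Re z1 * Re z2 - Im z1 * Im z2.
Proof. by case: z1 => a b; case: z2. Qed.

Lemma cImM z1 z2 : Im (z1 * z2) = Re z1 * Im z2 + Im z1 * Re z2.
Proof. by case: z1 => a b; case: z2 => c d /=; rewrite [b * c]mulrC. Qed.

Lemma cReD z1 z2 : Re (z1 + z2) = Re z1 + Re z2.
Proof. by case: z1 => a b; case: z2. Qed.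

Lemma cImD z1 z2 : Im (z1 + z2) = Im z1 + Im z2.
Proof. by case: z1 => a b; case: z2. Qed.

Lemma cReN z : Re (- z) = - Re z. Proof. by case: z. Qed.

Lemma cImN z : Im (- z) = - Im z. Proof. by case: z. Qed.

Lemma eq_complexP z1 z2 : Re z1 = Re z2 -> Im z1 = Im z2 -> z1 = z2.
Proof. by case: z1 => a b; case: z2 => c d /= -> ->. Qed.

Lemma cRe_sum (I : Type) (r : seq I) (P : pred I) (F : I -> R[i]) :
  Re (\sum_(i <- r | P i) F i) = \sum_(i <- r | P i) Re (F i).
Proof. by apply: (big_morph _ cReD). Qed.

Lemma cIm_sum (I : Type) (r : seq I) (P : pred I) (F : I -> R[i]) :
  Im (\sum_(i <- r | P i) F i) = \sum_(i <- r | P i) Im (F i).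
Proof. by apply: (big_morph _ cImD). Qed.

(* The l^1 norm of R^2: unlike the modulus it lives in R and is computed
   without square roots. *)
Definition norm1c z : R := `|Re z| + `|Im z|.

Lemma norm1c_ge0 z : 0 <= norm1c z.
Proof. by rewrite addr_ge0. Qed.

Lemma norm1cD z1 z2 : norm1c (z1 + z2) <= norm1c z1 + norm1c z2.
Proof.
rewrite /norm1c cReD cImD addrACA.
by apply: lerD; exact: ler_normD.
Qed.

Lemma norm1cM z1 z2 : norm1c (z1 * z2) <= norm1c z1 * norm1c z2.
Proof.
rewrite /norm1c cReM cImM.
apply: (@le_trans _ _ ((`|Re z1 * Re z2| + `|Im z1 * Im z2|) + (`|Re z1 * Im z2| + `|Im z1 * Re z2|))).
  by rewrite lerD ?ler_normD// ler_normB.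
by rewrite !normrM; lra.
Qed.

Lemma norm1c_real (a : R) : norm1c a%:C = `|a|.
Proof. by rewrite /norm1c/= normr0 addr0. Qed.

Lemma norm1c_sum (I : Type) (r : seq I) (P : pred I) (F : I -> R[i]) :
  norm1c (\sum_(i <- r | P i) F i) <= \sum_(i <- r | P i) norm1c (F i).
Proof.
elim/big_rec2 : _ => [|i x y _ h]; first by rewrite /norm1c/= normr0 addr0.
by rewrite (le_trans (norm1cD _ _))// lerD2l.
Qed.

Lemma normc_le_norm1c z : `|z| <= (norm1c z)%:C.
Proof.
case: z => a b; rewrite /norm1c/= normc_def lecR/=.
rewrite -[leRHS](ger0_norm (addr_ge0 (normr_ge0 a) (normr_ge0 b))) -sqrtr_sqr.
rewrite ler_sqrt ?sqr_ge0// -(real_normK (num_real a)) -(real_normK (num_real b)).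
by have := normr_ge0 a; have := normr_ge0 b; nra.
Qed.

Lemma cvg_complex (u v : nat -> R) (a b : R) :
  u @ \oo --> a -> v @ \oo --> b ->
  (fun n => u n +i* v n : R[i]^o) @ \oo --> (a +i* b : R[i]^o).
Proof.
move=> ua vb; apply/cvgrPdist_le => /= e e0.
have eE : e = (Re e)%:C.
  by move: e0; case: e => x y; rewrite ltcE/= => /andP[/eqP -> _].
have e'0 : 0 < Re e / 2 by rewrite divr_gt0//; move: e0; rewrite eE ltcR.
move/cvgrPdist_le : ua => /(_ _ e'0) ua.
move/cvgrPdist_le : vb => /(_ _ e'0) vb.
near=> n; apply: (le_trans (normc_le_norm1c _)).
rewrite eE lecR /norm1c/= [leRHS]splitr.
by apply: lerD; [near: n; exact: ua|near: n; exact: vb].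
Unshelve. all: by end_near. Qed.

Lemma cvg_complexP (s : nat -> R[i]) z :
  (fun n => Re (s n)) @ \oo --> Re z -> (fun n => Im (s n)) @ \oo --> Im z ->
  (s : nat -> R[i]^o) @ \oo --> (z : R[i]^o).
Proof.
move=> cr ci; have := cvg_complex cr ci.
suff -> : (fun n => Re (s n) +i* Im (s n)) = s by case: z {cr ci}.
by apply/funext => n; case: (s n).
Qed.

Lemma seriesRe (s : nat -> R[i]) n :
  Re (series (s : nat -> R[i]^o) n) = series (fun k => Re (s k)) n.
Proof. exact: cRe_sum. Qed.

Lemma seriesIm (s : nat -> R[i]) n :
  Im (series (s : nat -> R[i]^o) n) = series (fun k => Im (s k)) n.
Proof. exact: cIm_sum. Qed.

Lemma cseries_cvgP (s : nat -> R[i]) z :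
  series (fun n => Re (s n)) @ \oo --> Re z ->
  series (fun n => Im (s n)) @ \oo --> Im z -> cseries_cvg s z.
Proof.
move=> cr ci; apply: cvg_complexP.
  by under eq_fun do rewrite seriesRe.
by under eq_fun do rewrite seriesIm.
Qed.

Lemma cseries_cvg_unique (s : nat -> R[i]) z1 z2 :
  cseries_cvg s z1 -> cseries_cvg s z2 -> z1 = z2.
Proof. by move=> c1 c2; exact: (cvg_unique _ c1 c2). Qed.

Lemma csumE (s : nat -> R[i]) z : cseries_cvg s z -> csum s = z.
Proof. by move=> cs; exact: (cvg_lim _ cs). Qed.

Lemma csum_finite (s : nat -> R[i]) n : (forall i, (n <= i)%N -> s i = 0) ->
  csum s = \sum_(i < n) s i.
Proof.
move=> s0; apply: csumE; apply: cvg_near_cst; near=> k.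
have nk : (n <= k)%N by near: k; exact: nbhs_infty_ge.
rewrite /series/= (big_cat_nat (leq0n n) nk)//= [X in _ + X]big1_seq ?addr0 ?big_mkord//.
by move=> i; rewrite mem_index_iota => /andP[_ /andP[/s0]].
Unshelve. all: by end_near. Qed.

Definition cintegrable f := ible (fun t => Re (f t)) /\ ible (fun t => Im (f t)).

Lemma eq_cint f g : (forall t, 0 < t -> f t = g t) -> cint f = cint g.
Proof.
move=> fg; rewrite /cint; congr (_ +i* _); apply: eq_Rintegral => t /set_mem;
by rewrite RposE => /fg ->.
Qed.

Lemma eq_ible (f g : R -> R) : (forall t, 0 < t -> f t = g t) -> ible f -> ible g.
Proof.
move=> fg; apply: eq_integrable => // t /set_mem; rewrite RposE => /fg e.
by rewrite /= e.
Qed.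

Lemma eq_cintegrable f g : (forall t, 0 < t -> f t = g t) ->
  cintegrable f -> cintegrable g.
Proof. by move=> fg [fr fi]; split; [apply: eq_ible fr|apply: eq_ible fi] => t /fg ->. Qed.

Lemma ibleD (f g : R -> R) : ible f -> ible g -> ible (fun t => f t + g t).
Proof. by move=> i1 i2; exact: (integrableD measurable_Rpos i1 i2). Qed.

Lemma ibleB (f g : R -> R) : ible f -> ible g -> ible (fun t => f t - g t).
Proof. by move=> i1 i2; exact: (integrableB measurable_Rpos i1 i2). Qed.

Lemma ibleZ k (f : R -> R) : ible f -> ible (fun t => k * f t).
Proof. by move=> i1; exact: (integrableZl measurable_Rpos k i1). Qed.

Lemma cintegrableD f g : cintegrable f -> cintegrable g -> cintegrable (fun t => f t + g t).
Proof.
move=> [f1 f2] [g1 g2]; split.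
  by apply: eq_ible (ibleD f1 g1) => t _; rewrite cReD.
by apply: eq_ible (ibleD f2 g2) => t _; rewrite cImD.
Qed.

Lemma cintegrableZ z f : cintegrable f -> cintegrable (fun t => z * f t).
Proof.
move=> [f1 f2]; split.
  by apply: eq_ible (ibleB (ibleZ (Re z) f1) (ibleZ (Im z) f2)) => t _; rewrite cReM.
by apply: eq_ible (ibleD (ibleZ (Re z) f2) (ibleZ (Im z) f1)) => t _; rewrite cImM.
Qed.

Lemma cintD f g : cintegrable f -> cintegrable g ->
  cint (fun t => f t + g t) = cint f + cint g.
Proof.
move=> [f1 f2] [g1 g2]; rewrite /cint; apply: eq_complexP => /=.
  under eq_Rintegral do rewrite cReD.
  exact: (RintegralD measurable_Rpos f1 g1).
under eq_Rintegral do rewrite cImD.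
exact: (RintegralD measurable_Rpos f2 g2).
Qed.

Lemma cintZ z f : cintegrable f -> cint (fun t => z * f t) = z * cint f.
Proof.
move=> [f1 f2]; rewrite /cint; apply: eq_complexP => /=.
  under eq_Rintegral do rewrite cReM.
  rewrite (RintegralB measurable_Rpos (ibleZ _ f1) (ibleZ _ f2)).
  by rewrite (RintegralZl _ measurable_Rpos f1) (RintegralZl _ measurable_Rpos f2) cReM.
under eq_Rintegral do rewrite cImM.
rewrite (RintegralD measurable_Rpos (ibleZ _ f2) (ibleZ _ f1)).
by rewrite (RintegralZl _ measurable_Rpos f1) (RintegralZl _ measurable_Rpos f2) cImM.
Qed.

Lemma cintegrable0 : cintegrable (fun=> 0).
Proof. by split; exact: (integrable0 mu). Qed.

Lemma cint0 : cint (fun=> 0 : R[i]) = 0.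
Proof.
by rewrite /cint; apply: eq_complexP => /=; rewrite /Rintegral integral0.
Qed.

Lemma cintegrable_sum (I : Type) (r : seq I) (F : I -> R -> R[i]) :
  (forall i, cintegrable (F i)) -> cintegrable (fun t => \sum_(i <- r) F i t).
Proof.
move=> iF; elim: r => [|i r IHr].
  by apply: eq_cintegrable cintegrable0 => t _; rewrite big_nil.
by apply: eq_cintegrable (cintegrableD (iF i) IHr) => t _; rewrite big_cons.
Qed.

Lemma cint_sum (I : Type) (r : seq I) (F : I -> R -> R[i]) :
  (forall i, cintegrable (F i)) ->
  cint (fun t => \sum_(i <- r) F i t) = \sum_(i <- r) cint (F i).
Proof.
move=> iF; elim: r => [|i r IHr].
  by rewrite big_nil -[RHS]cint0; apply: eq_cint => t _; rewrite big_nil.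
rewrite big_cons -IHr -cintD//; last exact: cintegrable_sum.
by apply: eq_cint => t _; rewrite big_cons.
Qed.

Lemma cintegrable_real (f : R -> R) : ible f -> cintegrable (fun t => (f t)%:C).
Proof. by move=> i_f; split => //; exact: (integrable0 mu). Qed.

Lemma cint_real (f : R -> R) : cint (fun t => (f t)%:C) = (\int[mu]_(t in Rpos) f t)%:C.
Proof.
rewrite /cint; apply: eq_complexP => //=.
by rewrite /Rintegral integral0.
Qed.

Lemma cintegrable_le f (g : R -> R) :
  measurable_fun Rpos (fun t => Re (f t)) -> measurable_fun Rpos (fun t => Im (f t)) ->
  (forall t, 0 < t -> norm1c (f t) <= g t) -> ible g -> cintegrable f.
Proof.
move=> mr mi fg ig; split; apply: (integrable_le measurable_Rpos _ _ ig) => //.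
  move=> t; rewrite RposE => /fg; apply: le_trans.
  by rewrite /norm1c lerDl.
move=> t; rewrite RposE => /fg; apply: le_trans.
by rewrite /norm1c lerDr.
Qed.

Lemma norm1c_cint_le f (g : R -> R) : cintegrable f -> ible g ->
  (forall t, 0 < t -> norm1c (f t) <= g t) ->
  norm1c (cint f) <= \int[mu]_(t in Rpos) g t.
Proof.
move=> [f1 f2] ig fg; rewrite /norm1c/=.
apply: (@le_trans _ _ (\int[mu]_(t in Rpos) (`|Re (f t)| + `|Im (f t)|))).
  rewrite (RintegralD measurable_Rpos (integrable_norm f1) (integrable_norm f2)).
  by apply: lerD; apply: (le_normr_Rintegral measurable_Rpos).
apply: (le_Rintegral measurable_Rpos) => //.
  exact: ibleD (integrable_norm f1) (integrable_norm f2).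
by move=> t; rewrite RposE; exact: fg.
Qed.

Lemma cint_dominated_cvg (f_ : nat -> R -> R[i]) f (g : R -> R) :
  (forall n, measurable_fun Rpos (fun t => Re (f_ n t))) ->
  (forall n, measurable_fun Rpos (fun t => Im (f_ n t))) ->
  (forall t, 0 < t -> (fun n => Re (f_ n t)) @ \oo --> Re (f t)) ->
  (forall t, 0 < t -> (fun n => Im (f_ n t)) @ \oo --> Im (f t)) ->
  ible g -> (forall n t, 0 < t -> norm1c (f_ n t) <= g t) ->
  [/\ cintegrable f, (fun n => Re (cint (f_ n))) @ \oo --> Re (cint f) &
      (fun n => Im (cint (f_ n))) @ \oo --> Im (cint f)].
Proof.
move=> mr mi cr ci ig fg.
have [i1 c1] : ible (fun t => Re (f t)) /\
    (\int[mu]_(t in Rpos) Re (f_ n t)) @[n --> \oo] --> \int[mu]_(t in Rpos) Re (f t).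
  refine (Rintegral_dominated_cvg measurable_Rpos (f_ := fun n t => Re (f_ n t)) mr _ ig _).
    by move=> t; rewrite RposE; exact: cr.
  by move=> n t; rewrite RposE => /fg-/(_ n); apply: le_trans; rewrite /norm1c lerDl.
have [i2 c2] : ible (fun t => Im (f t)) /\
    (\int[mu]_(t in Rpos) Im (f_ n t)) @[n --> \oo] --> \int[mu]_(t in Rpos) Im (f t).
  refine (Rintegral_dominated_cvg measurable_Rpos (f_ := fun n t => Im (f_ n t)) mi _ ig _).
    by move=> t; rewrite RposE; exact: ci.
  by move=> n t; rewrite RposE => /fg-/(_ n); apply: le_trans; rewrite /norm1c lerDr.
by split.
Qed.

End ComplexIntegral.

(** * The Gamma function at complex and real arguments *)

Section GammaFunction.
Context {R : realType}.
Local Notation mu := (@lebesgue_measure R).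
Local Notation ible f := (mu.-integrable Rpos (EFin \o f)).
Local Notation Re := (@complex.Re R).
Local Notation Im := (@complex.Im R).
Implicit Types (z : R[i]) (a b y t : R).

Lemma rpowcE t z : 0 < t ->
  rpowc t z = t `^ Re z * cos (Im z * ln t) +i* (t `^ Re z * sin (Im z * ln t)).
Proof.
move=> t0; rewrite /rpowc /cexp /powR gt_eqF//.
by apply: eq_complexP;
  rewrite !(cReM, cImM)/= ?(mulr0, mul0r, addr0, subr0, add0r).
Qed.

(** The function [u] stands for the oscillating factor of [rpowc], the cosine or sine of a multiple
    of [ln t]. *)
Lemma integrable_powR_osc a b (u : R -> R) : 0 < a -> 0 < b ->
  (forall t, 0 < t -> {for t, continuous u}) -> (forall t, 0 < t -> `|u t| <= 1) ->
  ible (fun t => t `^ (a - 1) * u t * expR (- (b * t))).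
Proof.
move=> a0 b0 cu u1.
apply: (integrable_le measurable_Rpos _ _ (integrable_powR_expR a0 b0)).
  apply: continuous_measurable_Rpos => t t0.
  have -> : (fun t => t `^ (a - 1) * u t * expR (- (b * t))) =
            (fun t => t `^ (a - 1) * expR (- (b * t)) * u t).
    by apply/funext => x; rewrite mulrAC.
  by apply: cvgM; [exact: continuous_powR_expR|exact: cu].
move=> t; rewrite RposE => t0.
rewrite mulrAC normrM [X in X * _]ger0_norm ?mulr_ge0 ?powR_ge0 ?expR_ge0//.
by rewrite -[leRHS]mulr1 ler_wpM2l ?u1// mulr_ge0 ?powR_ge0 ?expR_ge0.
Qed.

(* Integration by parts of t^a u(t) e^(-bt), where u is meant to be the cosine
   or the sine of (y ln t), so that t u'(t) = - y v(t). *)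
Lemma Rintegral_powR_parts a b y (u v : R -> R) : 0 < a -> 0 < b ->
  (forall t, 0 < t -> is_derive t 1 u (- (y * v t) / t)) ->
  (forall t, 0 < t -> {for t, continuous v}) ->
  (forall t, 0 < t -> `|u t| <= 1) -> (forall t, 0 < t -> `|v t| <= 1) ->
  b * (\int[mu]_(t in Rpos) (t `^ (a + 1 - 1) * u t * expR (- (b * t)))) =
  a * (\int[mu]_(t in Rpos) (t `^ (a - 1) * u t * expR (- (b * t)))) -
  y * (\int[mu]_(t in Rpos) (t `^ (a - 1) * v t * expR (- (b * t)))).
Proof.
move=> a0 b0 du cv u1 v1; have a1 : 0 < a + 1 by rewrite addr_gt0.
have cu t : 0 < t -> {for t, continuous u}.
  by move=> t0; exact: is_derive_continuous (du t t0).
have i1 := integrable_powR_osc a1 b0 cu u1.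
have i2 := integrable_powR_osc a0 b0 cu u1.
have i3 := integrable_powR_osc a0 b0 cv v1.
pose F t := t `^ a * expR (- (b * t)) * u t.
pose f t := a * (t `^ (a - 1) * u t * expR (- (b * t))) -
            y * (t `^ (a - 1) * v t * expR (- (b * t))) -
            b * (t `^ (a + 1 - 1) * u t * expR (- (b * t))).
have i_f : ible f by apply: ibleB; [apply: ibleB|]; exact: ibleZ.
have dF t : 0 < t -> is_derive t 1 F (f t).
  move=> t0; have d1 := is_derive1_powR a t0.
  have d2 : is_derive t (1 : R) (fun t => - (b * t)) (- b).
    by apply: is_derive_eq; rewrite /GRing.scale/= mulr1.
  have d3 : is_derive t (1 : R) (fun t => expR (- (b * t))) (expR (- (b * t)) * - b).
    exact: (is_derive1_comp (is_derive_expR _) d2).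
  have d4 := is_deriveM (is_deriveM d1 d3) (du t t0).
  apply: (is_derive_eq d4); rewrite /f /GRing.scale/= addrK.
  have -> : t `^ (a - 1) = t `^ a / t.
    by rewrite powRB ?powRr1 ?(ltW t0)//; apply/implyP => _; rewrite gt_eqF.
  rewrite [X in X * (- _ / _)](_ : _ = t `^ a * expR (- (b * t)))//.
  by field; rewrite gt_eqF.
have cf t : 0 < t -> {for t, continuous f}.
  have c w c' : (forall t, 0 < t -> {for t, continuous w}) -> 0 < t ->
      {for t, continuous (fun t => t `^ c' * w t * expR (- (b * t)))}.
    move=> cw t0.
    have -> : (fun t => t `^ c' * w t * expR (- (b * t))) =
              (fun t => t `^ c' * expR (- (b * t)) * w t).
      by apply/funext => x; rewrite mulrAC.
    by apply: cvgM; [exact: continuous_powR_expR|exact: cw].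
  move=> t0; apply: cvgB; last by apply: cvgMl_tmp; exact: c.
  by apply: cvgB; apply: cvgMl_tmp; exact: c.
have F0 : F t @[t --> 0^'+] --> (0 : R).
  apply/cvgrPdist_le => e e0.
  have /cvgrPdist_le/(_ e e0) := powR_cvg0 a0.
  apply: filterS2 (nbhs_right_gt 0) => t t0.
  rewrite !sub0r !normrN [X in X <= _ -> _]ger0_norm ?powR_ge0//.
  apply: le_trans; rewrite /F !normrM.
  rewrite (ger0_norm (powR_ge0 _ _)) (ger0_norm (expR_ge0 _)) -mulrA.
  rewrite -[leRHS]mulr1 ler_wpM2l ?powR_ge0// mulr_ile1 ?u1//.
  by rewrite -[leRHS]expR0 ler_expR oppr_le0 mulr_ge0 ?ltW.
have Fy : F t @[t --> +oo] --> (0 : R).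
  apply/cvgrPdist_le => e e0.
  have /cvgrPdist_le/(_ e e0) := powR_expR_cvgy a0 b0.
  apply: filterS2 (nbhs_pinfty_gt (num_real 0)) => t t0.
  rewrite !sub0r !normrN; apply: le_trans; rewrite /F [leLHS]normrM.
  by rewrite -[leRHS]mulr1 ler_wpM2l ?u1.
have := Rintegral_FTC_Rpos dF cf i_f F0 Fy.
rewrite subrr /f RintegralB//; [|exact: ibleB (ibleZ _ i2) (ibleZ _ i3)|exact: ibleZ].
rewrite (RintegralB measurable_Rpos (ibleZ _ i2) (ibleZ _ i3)).
by rewrite !RintegralZl// => /eqP; rewrite subr_eq0 => /eqP ->.
Qed.

Let dcos y t : 0 < t ->
  is_derive t (1 : R) (fun t => cos (y * ln t)) (- (y * sin (y * ln t)) / t).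
Proof.
move=> t0; have d1 : is_derive t (1 : R) (fun t => y * ln t) (y / t).
  exact: (is_deriveZ y (is_derive1_ln t0)).
apply: (is_derive_eq (is_derive1_comp (is_derive_cos _) d1)).
by rewrite !mulNr mulrCA mulrA.
Qed.

Let dsin y t : 0 < t ->
  is_derive t (1 : R) (fun t => sin (y * ln t)) (- (y * - cos (y * ln t)) / t).
Proof.
move=> t0; have d1 : is_derive t (1 : R) (fun t => y * ln t) (y / t).
  exact: (is_deriveZ y (is_derive1_ln t0)).
apply: (is_derive_eq (is_derive1_comp (is_derive_sin _) d1)).
by rewrite mulrN opprK mulrCA mulrA.
Qed.

Let ccos y t : 0 < t -> {for t, continuous (fun t => cos (y * ln t))}.
Proof. by move=> /(dcos y)/is_derive_continuous. Qed.

Let csin y t : 0 < t -> {for t, continuous (fun t => sin (y * ln t))}.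
Proof. by move=> /(dsin y)/is_derive_continuous. Qed.

Let cos1 y t : `|cos (y * ln t)| <= 1. Proof. by rewrite ler_norml cos_geN1 cos_le1. Qed.
Let sin1 y t : `|sin (y * ln t)| <= 1. Proof. by rewrite ler_norml sin_geN1 sin_le1. Qed.

Lemma cintegrable_Gamma z : 0 < Re z ->
  cintegrable (fun t => rpowc t (z - 1) * (expR (- t))%:C).
Proof.
move=> z0; split.
  apply: eq_ible (integrable_powR_osc z0 ltr01 (@ccos (Im z)) (fun t _ => cos1 (Im z) t)) => t t0.
  by rewrite rpowcE// cReM cReD cImD cReN cImN/= oppr0 addr0 mulr0 subr0 mul1r.
apply: eq_ible (integrable_powR_osc z0 ltr01 (@csin (Im z)) (fun t _ => sin1 (Im z) t)) => t t0.
by rewrite rpowcE// cImM cReD cImD cReN cImN/= oppr0 addr0 mulr0 add0r mul1r.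
Qed.

Let ReGamma z : Re (Gamma z) =
  \int[mu]_(t in Rpos) (t `^ (Re z - 1) * cos (Im z * ln t) * expR (- (1 * t))).
Proof.
rewrite -[LHS]/(\int[mu]_(t in Rpos) Re (rpowc t (z - 1) * (expR (- t))%:C)).
apply: eq_Rintegral => t /set_mem; rewrite RposE => t0.
by rewrite rpowcE// cReM cReD cImD cReN cImN/= oppr0 addr0 mulr0 subr0 mul1r.
Qed.

Let ImGamma z : Im (Gamma z) =
  \int[mu]_(t in Rpos) (t `^ (Re z - 1) * sin (Im z * ln t) * expR (- (1 * t))).
Proof.
rewrite -[LHS]/(\int[mu]_(t in Rpos) Im (rpowc t (z - 1) * (expR (- t))%:C)).
apply: eq_Rintegral => t /set_mem; rewrite RposE => t0.
by rewrite rpowcE// cImM cReD cImD cReN cImN/= oppr0 addr0 mulr0 add0r mul1r.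
Qed.

(** Integration by parts with [u], [v] the cosine and sine gives the real part, with the sine and
    minus the cosine the imaginary part; together they form the complex product. *)
Lemma GammaS z : 0 < Re z -> Gamma (z + 1) = z * Gamma z.
Proof.
move=> z0; apply: eq_complexP.
  rewrite cReM !ReGamma ImGamma cReD cImD/= addr0 -[LHS]mul1r.
  rewrite (Rintegral_powR_parts z0 ltr01 (@dcos (Im z)) (@csin (Im z)))//.
rewrite cImM !ImGamma ReGamma cReD cImD/= addr0 -[LHS]mul1r.
have cNcos t : 0 < t -> {for t, continuous (fun t => - cos (Im z * ln t))}.
  by move=> t0; apply: cvgN; exact: ccos.
rewrite (Rintegral_powR_parts z0 ltr01 (@dsin (Im z)) cNcos)//; last first.
  by move=> t _; rewrite normrN.
have -> : \int[mu]_(t in Rpos) (t `^ (Re z - 1) * - cos (Im z * ln t) * expR (- (1 * t))) =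
   - 1 * \int[mu]_(t in Rpos) (t `^ (Re z - 1) * cos (Im z * ln t) * expR (- (1 * t))).
  rewrite -RintegralZl//; first by apply: eq_Rintegral => t _; ring.
  exact: (integrable_powR_osc z0 ltr01 (@ccos (Im z)) (fun t _ => cos1 (Im z) t)).
by ring.
Qed.

Lemma Gamma_poch z n : 0 < Re z -> Gamma (n%:R + z) = poch z n * Gamma z.
Proof.
move=> z0; elim: n => [|n IHn]; first by rewrite add0r poch0 mul1r.
rewrite -natr1 addrAC GammaS; last first.
  by rewrite cReD -(rmorph_nat (real_complex R))/= ltr_wpDl.
by rewrite IHn pochSr; ring.
Qed.

Definition rGamma a : R := \int[mu]_(t in Rpos) (t `^ (a - 1) * expR (- t)).

Lemma Gamma_real a : Gamma a%:C = (rGamma a)%:C.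
Proof.
apply: eq_complexP; rewrite ?ReGamma ?ImGamma/=.
  by apply: eq_Rintegral => t _; rewrite mul0r cos0 mulr1 mul1r.
rewrite (@eq_Rintegral _ _ _ mu _ (cst 0)) ?/Rintegral ?integral0// => t _.
by rewrite mul0r sin0 mulr0 mul0r.
Qed.

Lemma rGamma_poch a n : 0 < a -> rGamma (n%:R + a) = poch a n * rGamma a.
Proof.
move=> a0; apply: (@fmorph_inj _ _ (real_complex R)).
rewrite rmorphM/= -!Gamma_real rmorphD rmorph_nat Gamma_poch//; congr (_ * _).
by rewrite /poch rmorph_prod; apply: eq_bigr => i _; rewrite rmorphD rmorph_nat.
Qed.

Let ible_Gamma a b : 0 < a -> 0 < b -> ible (fun t => t `^ (a - 1) * expR (- (b * t))).
Proof. exact: integrable_powR_expR. Qed.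

(** If the integral were 0, the positive integrand would vanish almost everywhere on a set of
    infinite measure. *)
Lemma rGamma_gt0 a : 0 < a -> 0 < rGamma a.
Proof.
move=> a0; have i0 : ible (fun t => t `^ (a - 1) * expR (- t)).
  by apply: eq_ible (ible_Gamma a0 ltr01) => t _; rewrite mul1r.
have ge0 : 0 <= rGamma a.
  by apply: Rintegral_ge0 => t _; rewrite mulr_ge0 ?powR_ge0 ?expR_ge0.
rewrite lt_def ge0 andbT; apply/negP => /eqP g0.
pose h (t : R) := (t `^ (a - 1) * expR (- t))%:E.
have mh : measurable_fun Rpos h by exact: (measurable_int mu).
have : ae_eq mu Rpos h (cst 0%E).
  apply/(ae_eq_integral_abs mu measurable_Rpos mh).
  transitivity (\int[mu]_(t in Rpos) h t)%E.
    apply: eq_integral => t _; rewrite gee0_abs// lee_fin.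
    by rewrite mulr_ge0 ?powR_ge0 ?expR_ge0.
  by rewrite /h (EFin_Rintegral measurable_Rpos i0) -/(rGamma a) g0.
move=> [N [mN N0 sN]].
have sub : (Rpos : set R) `<=` N.
  move=> t; rewrite RposE => t0; apply: sN => /= h0.
  have : h t = 0%E by apply: h0; rewrite RposE.
  by apply/eqP; rewrite eqe gt_eqF// mulr_gt0 ?powR_gt0 ?expR_gt0.
have : (mu (Rpos : set R) <= 0)%E by rewrite -N0; apply: le_measure => //; rewrite inE.
by rewrite lebesgue_measure_itv/= ltry leye_eq.
Qed.

(* The substitution t -> 2 t is only available for integrands continuous up to 0,
   hence is applied to a + 1 in place of a. *)
Lemma Rintegral_powR_exp2 a : 0 < a ->
  \int[mu]_(t in Rpos) (t `^ (a - 1) * expR (- (2 * t))) = 2 `^ (- a) * rGamma a.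
Proof.
move=> a0; pose G t : R := t `^ a * expR (- t).
pose F t : R := 2 * t.
have dF t : is_derive t (1 : R) F 2.
  by apply: is_derive_eq; rewrite /GRing.scale/= mulr1.
have F'E : derive1 F = cst 2 by apply/funext => t; rewrite derive1E; have [_ ->] := dF t.
have F0 : F 0 = 0 by rewrite /F mulr0.
have cG t : 0 < t -> {for t, continuous G}.
  have -> : G = (fun t => t `^ a * expR (- (1 * t))) by apply/funext => x; rewrite mul1r.
  exact: continuous_powR_expR.
have mG : measurable_fun Rpos (fun t => (G t)%:E).
  apply/measurable_EFinP; apply: continuous_measurable_Rpos => t t0.
  exact: cG.
have mGF : measurable_fun Rpos (fun t => (((G \o F) * derive1 F) t)%:E).
  apply/measurable_EFinP; apply: continuous_measurable_Rpos => t t0.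
  rewrite F'E; apply: (@cvgM _ _ _ _ (G \o F) (cst 2)); last exact: cvg_cst.
  apply: (@continuous_comp _ _ _ F G); first exact: (is_derive_continuous (dF t)).
  exact: (cG (F t) (mulr_gt0 (ltr0n _ 2) t0)).
have sub : rGamma (a + 1) =
    \int[mu]_(t in Rpos) (2 `^ (a + 1) * (t `^ (a + 1 - 1) * 1 * expR (- (2 * t)))).
  rewrite /rGamma /Rintegral; congr fine.
  transitivity (\int[mu]_(t in `[F 0%R, +oo[) (G t)%:E)%E.
    rewrite F0 -integral_itv_obnd_cbnd//.
    by apply: eq_integral => t _; rewrite /G addrK.
  rewrite (@increasing_ge0_integration_by_substitutiony R F G 0).
  - rewrite -integral_itv_obnd_cbnd//; apply: eq_integral => t /set_mem.
    rewrite /= in_itv/= andbT => t0; congr EFin.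
    rewrite F'E /GRing.mul/= -!/(GRing.mul _ _) /G /F powRM ?ltW// addrK mulr1.
    rewrite powRD ?powRr1//; last by apply/implyP => _.
    by ring.
  - by move=> x y _ _ xy; rewrite /F ltr_pM2l.
  - by rewrite F'E => x _; exact: cvg_cst.
  - by rewrite F'E; exact: is_cvg_cst.
  - by rewrite F'E; exact: is_cvg_cst.
  - split; first by move=> t _; have [] := dF t.
    by apply: cvg_at_right_filter; exact: (is_derive_continuous (dF 0)).
  - apply/cvgryPge => A; near=> t.
    have tA : A / 2 <= t by near: t; apply: nbhs_pinfty_ge; rewrite num_real.
    by rewrite /F mulrC -ler_pdivrMr.
  - apply/continuous_within_itvcyP; split.
      rewrite F0 => t; rewrite in_itv/= andbT => t0.
      exact: cG.
    rewrite F0 /G powR0 ?gt_eqF// mul0r -[0 as X in _ --> X](mul0r (expR (- 0))).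
    apply: cvgM; first exact: powR_cvg0.
    apply: cvg_at_right_filter.
    by apply: continuous_comp; [exact: cvgN cvg_id|exact: continuous_expR].
  - by move=> x _; rewrite mulr_ge0 ?powR_ge0 ?expR_ge0.
have c1 t : 0 < t -> {for t, continuous (cst (1 : R))} by move=> _; exact: cvg_cst.
have c0 t : 0 < t -> {for t, continuous (cst (0 : R))} by move=> _; exact: cvg_cst.
have b1 t : 0 < t -> `|cst (1 : R) t| <= 1 by rewrite normr1.
have b0 t : 0 < t -> `|cst (0 : R) t| <= 1 by rewrite normr0.
have d1 t : 0 < t -> is_derive t (1 : R) (cst (1 : R)) (- (0 * cst (0 : R) t) / t).
  by move=> t0; apply: (is_derive_eq (is_derive_cst _ _ _)); rewrite mul0r oppr0 mul0r.
(* With [u = 1] and [v = 0], integration by parts brings the exponent [a + 1] back to [a]. *)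
have parts := Rintegral_powR_parts a0 (ltr0n _ 2) d1 c0 b1 b0.
have i1 := integrable_powR_osc (addr_gt0 a0 ltr01) (ltr0n _ 2) c1 b1.
rewrite RintegralZl// in sub.
have rec : rGamma (a + 1) = a * rGamma a.
  by rewrite addrC -[1](mulr1n 1) rGamma_poch// pochSr poch0 mul1r addr0.
rewrite mul0r subr0 in parts.
have -> : \int[mu]_(t in Rpos) (t `^ (a - 1) * expR (- (2 * t))) =
          \int[mu]_(t in Rpos) (t `^ (a - 1) * cst 1 t * expR (- (2 * t))).
  by apply: eq_Rintegral => t _; rewrite /= mulr1.
apply: (@mulfI _ a); first by rewrite gt_eqF.
rewrite -parts mulrCA -rec sub powRN.
have p2 : 0 < (2 : R) `^ a by rewrite powR_gt0.
rewrite powRD ?powRr1//; last by apply/implyP => _.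
by rewrite /cst; field; rewrite gt_eqF.
Unshelve. all: by end_near. Qed.

End GammaFunction.

(** * Entire power series and the growth of solutions of Bessel's equation *)

Section EntireSeries.
Context {R : realType}.
Implicit Types (u v : nat -> R) (C x : R).

Lemma cvgn_uniq (s : nat -> R) (x y : R) : s @ \oo --> x -> s @ \oo --> y -> x = y.
Proof. by move=> c1 c2; exact: (cvg_unique _ c1 c2). Qed.

(** This class of coefficients is stable under [pseries_diffs] with the same constant, so a single
    hypothesis covers the derivatives of all orders. *)
Definition fact_bounded C u := forall m, `|u m| <= C / m`!%:R.

Lemma fact_bounded_diffs C u : fact_bounded C u -> fact_bounded C (pseries_diffs u).
Proof.
move=> hu m; rewrite /pseries_diffs normrM normr_nat.
have := hu m.+1; rewrite factS natrM => h.
rewrite mulrC -ler_pdivlMr ?ltr0n// (le_trans h)//.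
by rewrite invfM mulrA mulrAC.
Qed.

Lemma fact_bounded_ge0 C u : fact_bounded C u -> 0 <= C.
Proof. by move=> /(_ 0%N); rewrite fact0 divr1; exact: le_trans. Qed.

Lemma fact_bounded_norm_cvg C u x : fact_bounded C u ->
  cvgn (series (fun n => `|u n * x ^+ n|)).
Proof.
move=> hu; apply: (@series_le_cvg _ _ (fun n => C * exp_coeff `|x| n)).
- by move=> n; exact: normr_ge0.
- by move=> n; rewrite mulr_ge0 ?(fact_bounded_ge0 hu)// exp_coeff_ge0.
- move=> n; rewrite normrM normrX /exp_coeff/= mulrCA mulrC.
  by rewrite ler_wpM2l ?exprn_ge0.
- exact: (@is_cvg_seriesZ _ _ C (is_cvg_series_exp_coeff `|x|)).
Qed.

Lemma fact_bounded_cvg C u x : fact_bounded C u -> cvgn (pseries u x).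
Proof. by move=> hu; apply: normed_cvg; exact: fact_bounded_norm_cvg hu. Qed.

Definition psum u x : R := limn (pseries u x).

Lemma norm_psum_partial_le C u x n : fact_bounded C u ->
  \sum_(0 <= k < n) `|u k * x ^+ k| <= C * expR `|x|.
Proof.
move=> hu; have C0 := fact_bounded_ge0 hu.
apply: (@le_trans _ _ (C * series (exp_coeff `|x|) n)).
  rewrite /series/= mulr_sumr; apply: ler_sum => k _.
  rewrite normrM normrX /exp_coeff/= mulrCA mulrC.
  by rewrite ler_wpM2l ?exprn_ge0.
rewrite ler_wpM2l// /expR; apply: nondecreasing_cvgn_le.
  by apply: nondecreasing_series => k _ _; exact: exp_coeff_ge0.
exact: is_cvg_series_exp_coeff.
Qed.

Lemma norm_psum_le C u x : fact_bounded C u -> `|psum u x| <= C * expR `|x|.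
Proof.
move=> hu; have cu := fact_bounded_cvg (x := x) hu.
have : (fun n => `|pseries u x n|) @ \oo --> `|psum u x| by apply: cvg_norm; exact: cu.
move=> /(@cvg_lim _ _) <-//; apply: limr_le; first by apply: is_cvg_norm; exact: cu.
apply: nearW => n; rewrite (le_trans _ (norm_psum_partial_le x n hu))//.
exact: ler_norm_sum.
Qed.

Lemma is_derive_psum C u x : fact_bounded C u ->
  is_derive x (1 : R) (psum u) (psum (pseries_diffs u) x).
Proof.
move=> hu; apply: (@pseries_snd_diffs _ _ (`|x| + 1)).
- exact: fact_bounded_cvg hu.
- exact/fact_bounded_cvg/fact_bounded_diffs/hu.
- exact/fact_bounded_cvg/fact_bounded_diffs/fact_bounded_diffs/hu.
- by rewrite [ltRHS]ger0_norm ?addr_ge0// ltrDl.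
Qed.

(* u and v are the real and imaginary parts of the coefficients of an entire
   solution y of x y'' + (a + i b) y' + y = 0; then (|y|^2 + x |y'|^2) / x is
   nonincreasing, because a >= 0. *)
Lemma bessel_ode_growth C a b u v : 0 <= a -> fact_bounded C u -> fact_bounded C v ->
  (forall m, (m%:R + a) * pseries_diffs u m - b * pseries_diffs v m = - u m) ->
  (forall m, (m%:R + a) * pseries_diffs v m + b * pseries_diffs u m = - v m) ->
  exists2 B, 0 <= B & forall x, 0 <= x -> `|psum u x| + `|psum v x| <= B * (1 + x).
Proof.
move=> a0 hu hv ru rv.
have hu1 := fact_bounded_diffs hu; have hv1 := fact_bounded_diffs hv.
have hu2 := fact_bounded_diffs hu1; have hv2 := fact_bounded_diffs hv1.
pose U := psum u; pose V := psum v.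
pose U1 := psum (pseries_diffs u); pose V1 := psum (pseries_diffs v).
pose U2 := psum (pseries_diffs (pseries_diffs u)).
pose V2 := psum (pseries_diffs (pseries_diffs v)).
have xdd w (hw : fact_bounded C w) x :
    series (fun i => i%:R * pseries_diffs w i * x ^+ i) @ \oo -->
    x * psum (pseries_diffs (pseries_diffs w)) x.
  have c := pseries_diffs_equiv
    (fact_bounded_cvg (x := x) (fact_bounded_diffs (fact_bounded_diffs hw))).
  have c' := cvgMl_tmp (a := x) c.
  suff -> : series (fun i => i%:R * pseries_diffs w i * x ^+ i) =
      (fun n => x * series (fun i => i%:R * pseries_diffs w i * x ^+ i.-1) n) by exact: c'.
  apply/funext => n; rewrite /series/= mulr_sumr; apply: eq_bigr => -[|i] _.
    by rewrite !mul0r mulr0.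
  by rewrite /= exprS; ring.
have ps w (hw : fact_bounded C w) x : pseries w x @ \oo --> psum w x.
  exact: fact_bounded_cvg hw.
have odeU x : x * U2 x + a * U1 x - b * V1 x = - U x.
  have c1 := cvgB (cvgD (xdd u hu x) (cvgMl_tmp (a := a) (ps _ hu1 x))) (cvgMl_tmp (a := b) (ps _ hv1 x)).
  have c2 := cvgN (ps _ hu x).
  suff e : series (fun i => i%:R * pseries_diffs u i * x ^+ i) +
      (fun n => a * pseries (pseries_diffs u) x n) -
      (fun n => b * pseries (pseries_diffs v) x n) =
      - pseries u x by rewrite -e in c2; exact: (cvgn_uniq (c1 _ _ _ _) (c2 _)).
  apply/funext => n; rewrite /pseries /series !fctE/= !mulr_sumr -big_split/= -sumrB -sumrN.
  by apply: eq_bigr => i _; have := ru i; move: (pseries_diffs _ _) (pseries_diffs _ _);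
    move=> p r h; rewrite -[u i]opprK -h; ring.
have odeV x : x * V2 x + a * V1 x + b * U1 x = - V x.
  have c1 := cvgD (cvgD (xdd v hv x) (cvgMl_tmp (a := a) (ps _ hv1 x))) (cvgMl_tmp (a := b) (ps _ hu1 x)).
  have c2 := cvgN (ps _ hv x).
  suff e : series (fun i => i%:R * pseries_diffs v i * x ^+ i) +
      (fun n => a * pseries (pseries_diffs v) x n) +
      (fun n => b * pseries (pseries_diffs u) x n) =
      - pseries v x by rewrite -e in c2; exact: (cvgn_uniq (c1 _ _ _ _) (c2 _)).
  apply/funext => n; rewrite /pseries /series !fctE/= !mulr_sumr -!big_split/= -sumrN.
  by apply: eq_bigr => i _; have := rv i; move: (pseries_diffs _ _) (pseries_diffs _ _);
    move=> p r h; rewrite -[v i]opprK -h; ring.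
(* By the equation, the derivative of [E] is [(1 - 2 a) |y'|^2], the contributions of [b]
   cancelling. Dividing [E] by [x] subtracts [|y'|^2 / x + |y|^2 / x^2] from [E' / x], and only
   nonpositive terms remain. *)
pose E x := U x * U x + V x * V x + x * (U1 x * U1 x + V1 x * V1 x).
pose dG x := x^-1 * ((1 - 2 * a) * (U1 x * U1 x + V1 x * V1 x)) + E x * (- x^-2).
have dE x : is_derive x (1 : R) E ((1 - 2 * a) * (U1 x * U1 x + V1 x * V1 x)).
  have dU : is_derive x (1 : R) U (U1 x) := is_derive_psum x hu.
  have dV : is_derive x (1 : R) V (V1 x) := is_derive_psum x hv.
  have dU1 : is_derive x (1 : R) U1 (U2 x) := is_derive_psum x hu1.
  have dV1 : is_derive x (1 : R) V1 (V2 x) := is_derive_psum x hv1.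
  have d := is_deriveD (is_deriveD (is_deriveM dU dU) (is_deriveM dV dV))
    (is_deriveM (is_derive_id x (1 : R)) (is_deriveD (is_deriveM dU1 dU1) (is_deriveM dV1 dV1))).
  apply: (is_derive_eq d); rewrite /GRing.scale/=.
  have := odeU x; have := odeV x => e1 e2.
  rewrite [(U1 * U1 + V1 * V1) x](_ : _ = U1 x * U1 x + V1 x * V1 x)//.
  have e3 : x * U2 x = - U x - a * U1 x + b * V1 x by rewrite -e2; ring.
  have e4 : x * V2 x = - V x - a * V1 x - b * U1 x by rewrite -e1; ring.
  transitivity (2 * (U x * U1 x) + 2 * (V x * V1 x) + (U1 x * U1 x + V1 x * V1 x)
    + 2 * (U1 x * (x * U2 x)) + 2 * (V1 x * (x * V2 x))); first by ring.
  by rewrite e3 e4; ring.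
have dGP x : 0 < x -> is_derive x (1 : R) (fun x => x^-1 * E x) (dG x).
  move=> x0; have xn0 : x != 0 by rewrite gt_eqF.
  have dV := is_deriveV xn0 (is_derive_id x (1 : R)).
  apply: (is_derive_eq (is_deriveM dV (dE x))); rewrite /dG /GRing.scale/= mulr1.
  by [].
have dG0 x : 0 < x -> dG x <= 0.
  move=> x0; rewrite /dG /E.
  set W := U1 x * U1 x + V1 x * V1 x.
  have W0 : 0 <= W by rewrite addr_ge0// -expr2 sqr_ge0.
  have -> : x^-1 * ((1 - 2 * a) * W) + (U x * U x + V x * V x + x * W) * - x ^- 2 =
     - ((2 * a * W) / x + (U x * U x + V x * V x) / x ^+ 2).
    by field; rewrite gt_eqF.
  rewrite oppr_le0 addr_ge0//.
    by rewrite divr_ge0 ?(ltW x0)// mulr_ge0// mulr_ge0.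
  by rewrite divr_ge0 ?sqr_ge0// addr_ge0// -expr2 sqr_ge0.
have Ex x : 1 <= x -> E x <= E 1 * x.
  move=> x1; have x0 : 0 < x by rewrite (lt_le_trans ltr01).
  have pos y : 1 <= y -> 0 < y by exact: lt_le_trans.
  have [||c] := @MVT_segment _ (fun x => x^-1 * E x) dG 1 x x1.
  - by move=> y; rewrite in_itv/= => /andP[/ltW/pos y0 _]; exact: dGP.
  - apply: continuous_in_subspaceT => y /set_mem; rewrite /= in_itv/= => /andP[/pos y0 _].
    exact: is_derive_continuous (dGP y y0).
  - rewrite in_itv/= => /andP[/pos c0 _]; rewrite invr1 mul1r => h.
    have : dG c * (x - 1) <= 0 by rewrite mulr_le0_ge0 ?dG0// subr_ge0.
    by rewrite -h subr_le0 mulrC ler_pdivrMr.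
have C0 := fact_bounded_ge0 hu.
have E10 : 0 <= E 1.
  by rewrite /E mul1r !addr_ge0// -expr2 sqr_ge0.
(* The first summand covers [x <= 1] by the bound on the series. The second covers [x >= 1], where
   [p + r <= 1 + (p + r)^2 <= 1 + 2 (p^2 + r^2)] and [p^2 + r^2 <= E 1 * x]. *)
exists (2 * C * expR 1 + (1 + 2 * E 1)).
  by rewrite !addr_ge0// ?mulr_ge0// expR_ge0.
move=> x x0; have e1 : 0 <= 2 * C * expR 1 by rewrite !mulr_ge0 ?expR_ge0.
move: (E 1) E10 Ex => e E10 Ex.
have [x1|/ltW x1] := leP 1 x.
  have := Ex x x1; rewrite /E -/U -/V.
  set W := U1 x * U1 x + V1 x * V1 x.
  have W0 : 0 <= x * W by rewrite mulr_ge0// addr_ge0// -expr2 sqr_ge0.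
  rewrite -!expr2 -(real_normK (num_real (U x))) -(real_normK (num_real (V x))).
  set p := `|U x|; set r := `|V x| => h.
  have h2 : (p + r) ^+ 2 <= 2 * e * x.
    by have := sqr_ge0 (p - r); nra.
  have p0 : 0 <= p + r by rewrite addr_ge0 ?normr_ge0.
  have h3 : p + r <= 1 + (p + r) ^+ 2 by have := sqr_ge0 (p + r - 1); nra.
  by nra.
have h1 := norm_psum_le x hu; have h2 := norm_psum_le x hv.
have h3 : expR `|x| <= expR 1 by rewrite ler_expR ger0_norm.
have h4 : C * expR `|x| <= C * expR 1 by rewrite ler_wpM2l.
rewrite -/U -/V in h1 h2 *.
set f := expR 1 in e1 h4 *.
have : 0 <= (2 * C * f) * x by rewrite mulr_ge0.
by have : 0 <= (1 + 2 * e) * (1 + x); [rewrite mulr_ge0 ?addr_ge0// mulr_ge0|lra].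
Qed.

End EntireSeries.

(** * The kernel as an entire function of [st] *)

Section BesselKernel.
Context {R : realType}.
Local Notation Re := (@complex.Re R).
Local Notation Im := (@complex.Im R).
Implicit Types (z c q : R[i]) (x s t : R).

Lemma cexpD z1 z2 : cexp (z1 + z2) = cexp z1 * cexp z2.
Proof.
rewrite /cexp cReD cImD expRD cosD sinD.
by apply: eq_complexP; rewrite !(cReM, cImM)/=; ring.
Qed.

Lemma cexp0 : cexp (0 : R[i]) = 1.
Proof. by rewrite /cexp/= expR0 cos0 sin0 mul1r. Qed.

Lemma cexp_neq0 z : cexp z != 0.
Proof.
apply/eqP => z0; have := cexpD z (- z); rewrite subrr cexp0 z0 mul0r => /eqP.
by rewrite oner_eq0.
Qed.

Lemma rpowcM x y z : 0 < x -> 0 < y -> rpowc (x * y) z = rpowc x z * rpowc y z.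
Proof. by move=> x0 y0; rewrite /rpowc lnM ?posrE// rmorphD/= mulrDr cexpD. Qed.

Lemma rpowcD x z1 z2 : rpowc x (z1 + z2) = rpowc x z1 * rpowc x z2.
Proof. by rewrite /rpowc mulrDl cexpD. Qed.

Lemma rpowc_nat x n : 0 < x -> rpowc x n%:R = x%:C ^+ n.
Proof.
move=> x0; elim: n => [|n IHn]; first by rewrite /rpowc mul0r cexp0.
rewrite -natr1 rpowcD IHn exprSr; congr (_ * _).
by rewrite rpowcE//= powRr1 ?ltW// mul0r cos0 sin0 mulr1 mulr0.
Qed.

Lemma rpowc_sqrt x z : 0 < x -> rpowc (Num.sqrt x) (2 * z) = rpowc x z.
Proof.
move=> x0; have s0 : 0 < Num.sqrt x by rewrite sqrtr_gt0.
by rewrite mulr_natl mulr2n rpowcD -rpowcM// -expr2 sqr_sqrtr// ltW.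
Qed.

Definition kcoef c (m : nat) : R[i] := (-1) ^+ m / (m`!%:R * Gamma (m%:R + c)).

(* J_(c-1) (2 sqrt x) / x^((c-1)/2) *)
Definition bessel_kernel c x : R[i] := csum (fun m => kcoef c m * x%:C ^+ m).

(** The power of [2 sqrt(st)] in front of the Bessel series cancels against the two denominators,
    because [rpowc] of a square root at a doubled exponent is [rpowc] itself. *)
Lemma BesselJE q s t : 0 < s -> 0 < t ->
  BesselJ (2 * q - 1) (2 * Num.sqrt (s * t)) / rpowc (s * t) (q - 2^-1) =
  bessel_kernel (2 * q) (s * t).
Proof.
move=> s0 t0; have st0 : 0 < s * t by rewrite mulr_gt0.
have r0 : 0 < Num.sqrt (s * t) by rewrite sqrtr_gt0.
have e : 2 * q - 1 = 2 * (q - 2^-1) by rewrite mulrBr divff// pnatr_eq0.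
rewrite /BesselJ e (rpowcM _ (ltr0n _ 2) r0) (rpowc_sqrt _ st0).
have : rpowc (s * t) (q - 2^-1) != 0 by exact: cexp_neq0.
have : rpowc 2 (2 * (q - 2^-1)) != 0 :> R[i] by exact: cexp_neq0.
move: (rpowc 2 _) (rpowc (s * t) _) => a b a0 b0.
rewrite [a * b]mulrC mulfK// [b * _]mulrC mulfK// /bessel_kernel.
congr csum; apply/funext => m; rewrite /kcoef.
have -> : m%:R + 2 * (q - 2^-1) + 1 = m%:R + 2 * q.
  by rewrite mulrBr divff ?pnatr_eq0// addrA subrK.
have -> : (2 * Num.sqrt (s * t))%:C = 2 * (Num.sqrt (s * t))%:C :> R[i].
  by rewrite rmorphM rmorph_nat.
rewrite exprMn.
have -> : (Num.sqrt (s * t))%:C ^+ (2 * m) = (s * t)%:C ^+ m :> R[i].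
  by rewrite exprM -rmorphXn/= sqr_sqrtr// ltW.
have P0 : (2 : R[i]) ^+ (2 * m) != 0 by rewrite expf_neq0// pnatr_eq0.
move: ((2 : R[i]) ^+ (2 * m)) P0 => P P0; rewrite !invfM.
move: (Gamma _)^-1 (m`!%:R^-1) => g f.
by rewrite -!mulrA [X in _ * X = _](_ : _ = f * (g * (s * t)%:C ^+ m))//; field.
Qed.

Lemma norm1c_le_normc z : (norm1c z)%:C <= 2 * `|z|.
Proof.
rewrite normc_def -[2](rmorph_nat (real_complex R)) -rmorphM lecR /norm1c mulr_natl mulr2n.
by rewrite lerD// -sqrtr_sqr ler_wsqrtr// ?lerDl ?lerDr sqr_ge0.
Qed.

Section Coefficients.
Variable c : R[i].
Hypothesis c0 : 0 < Re c.

Lemma Re_natD n : Re (n%:R + c) = n%:R + Re c.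
Proof. by rewrite cReD -(rmorph_nat (real_complex R)). Qed.

Lemma natD_neq0 n : n%:R + c != 0.
Proof.
apply/eqP => /(congr1 Re); rewrite Re_natD/= => /eqP.
by rewrite gt_eqF// ltr_wpDl.
Qed.

Lemma poch_neq0 n : poch c n != 0.
Proof. by apply/prodf_neq0 => i _; rewrite addrC natD_neq0. Qed.

(** Every factor satisfies [|c + k| >= k] since [Re c > 0]. This supplies a second factorial in the
    denominator of [kcoef]. *)
Let pochS_ge n : `|c| * n`!%:R <= `|poch c n.+1|.
Proof.
elim: n => [|n IHn]; first by rewrite mulr1 pochSr poch0 mul1r addr0.
rewrite pochSr normrM factS natrM [_%:R * _]mulrC mulrA.
apply: ler_pM => //.
rewrite addrC; apply: le_trans (normc_ge_Re _); rewrite Re_natD.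
have r0 : 0 <= n.+1%:R + Re c by rewrite addr_ge0// ltW.
by rewrite ger0_norm// -(rmorph_nat (real_complex R)) lecR lerDl ltW.
Qed.

(** The factor [2^-1 ^+ m] makes the kernel [O(e^(s/2))] in [s] for fixed [t], hence integrable
    against [e^(-s)]. Of the two factorials below [kcoef], the one from [pochS_ge] absorbs the
    powers of [2 t] at the cost of [e^(2 t)]. *)
Lemma kcoef_le t : 0 <= t ->
  exists2 C, 0 <= C & forall m, norm1c (kcoef c m) * t ^+ m <= C * (2^-1 ^+ m / m`!%:R).
Proof.
move=> t0.
pose K := 2 * (Re (`|(Gamma c)^-1| * `|c^-1|)).
have KE : K%:C = 2 * (`|(Gamma c)^-1| * `|c^-1|).
  by rewrite /K -normrM normc_def/= rmorphM rmorph_nat.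
have K0 : 0 <= K by rewrite -lecR KE mulr_ge0 ?ler0n ?mulr_ge0.
move: K KE K0 => K KE K0.
have e0 : 0 <= K * (2 * t * expR (2 * t)).
  by apply: (mulr_ge0 K0); apply: mulr_ge0 (expR_ge0 _); exact: mulr_ge0.
(* The first summand takes care of [m = 0], as [pochS_ge] starts at index 1. *)
exists (norm1c (kcoef c 0) + K * (2 * t * expR (2 * t))).
  by rewrite addr_ge0 ?norm1c_ge0.
case=> [|m]; first by rewrite !expr0 fact0 divr1 !mulr1 lerDl.
have h1 : norm1c (kcoef c m.+1) <= K / (m.+1`!%:R * m`!%:R).
  have E : (K / (m.+1`!%:R * m`!%:R))%:C =
      2 * ((`|(Gamma c)^-1| * `|c^-1|) * ((m.+1`!%:R)^-1 * (m`!%:R)^-1)) :> R[i].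
    by rewrite rmorphM fmorphV rmorphM !rmorph_nat invfM /= KE [RHS]mulrA.
  rewrite -lecR E (le_trans (norm1c_le_normc _))//.
  rewrite ler_wpM2l ?ler0n// /kcoef normrM normrX normrN1 expr1n mul1r.
  rewrite Gamma_poch// !normfV !normrM !invfM normr_nat.
  rewrite [leRHS]mulrCA ler_wpM2l ?invr_ge0 ?ler0n// [leLHS]mulrC -mulrA.
  rewrite ler_wpM2l ?invr_ge0// -invfM lef_pV2 ?posrE ?pochS_ge//.
    by rewrite normr_gt0 poch_neq0.
  rewrite mulr_gt0 ?ltr0n ?fact_gt0// normr_gt0.
  by have := natD_neq0 0; rewrite add0r.
apply: (@le_trans _ _ (K / (m.+1`!%:R * m`!%:R) * t ^+ m.+1)).
  by rewrite ler_wpM2r ?exprn_ge0.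
apply: (@le_trans _ _ (K * (2 * t * expR (2 * t)) * (2^-1 ^+ m.+1 / m.+1`!%:R))); last first.
  by rewrite ler_wpM2r ?lerDr ?norm1c_ge0// mulr_ge0 ?exprn_ge0 ?invr_ge0.
have e1 : (2 * t) ^+ m / m`!%:R <= expR (2 * t).
  have t2 : 0 <= 2 * t by rewrite mulr_ge0.
  case: m {h1} => [|m]; first by rewrite expr0 fact0 divr1 -[leLHS]expR0 ler_expR.
  by apply: le_trans (expR_ge1Dxn m t2); rewrite lerDr.
have f1 : 0 < m.+1`!%:R :> R by rewrite ltr0n fact_gt0.
have f2 : 0 < m`!%:R :> R by rewrite ltr0n fact_gt0.
have p2 : 0 < (2 : R) ^+ m.+1 by rewrite exprn_gt0.
rewrite -!mulrA ler_wpM2l// exprVn.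
have -> : (m.+1`!%:R * m`!%:R)^-1 * t ^+ m.+1 =
    2 * (t * (((2 * t) ^+ m / m`!%:R) * ((2 ^+ m.+1)^-1 / m.+1`!%:R))) :> R.
  by rewrite exprMn !exprS; field; rewrite !gt_eqF.
rewrite !ler_wpM2l// ler_wpM2r// mulr_ge0// invr_ge0 ltW//.
Qed.

Definition kRe m := Re (kcoef c m).
Definition kIm m := Im (kcoef c m).

Lemma kcoef_fact_bounded : exists C, fact_bounded C kRe /\ fact_bounded C kIm.
Proof.
have [C C0 HC] := kcoef_le ler01; exists C.
have h m : norm1c (kcoef c m) <= C / m`!%:R.
  have := HC m; rewrite expr1n mulr1 => /le_trans; apply.
  rewrite ler_wpM2l// -[leRHS]mul1r ler_wpM2r ?invr_ge0// exprn_ile1// ?invr_ge0//.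
  by rewrite invf_le1// ler1n.
by split => m; apply: le_trans (h m); rewrite /norm1c ?lerDl ?lerDr.
Qed.

Lemma Re_kterm m x : Re (kcoef c m * x%:C ^+ m) = kRe m * x ^+ m.
Proof. by rewrite -rmorphXn/= cReM/= mulr0 subr0. Qed.

Lemma Im_kterm m x : Im (kcoef c m * x%:C ^+ m) = kIm m * x ^+ m.
Proof. by rewrite -rmorphXn/= cImM/= mulr0 add0r. Qed.

Lemma bessel_kernel_psum x : bessel_kernel c x = psum kRe x +i* psum kIm x.
Proof.
have [C [hr hi]] := kcoef_fact_bounded; apply: csumE; apply: cseries_cvgP => /=.
  under eq_fun do rewrite Re_kterm.
  exact: fact_bounded_cvg hr.
under eq_fun do rewrite Im_kterm.
exact: fact_bounded_cvg hi.
Qed.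

Lemma bessel_kernel_growth :
  exists2 B, 0 <= B & forall x, 0 <= x -> norm1c (bessel_kernel c x) <= B * (1 + x).
Proof.
have [C [hr hi]] := kcoef_fact_bounded.
(* This is [x y'' + c y' + y = 0] read on coefficients. Its real and imaginary parts are the
   recurrences of [bessel_ode_growth] for [a = Re c] and [b = Im c]. *)
have rec m : (m%:R + c) * (m.+1%:R * kcoef c m.+1) = - kcoef c m.
  rewrite /kcoef -natr1 addrAC GammaS ?Re_natD ?ltr_wpDl// factS natrM natr1 exprS.
  rewrite !invfM mulN1r !mulNr !mulrN; congr (- _).
  set g := (Gamma _)^-1; set f := (m`!%:R)^-1; have := natD_neq0 m.
  have : m.+1%:R != 0 :> R[i] by rewrite pnatr_eq0.
  move: (m.+1%:R : R[i]) (m%:R + c) => a b a0 b0.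
  by field; rewrite a0 b0.
have Rn (n : nat) z : Re (n%:R * z) = n%:R * Re z.
  by rewrite -(rmorph_nat (real_complex R)) cReM/= mul0r subr0.
have In (n : nat) z : Im (n%:R * z) = n%:R * Im z.
  by rewrite -(rmorph_nat (real_complex R)) cImM/= mul0r addr0.
have Imc n : Im (n%:R + c) = Im c.
  by rewrite cImD -(rmorph_nat (real_complex R))/= add0r.
have [||B B0 HB] := @bessel_ode_growth R C (Re c) (Im c) _ _ (ltW c0) hr hi.
- move=> m; have := congr1 Re (rec m).
  by rewrite cReM Re_natD Imc Rn In cReN.
- move=> m; have := congr1 Im (rec m).
  by rewrite cImM Re_natD Imc Rn In cImN.
- by exists B => // x x0; rewrite bessel_kernel_psum; exact: HB.
Qed.

Lemma continuous_bessel_kernel_Re : continuous (fun x => Re (bessel_kernel c x)).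
Proof.
have [C [hr hi]] := kcoef_fact_bounded => x.
under eq_fun do rewrite bessel_kernel_psum/=.
exact: (is_derive_continuous (is_derive_psum x hr)).
Qed.

Lemma continuous_bessel_kernel_Im : continuous (fun x => Im (bessel_kernel c x)).
Proof.
have [C [hr hi]] := kcoef_fact_bounded => x.
under eq_fun do rewrite bessel_kernel_psum/=.
exact: (is_derive_continuous (is_derive_psum x hi)).
Qed.

End Coefficients.
End BesselKernel.

(** * The action of N_q on monomials *)

Section KernelMonomials.
Context {R : realType}.
Local Notation mu := (@lebesgue_measure R).
Local Notation ible f := (mu.-integrable Rpos (EFin \o f)).
Local Notation Re := (@complex.Re R).
Local Notation Im := (@complex.Im R).
Implicit Types (q : R[i]) (x s t xi : R).

Definition lweight xi t : R := t `^ (2 * xi - 1) * expR (- t).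

Lemma lweight_gt0 xi t : 0 < t -> 0 < lweight xi t.
Proof. by move=> t0; rewrite mulr_gt0 ?powR_gt0 ?expR_gt0. Qed.

Lemma lweight_ge0 xi t : 0 <= lweight xi t.
Proof. by rewrite mulr_ge0 ?powR_ge0 ?expR_ge0. Qed.

Lemma continuous_lweight xi t : 0 < t -> {for t, continuous (lweight xi)}.
Proof.
move=> t0; have -> : lweight xi = (fun t => t `^ (2 * xi - 1) * expR (- (1 * t))).
  by apply/funext => x; rewrite mul1r.
exact: continuous_powR_expR.
Qed.

Lemma measurable_lweight xi : measurable_fun Rpos (lweight xi).
Proof. by apply: continuous_measurable_Rpos => t; exact: continuous_lweight. Qed.

Lemma Re_mdens q t : 0 < t ->
  Re (mdens q t) = lweight (Re q) t * cos (2 * Im q * ln t).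
Proof.
move=> t0; rewrite /mdens rpowcE// cReM/= mulr0 subr0.
have -> : Re (2 * q - 1) = 2 * Re q - 1.
  by rewrite cReD cReN -[2](rmorph_nat (real_complex R)) cReM/= mul0r subr0.
have -> : Im (2 * q - 1) = 2 * Im q.
  by rewrite cImD cImN -[2](rmorph_nat (real_complex R)) cImM/= mul0r !(addr0, oppr0).
by rewrite mulrAC.
Qed.

Lemma Im_mdens q t : 0 < t ->
  Im (mdens q t) = lweight (Re q) t * sin (2 * Im q * ln t).
Proof.
move=> t0; rewrite /mdens rpowcE// cImM/= mulr0 add0r.
have -> : Re (2 * q - 1) = 2 * Re q - 1.
  by rewrite cReD cReN -[2](rmorph_nat (real_complex R)) cReM/= mul0r subr0.
have -> : Im (2 * q - 1) = 2 * Im q.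
  by rewrite cImD cImN -[2](rmorph_nat (real_complex R)) cImM/= mul0r !(addr0, oppr0).
by rewrite mulrAC.
Qed.

Lemma norm1c_mdens q t : 0 < t -> norm1c (mdens q t) <= 2 * lweight (Re q) t.
Proof.
move=> t0; rewrite /norm1c Re_mdens// Im_mdens// 2!(normrM (lweight _ _)).
rewrite (ger0_norm (lweight_ge0 _ _)) [leRHS]mulr_natl mulr2n.
by apply: lerD; rewrite ler_piMr ?lweight_ge0// ler_norml
  ?cos_geN1 ?cos_le1 ?sin_geN1 ?sin_le1.
Qed.

Let continuous_ln_scale (y : R) t : 0 < t -> {for t, continuous (fun t => y * ln t)}.
Proof. by move=> t0; apply: cvgMl_tmp; exact: continuous_ln. Qed.

Lemma measurable_Re_mdens q : measurable_fun Rpos (fun t => Re (mdens q t)).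
Proof.
apply: (eq_measurable_fun (fun t => lweight (Re q) t * cos (2 * Im q * ln t))).
  by move=> t /set_mem; rewrite RposE => /(Re_mdens q) ->.
apply: measurable_funM; first exact: measurable_lweight.
apply: continuous_measurable_Rpos => t t0.
by apply: continuous_comp; [exact: continuous_ln_scale|exact: continuous_cos].
Qed.

Lemma measurable_Im_mdens q : measurable_fun Rpos (fun t => Im (mdens q t)).
Proof.
apply: (eq_measurable_fun (fun t => lweight (Re q) t * sin (2 * Im q * ln t))).
  by move=> t /set_mem; rewrite RposE => /(Im_mdens q) ->.
apply: measurable_funM; first exact: measurable_lweight.
apply: continuous_measurable_Rpos => t t0.
by apply: continuous_comp; [exact: continuous_ln_scale|exact: continuous_sin].
Qed.

Lemma powR_addn t (n : nat) a : 0 < t -> t ^+ n * t `^ (a - 1) = t `^ (n%:R + a - 1).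
Proof.
move=> t0; rewrite -powR_mulrn ?ltW// -powRD ?addrA//.
by apply/implyP => _; rewrite gt_eqF.
Qed.

Let monomialE q n t : 0 < t ->
  t%:C ^+ n * mdens q t = rpowc t (n%:R + 2 * q - 1) * (expR (- t))%:C.
Proof.
by move=> t0; rewrite /mdens -rpowc_nat// mulrA -rpowcD addrA.
Qed.

Let Re_2q q : Re (2 * q) = 2 * Re q.
Proof. by rewrite -[2](rmorph_nat (real_complex R)) cReM/= mul0r subr0. Qed.

Lemma cintegrable_monomial q n : 0 < Re q ->
  cintegrable (fun t => t%:C ^+ n * mdens q t).
Proof.
move=> q0; have h : 0 < Re (n%:R + 2 * q).
  by rewrite Re_natD Re_2q ltr_wpDl// mulr_gt0.
by apply: eq_cintegrable (cintegrable_Gamma h) => t t0; rewrite monomialE.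
Qed.

Lemma cint_monomial q n : 0 < Re q ->
  cint (fun t => t%:C ^+ n * mdens q t) = Gamma (n%:R + 2 * q).
Proof. by move=> q0; apply: eq_cint => t t0; rewrite monomialE. Qed.

Lemma cvgn_sum (I : Type) (r : seq I) (f : I -> nat -> R) (l : I -> R) :
  (forall i, f i @ \oo --> l i) ->
  (fun n => \sum_(i <- r) f i n) @ \oo --> \sum_(i <- r) l i.
Proof.
move=> fl; elim: r => [|i r IHr].
  by under eq_fun do rewrite big_nil; rewrite big_nil; exact: cvg_cst.
under eq_fun do rewrite big_cons.
by rewrite big_cons; apply: cvgD; [exact: fl|exact: IHr].
Qed.

(** The sum is [x ^+ j] times the [j]-th derivative of the exponential series. The first [j] terms
    vanish, hence the shift. *)
Lemma cvg_series_ffact_exp (j : nat) (x : R) :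
  series (fun m => (m ^_ j)%:R * (x ^+ m / m`!%:R)) @ \oo --> x ^+ j * expR x.
Proof.
rewrite -(cvg_shiftn j).
have -> : (fun n => series (fun m => (m ^_ j)%:R * (x ^+ m / m`!%:R)) (n + j)%N) =
          (fun n => x ^+ j * series (exp_coeff x) n).
  apply/funext => n; rewrite /series/=; elim: n => [|n IHn].
    rewrite add0n big_nil mulr0 big1_seq// => m; rewrite mem_index_iota => /andP[_ mj].
    by rewrite ffact_small ?mul0r.
  rewrite addSn !big_nat_recr//= IHn mulrDr; congr (_ + _).
  rewrite /exp_coeff/= -(ffact_fact (leq_addl n j)) addnK natrM exprD.
  by field; rewrite !pnatr_eq0 -!lt0n ?fact_gt0 ?ffact_gt0 ?leq_addl.
by apply: cvgMl_tmp; exact: is_cvg_series_exp_coeff.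
Qed.

Section Action.
Variable q : R[i].
Hypothesis q0 : 0 < Re q.
Local Notation c := (2 * q).

Let c0 : 0 < Re c. Proof. by rewrite Re_2q mulr_gt0. Qed.

(* The factor Gamma c / Gamma c (1, or 0 if Gamma c = 0) makes it unnecessary to
   know that Gamma has no zeros. *)
Definition kernel_monomial (l : nat) t : R[i] :=
  Gamma c / Gamma c * (expR (- t))%:C *
  \sum_(j < l.+1) 'C(l, j)%:R * poch (c + j%:R) (l - j) * (- t)%:C ^+ j.

(** The Pochhammer factors of the coefficient and of the moment cancel, leaving a term of the
    exponential series times a polynomial of degree [l] in [m]. *)
Let kcoef_moment l m t :
  kcoef c m * t%:C ^+ m * Gamma ((m + l)%:R + c) =
  Gamma c / Gamma c * ((- t) ^+ m / m`!%:R)%:C * poch (c + m%:R) l.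
Proof.
rewrite /kcoef !Gamma_poch// pochD invfM invfM.
rewrite rmorphM fmorphV rmorph_nat rmorphXn rmorphN/= [in RHS]exprNn.
have := poch_neq0 c0 m; move: (poch c m) (poch _ l) (Gamma c) (Gamma c)^-1 (m`!%:R^-1).
by move=> p p' G G' f p0; field.
Qed.

(** Chu-Vandermonde expands that polynomial in the falling factorials of [m], and each of them sums
    the exponential series to [(- t)^j e^(- t)]. This is Kummer's transformation in the terminating
    case. *)
Let cvg_kernel_moments l t :
  cseries_cvg (fun m => kcoef c m * t%:C ^+ m * Gamma ((m + l)%:R + c))
    (kernel_monomial l t).
Proof.
pose e := Gamma c / Gamma c.
pose C (j : 'I_l.+1) := e * ('C(l, j)%:R * poch (c + j%:R) (l - j)).
pose S (j : 'I_l.+1) n := series (fun m => (m ^_ j)%:R * ((- t) ^+ m / m`!%:R)) n.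
have SE n : series ((fun m => kcoef c m * t%:C ^+ m * Gamma ((m + l)%:R + c)) : nat -> R[i]^o) n
    = \sum_(j < l.+1) C j * (S j n)%:C.
  rewrite /series/= (eq_bigr (fun m => \sum_(j < l.+1) C j * ((m ^_ j)%:R * ((- t) ^+ m / m`!%:R))%:C)).
    rewrite exchange_big/=; apply: eq_bigr => j _.
    by rewrite -mulr_sumr /S /series/= rmorph_sum.
  move=> m _; rewrite kcoef_moment poch_vandermonde -/e mulr_sumr; apply: eq_bigr => j _.
  by rewrite [X in _ = _ * X]rmorphM rmorph_nat natrM /C; ring.
have limE : kernel_monomial l t = \sum_(j < l.+1) C j * ((- t) ^+ j * expR (- t))%:C.
  rewrite /kernel_monomial mulr_sumr; apply: eq_bigr => j _.
  by rewrite /C -/e [X in _ = _ * X]rmorphM rmorphXn/=; ring.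
have cS j : S j @ \oo --> (- t) ^+ j * expR (- t) by exact: cvg_series_ffact_exp.
have Rr (z : R[i]) (a : R) : Re (z * a%:C) = Re z * a by rewrite cReM/= mulr0 subr0.
have Ir (z : R[i]) (a : R) : Im (z * a%:C) = Im z * a by rewrite cImM/= mulr0 add0r.
rewrite limE; apply: cvg_complexP.
  under eq_fun do rewrite SE cRe_sum.
  rewrite cRe_sum; apply: cvgn_sum => j.
  under eq_fun do rewrite Rr.
  by rewrite Rr; apply: cvgMl_tmp.
under eq_fun do rewrite SE cIm_sum.
rewrite cIm_sum; apply: cvgn_sum => j.
under eq_fun do rewrite Ir.
by rewrite Ir; apply: cvgMl_tmp.
Qed.

(** Dominated convergence for the partial sums [P n], which [kcoef_le] bounds by [C e^(s/2)]
    uniformly in [n]. The 2 in [g] comes from the complex density [mdens]. *)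
Lemma bessel_kernel_monomial l t : 0 < t ->
  cintegrable (fun s => bessel_kernel c (s * t) * (s%:C ^+ l * mdens q s)) /\
  cint (fun s => bessel_kernel c (s * t) * (s%:C ^+ l * mdens q s)) =
  kernel_monomial l t.
Proof.
move=> t0; have [C C0 HC] := kcoef_le c0 (ltW t0).
pose P n s := \sum_(m < n) kcoef c m * (s * t)%:C ^+ m.
pose g s := C * 2 * (s `^ (l%:R + 2 * Re q - 1) * expR (- (2^-1 * s))).
have ig : ible g.
  apply: ibleZ; apply: integrable_powR_expR; last by rewrite invr_gt0.
  by rewrite ltr_wpDl// mulr_gt0.
have Pg n s : 0 < s -> norm1c (P n s * (s%:C ^+ l * mdens q s)) <= g s.
  move=> s0; have s1 := ltW s0; have t1 := ltW t0; apply: (le_trans (norm1cM _ _)).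
  have h1 : norm1c (P n s) <= C * expR (2^-1 * s).
    apply: (le_trans (norm1c_sum _ _ _)).
    apply: (@le_trans _ _ (C * series (exp_coeff (2^-1 * s)) n)).
      rewrite /series/= big_mkord mulr_sumr; apply: ler_sum => m _.
      apply: (le_trans (norm1cM _ _)).
      rewrite -rmorphXn/= norm1c_real ger0_norm ?exprn_ge0 ?mulr_ge0//.
      have -> : norm1c (kcoef c m) * (s * t) ^+ m = norm1c (kcoef c m) * t ^+ m * s ^+ m.
        by rewrite exprMn; ring.
      have -> : C * exp_coeff (2^-1 * s) m = C * (2^-1 ^+ m / m`!%:R) * s ^+ m.
        by rewrite /exp_coeff/= exprMn; ring.
      by rewrite ler_wpM2r ?exprn_ge0.
    rewrite ler_wpM2l// /expR; apply: nondecreasing_cvgn_le.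
      apply: nondecreasing_series => k _ _; apply: exp_coeff_ge0.
      by rewrite mulr_ge0//.
    exact: is_cvg_series_exp_coeff.
  have h2 : norm1c (s%:C ^+ l * mdens q s) <= s ^+ l * (2 * lweight (Re q) s).
    apply: (le_trans (norm1cM _ _)); rewrite -rmorphXn/= norm1c_real.
    rewrite ger0_norm ?exprn_ge0// ler_wpM2l ?exprn_ge0//.
    exact: norm1c_mdens.
  apply: (le_trans (ler_pM (norm1c_ge0 _) (norm1c_ge0 _) h1 h2)).
  rewrite /g -powR_addn// /lweight.
  have -> : expR (- (2^-1 * s)) = expR (2^-1 * s) * expR (- s).
    by rewrite -expRD; congr expR; field.
  by rewrite le_eqVlt; apply/orP; left; apply/eqP; ring.
have cP s : (fun n => Re (P n s)) @ \oo --> Re (bessel_kernel c (s * t)) /\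
            (fun n => Im (P n s)) @ \oo --> Im (bessel_kernel c (s * t)).
  have [D [hr hi]] := kcoef_fact_bounded c0.
  rewrite bessel_kernel_psum//=; split.
    rewrite (_ : (fun n => Re (P n s)) = pseries (kRe c) (s * t)); first exact: fact_bounded_cvg hr.
    apply/funext => n; rewrite /P cRe_sum /pseries /series/= big_mkord.
    by apply: eq_bigr => m _; rewrite Re_kterm.
  rewrite (_ : (fun n => Im (P n s)) = pseries (kIm c) (s * t)); first exact: fact_bounded_cvg hi.
  apply/funext => n; rewrite /P cIm_sum /pseries /series/= big_mkord.
  by apply: eq_bigr => m _; rewrite Im_kterm.
have PE n s : P n s * (s%:C ^+ l * mdens q s) =
    \sum_(m < n) kcoef c m * t%:C ^+ m * (s%:C ^+ (m + l) * mdens q s).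
  rewrite /P mulr_suml; apply: eq_bigr => m _.
  by rewrite rmorphM exprMn exprD/=; ring.
have iP n : cintegrable (fun s => P n s * (s%:C ^+ l * mdens q s)).
  apply: (@eq_cintegrable _ (fun s => \sum_(m < n) kcoef c m * t%:C ^+ m * (s%:C ^+ (m + l) * mdens q s))).
    by move=> s _; rewrite PE.
  apply: cintegrable_sum => m; apply: cintegrableZ; exact: cintegrable_monomial.
have cE n : cint (fun s => P n s * (s%:C ^+ l * mdens q s)) =
    series ((fun m => kcoef c m * t%:C ^+ m * Gamma ((m + l)%:R + c)) : nat -> R[i]^o) n.
  rewrite /series/= big_mkord.
  transitivity (cint (fun s => \sum_(m < n) kcoef c m * t%:C ^+ m * (s%:C ^+ (m + l) * mdens q s))).
    by apply: eq_cint => s _; rewrite PE.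
  rewrite cint_sum; last first.
    by move=> m; apply: cintegrableZ; exact: cintegrable_monomial.
  apply: eq_bigr => m _; rewrite cintZ ?cint_monomial//; exact: cintegrable_monomial.
have [] := @cint_dominated_cvg R (fun n s => P n s * (s%:C ^+ l * mdens q s))
  (fun s => bessel_kernel c (s * t) * (s%:C ^+ l * mdens q s)) g.
- by move=> n; have [/integrable_measurable + _] := iP n.
- by move=> n; have [_ /integrable_measurable] := iP n.
- move=> s s0; have [c1 c2] := cP s.
  rewrite cReM; under eq_fun do rewrite cReM.
  by apply: cvgB; apply: cvgMr_tmp.
- move=> s s0; have [c1 c2] := cP s.
  rewrite cImM; under eq_fun do rewrite cImM.
  by apply: cvgD; apply: cvgMr_tmp.
- exact: ig.
- exact: Pg.
move=> ci cr cim; split => //.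
apply: (@cseries_cvg_unique R (fun m => kcoef c m * t%:C ^+ m * Gamma ((m + l)%:R + c)));
  last exact: cvg_kernel_moments.
apply: cvg_complexP.
  by under eq_fun do rewrite -cE.
by under eq_fun do rewrite -cE.
Qed.

End Action.
End KernelMonomials.

(** * Uniqueness in the moment problem *)

Section Moments.
Context {R : realType}.
Local Notation mu := (@lebesgue_measure R).
Local Notation ible f := (mu.-integrable Rpos (EFin \o f)).
Implicit Types (F : R -> R) (a d t x : R).

Lemma expn_le_expR h t k : 0 < h -> 0 <= t -> t ^+ k <= k`!%:R / h ^+ k * expR (h * t).
Proof.
move=> h0 t0; have ht : 0 <= h * t by rewrite mulr_ge0 // ltW.
have hk : 0 < h ^+ k by rewrite exprn_gt0.
have fk : 0 < k`!%:R :> R by rewrite ltr0n fact_gt0.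
have e : (h * t) ^+ k / k`!%:R <= expR (h * t).
  case: k {hk fk} => [|k]; first by rewrite expr0 fact0 divr1 -[leLHS]expR0 ler_expR.
  by apply: le_trans (expR_ge1Dxn k ht); rewrite lerDr.
rewrite mulrAC ler_pdivlMr// mulrC -exprMn.
by move: e; rewrite ler_pdivrMr// [leRHS]mulrC.
Qed.

Lemma norm_exp_partial_le x n : `|series (exp_coeff x) n| <= expR `|x|.
Proof.
apply: (@le_trans _ _ (series (exp_coeff `|x|) n)).
  apply: (le_trans (ler_norm_sum _ _ _)); apply: ler_sum => k _.
  by rewrite /exp_coeff/= normrM normrX normfV normr_nat.
apply: nondecreasing_cvgn_le.
  by apply: nondecreasing_series => k _ _; exact: exp_coeff_ge0.
exact: is_cvg_series_exp_coeff.
Qed.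

(** The partial exponential sums are dominated by [e^(B t)]. The lemma serves once for a shift of
    the Laplace transform, with [x = - h t], and once for Phragmen's kernels, with [x] itself minus
    an exponential. *)
Let Rint_series_exp F (x : R -> R) (B : R -> R) : measurable_fun Rpos x ->
  (forall t, 0 < t -> `|x t| <= B t) -> measurable_fun Rpos F ->
  ible (fun t => F t * expR (B t)) ->
  (forall k, ible (fun t => F t * x t ^+ k)) ->
  (forall k, \int[mu]_(t in Rpos) (F t * x t ^+ k) = 0) ->
  \int[mu]_(t in Rpos) (F t * expR (x t)) = 0.
Proof.
move=> mx xB mF iB ik h0.
have [_ cv] : ible (fun t => F t * expR (x t)) /\
    (\int[mu]_(t in Rpos) (F t * series (exp_coeff (x t)) n)) @[n --> \oo] -->
    \int[mu]_(t in Rpos) (F t * expR (x t)).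
  refine (Rintegral_dominated_cvg measurable_Rpos
    (f_ := fun n t => F t * series (exp_coeff (x t)) n) _ _ (integrable_norm iB) _).
  - move=> n; apply: measurable_funM => //; rewrite /series/=.
    apply: measurable_sum => k; rewrite /exp_coeff/=.
    by apply: measurable_funM => //; exact: measurable_funX.
  - move=> t _; apply: cvgMl_tmp; exact: is_cvg_series_exp_coeff.
  - move=> n t; rewrite RposE => t0 /=; rewrite !normrM ler_wpM2l//.
    rewrite (le_trans (norm_exp_partial_le _ _))// ger0_norm ?expR_ge0//.
    by rewrite ler_expR xB.
have e n : \int[mu]_(t in Rpos) (F t * series (exp_coeff (x t)) n) = 0.
  elim: n => [|n IHn].
    rewrite (@eq_Rintegral _ _ _ mu _ (cst 0)) ?/Rintegral ?integral0// => t _.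
    by rewrite /series/= big_geq// mulr0.
  have i1 : ible (fun t => F t * series (exp_coeff (x t)) n).
    elim: n {IHn} => [|n IHn].
      apply: eq_ible (integrable0 mu Rpos) => t _.
      by rewrite /series/= big_geq// mulr0.
    apply: eq_ible (ibleD IHn (ibleZ (n`!%:R^-1) (ik n))) => t _.
    by rewrite /series/= big_nat_recr//= mulrDr /exp_coeff/=; congr (_ + _); ring.
  transitivity (\int[mu]_(t in Rpos) (F t * series (exp_coeff (x t)) n + n`!%:R^-1 * (F t * x t ^+ n))).
    apply: eq_Rintegral => t _.
    by rewrite /series/= big_nat_recr//= mulrDr /exp_coeff/=; congr (_ + _); ring.
  rewrite (RintegralD measurable_Rpos i1 (ibleZ _ (ik n))) IHn add0r.
  by rewrite (RintegralZl _ measurable_Rpos (ik n)) h0 mulr0.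
rewrite (_ : (fun n => _) = cst 0) in cv; last by apply/funext => n; rewrite e.
by apply: (cvgn_uniq cv); exact: cvg_cst.
Qed.

(* The Laplace transform of F vanishes at all multiples of d/2: it is analytic, so
   the vanishing of all its derivatives propagates by steps of length d/2. Then
   Phragmen's kernels exp(- exp(n h (a - t))), which are series of exponentials,
   approximate the indicator function of t > a. *)
Lemma moments_determine F d : 0 < d -> ible (fun t => F t * expR (d * t)) ->
  (forall k, \int[mu]_(t in Rpos) (F t * t ^+ k) = 0) ->
  {ae mu, forall t, Rpos t -> F t = 0}.
Proof.
(* Half of the exponential moment absorbs the powers of [t]; the other half dominates the expansion
   of [e^(- h t)] in one step of length [h]. *)
move=> d0 iF mom; pose h := d / 2; have h0 : 0 < h by rewrite divr_gt0.
have mexp (b : R) : measurable_fun Rpos (fun t => expR (b * t)).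
  apply: measurableT_comp => //; exact: measurable_funM.
have mid : measurable_fun Rpos (id : R -> R) by exact: measurable_id.
have mF : measurable_fun Rpos F.
  apply: (eq_measurable_fun (fun t => F t * expR (d * t) * expR (- d * t))).
    by move=> t _; rewrite -mulrA -expRD mulNr subrr expR0 mulr1.
  by apply: measurable_funM => //; exact: integrable_measurable iF.
have mFk k a : measurable_fun Rpos (fun t => F t * t ^+ k * expR (- (a * t))).
  apply: measurable_funM; first by apply: measurable_funM => //; exact: measurable_funX.
  have -> : (fun t => expR (- (a * t))) = (fun t => expR (- a * t)) by apply/funext => t; rewrite mulNr.
  exact: mexp.
have iFk k a : 0 <= a -> ible (fun t => F t * t ^+ k * expR (- (a * t)) * expR (h * t)).
  move=> a0; apply: (integrable_le measurable_Rpos _ _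
    (ibleZ (k`!%:R / h ^+ k) (integrable_norm iF))).
    exact: (measurable_funM (mFk k a) (mexp h)).
  move=> t; rewrite RposE => t0 /=; rewrite !normrM; have t1 := ltW t0.
  rewrite !(ger0_norm (expR_ge0 _)) (@ger0_norm _ (t ^+ k)) ?exprn_ge0//.
  have -> : expR (d * t) = expR (h * t) * expR (h * t).
    by rewrite -expRD; congr expR; rewrite /h; field.
  have e1 : expR (- (a * t)) <= 1.
    by rewrite -expR0 ler_expR oppr_le0 mulr_ge0// ltW.
  have e2 := expn_le_expR k h0 (ltW t0).
  have n0 : 0 <= `|F t| by exact: normr_ge0.
  have -> : `|F t| * t ^+ k * expR (- (a * t)) * expR (h * t) =
    `|F t| * expR (h * t) * (t ^+ k * expR (- (a * t))) by ring.
  have -> : k`!%:R / h ^+ k * (`|F t| * (expR (h * t) * expR (h * t))) =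
    `|F t| * expR (h * t) * (k`!%:R / h ^+ k * expR (h * t)) by ring.
  rewrite ler_wpM2l ?mulr_ge0 ?expR_ge0//.
  by rewrite (le_trans _ e2)// -[leRHS]mulr1 ler_wpM2l// exprn_ge0// ltW.
have iFk' k a : 0 <= a -> ible (fun t => F t * t ^+ k * expR (- (a * t))).
  move=> a0; apply: (integrable_le measurable_Rpos _ _ (integrable_norm (iFk k a a0))).
    exact: mFk.
  move=> t; rewrite RposE => t0 /=; rewrite [leRHS]normrM -[leLHS]mulr1 ler_wpM2l//.
  by rewrite ger0_norm ?expR_ge0// -expR0 ler_expR mulr_ge0 ?ltW.
have step a : 0 <= a -> (forall k, \int[mu]_(t in Rpos) (F t * t ^+ k * expR (- (a * t))) = 0) ->
    forall k, \int[mu]_(t in Rpos) (F t * t ^+ k * expR (- ((a + h) * t))) = 0.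
  move=> a0 IH k.
  have pw j t : F t * t ^+ (k + j) * expR (- (a * t)) * (- h) ^+ j =
      F t * t ^+ k * expR (- (a * t)) * (- h * t) ^+ j by rewrite exprD exprMn; ring.
  have ipw j : ible (fun t => F t * t ^+ k * expR (- (a * t)) * (- h * t) ^+ j).
    by apply: eq_ible (ibleZ ((- h) ^+ j) (iFk' (k + j)%N a a0)) => t _; rewrite -pw mulrC.
  have := @Rint_series_exp (fun t => F t * t ^+ k * expR (- (a * t))) (fun t => - h * t) (fun t => h * t).
  rewrite (_ : (fun t => F t * t ^+ k * expR (- (a * t)) * expR (- h * t)) =
    (fun t => F t * t ^+ k * expR (- ((a + h) * t)))); last first.
    by apply/funext => t; rewrite -[LHS]mulrA -expRD; congr (_ * expR _); ring.
  apply => //.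
  - exact: measurable_funM.
  - by move=> t t0; rewrite normrM normrN (gtr0_norm h0) (gtr0_norm t0).
  - exact: iFk.
  - move=> j; transitivity (\int[mu]_(t in Rpos) ((- h) ^+ j * (F t * t ^+ (k + j) * expR (- (a * t))))).
      by apply: eq_Rintegral => t _; rewrite -pw mulrC.
    by rewrite (RintegralZl _ measurable_Rpos (iFk' (k + j)%N a a0)) IH mulr0.
have lap n k : \int[mu]_(t in Rpos) (F t * t ^+ k * expR (- (n%:R * h * t))) = 0.
  elim: n k => [|n IHn] k.
    rewrite -[RHS](mom k); apply: eq_Rintegral => t _.
    by rewrite !mul0r oppr0 expR0 mulr1.
  have nh0 : 0 <= n%:R * h by rewrite mulr_ge0// ltW.
  rewrite -[RHS](step _ nh0 IHn k).
  by apply: eq_Rintegral => t _; rewrite -natr1 mulrDl mul1r.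
have iL n : ible (fun t => F t * expR (- (n%:R * h * t))).
  have nh0 : 0 <= n%:R * h by rewrite mulr_ge0// ltW.
  by apply: eq_ible (iFk' 0%N _ nh0) => t _; rewrite expr0 mulr1.
have lap0 n : \int[mu]_(t in Rpos) (F t * expR (- (n%:R * h * t))) = 0.
  by rewrite -[RHS](lap n 0%N); apply: eq_Rintegral => t _; rewrite expr0 mulr1.
have i_F : ible F.
  by apply: eq_ible (iL 0%N) => t _; rewrite !mul0r oppr0 expR0 mulr1.
(* The [k]-th power of the inner exponential is a multiple of [e^(- k n h t)], so all terms of the
   outer series integrate to 0 by [lap0]. As [t > 0], the inner exponential is at most
   [e^(n h a)]. *)
have phragmen a n : \int[mu]_(t in Rpos) (F t * expR (- expR (n%:R * h * (a - t)))) = 0.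
  have pw k t : F t * (- expR (n%:R * h * (a - t))) ^+ k =
      ((- 1) ^+ k * expR ((k * n)%:R * h * a)) * (F t * expR (- ((k * n)%:R * h * t))).
    rewrite -[- expR (_ * (a - t))]mulN1r exprMn -expRM_natl [RHS]mulrCA; congr (_ * _).
    rewrite -[RHS]mulrA -expRD; congr (_ * expR _).
    by rewrite natrM; ring.
  apply: (@Rint_series_exp F (fun t => - expR (n%:R * h * (a - t))) (fun=> expR (n%:R * h * a))) => //.
  - apply: measurableT_comp => //; apply: measurableT_comp => //.
    by apply: measurable_funM => //; exact: measurable_funB.
  - move=> t t0; rewrite normrN ger0_norm ?expR_ge0// ler_expR ler_wpM2l//; first by rewrite mulr_ge0// ltW.
    by rewrite lerBlDr lerDl ltW.
  - by apply: eq_ible (ibleZ (expR (expR (n%:R * h * a))) i_F) => t _; rewrite mulrC.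
  - by move=> k; apply: eq_ible (ibleZ _ (iL (k * n)%N)) => t _; rewrite pw.
  - move=> k; under eq_Rintegral do rewrite pw.
    by rewrite (RintegralZl _ measurable_Rpos (iL (k * n)%N)) lap0 mulr0.
pose g a t : R := if t < a then 0 else if t == a then expR (- 1) else 1.
have gcvg a t : (fun n => expR (- expR (n%:R * h * (a - t)))) @ \oo --> g a t.
  have lin (e : R) : 0 < e -> (fun n => expR (- (n%:R * e))) @ \oo --> (0 : R).
    move=> e0; rewrite (_ : (fun n => _) = (fun n => expR (- e) ^+ n)); last first.
      by apply/funext => n; rewrite -mulrN expRM_natl.
    apply: cvg_expr; rewrite ger0_norm ?expR_ge0//.
    by rewrite expR_lt1 oppr_lt0.
  rewrite /g; case: ltgtP => [ta|at_|->].
  - have e0 : 0 < h * (a - t) by rewrite mulr_gt0// subr_gt0.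
    apply: (@squeeze_cvgr _ _ _ _ (cst 0) (fun n => expR (- (n%:R * (h * (a - t)))))).
    + apply: nearW => n; rewrite expR_ge0 ler_expR lerN2 mulrA.
      by rewrite (le_trans _ (expR_ge1Dx _))// lerDr.
    + exact: cvg_cst.
    + exact: lin.
  - have e0 : 0 < h * (t - a) by rewrite mulr_gt0// subr_gt0.
    have c1 : (fun n => expR (n%:R * h * (a - t))) @ \oo --> (0 : R).
      rewrite (_ : (fun n => _) = (fun n => expR (- (n%:R * (h * (t - a))))))//; first exact: lin.
      by apply/funext => n; congr expR; ring.
    have c2 := cvg_comp _ _ (cvgN c1) (@continuous_expR R (- 0)).
    rewrite oppr0 expR0 in c2; exact: (c2 _).
  - by under eq_fun do rewrite subrr mulr0 expR0; exact: cvg_cst.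
have [ig Ig] : (forall a, ible (fun t => F t * g a t)) /\
    (forall a, \int[mu]_(t in Rpos) (F t * g a t) = 0).
  suff H a : ible (fun t => F t * g a t) /\ \int[mu]_(t in Rpos) (F t * g a t) = 0.
    by split => a; have [] := H a.
  have [i1 cv] : ible (fun t => F t * g a t) /\
    (\int[mu]_(t in Rpos) (F t * expR (- expR (n%:R * h * (a - t))))) @[n --> \oo] -->
    \int[mu]_(t in Rpos) (F t * g a t).
    refine (Rintegral_dominated_cvg measurable_Rpos
      (f_ := fun n t => F t * expR (- expR (n%:R * h * (a - t)))) _ _ (integrable_norm i_F) _).
    - move=> n; apply: measurable_funM => //; apply: measurableT_comp => //.
      apply: measurableT_comp => //; apply: measurableT_comp => //.
      by apply: measurable_funM => //; exact: measurable_funB.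
    - by move=> t _; apply: cvgMl_tmp; exact: gcvg.
    - move=> n t _ /=; rewrite normrM -[leRHS]mulr1 ler_wpM2l//.
      by rewrite ger0_norm ?expR_ge0// -expR0 ler_expR oppr_le0 expR_ge0.
  split => //; rewrite (_ : (fun n => _) = cst 0) in cv; last by apply/funext => n; rewrite phragmen.
  by apply/esym; apply: (cvgn_uniq _ cv); exact: cvg_cst.
(* The indicator of [t <= a] is [1 - g a] corrected at the single point [a], where the limit of the
   kernels is [e^(-1)]. *)
have cum a : \int[mu]_(t in `]-oo, a]) ((F \_ Rpos) t) = 0.
  rewrite -Rintegral_mkcondr setIC Rintegral_mkcondr.
  transitivity (\int[mu]_(t in Rpos) (F t - F t * g a t + expR (- 1) * (F \_ [set a]) t)).
    apply: eq_Rintegral => t _; rewrite !patchE /g.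
    case: ifPn => [/set_mem|]; rewrite ?notin_setE/= in_itv/=.
      rewrite le_eqVlt => /predU1P[->|ta].
        by rewrite ltxx eqxx mem_set//; ring.
      by rewrite ta memNset/= ?mulr0 ?subr0 ?addr0// => e; rewrite e ltxx in ta.
    move=> /negP; rewrite -ltNge => at_.
    rewrite ltNge ltW//= gt_eqF// memNset/= ?mulr0 ?mulr1 ?subrr ?addr0//.
    by move=> e; rewrite e ltxx in at_.
  have ia : ible (F \_ [set a]).
    apply: (integrable_le measurable_Rpos _ _ (integrable_norm i_F)).
      by apply/measurable_restrict => //; exact: (measurable_funS measurable_Rpos (@subIsetl _ _ _) mF).
    by move=> t _; rewrite patchE /=; case: ifP => // _; rewrite normr0 ?normr_ge0.
  rewrite (RintegralD measurable_Rpos (ibleB i_F (ig a)) (ibleZ _ ia)).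
  rewrite (RintegralB measurable_Rpos i_F (ig a)) Ig (RintegralZl _ measurable_Rpos ia).
  have -> : \int[mu]_(t in Rpos) F t = 0.
    by rewrite -[RHS](lap0 0%N); apply: eq_Rintegral => t _; rewrite !mul0r oppr0 expR0 mulr1.
  rewrite -Rintegral_mkcondr subrr add0r.
  have [a0|a0] := ltP 0 a.
    rewrite setIidr; last by move=> t ->; rewrite RposE.
    by rewrite Rintegral_set1 mulr0.
  rewrite (_ : Rpos `&` [set a] = set0) ?Rintegral_set0 ?mulr0//.
  by apply/seteqP; split => // t [/=]; rewrite RposE => t0 e; move: t0; rewrite e ltNge a0.
have iT : mu.-integrable setT (EFin \o (F \_ Rpos)).
  by rewrite -restrict_EFin; apply/(integrable_mkcond _ measurable_Rpos).
have i_y y : mu.-integrable `]-oo, y] (EFin \o (F \_ Rpos)).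
  by apply: (integrableS measurableT _ _ iT).
have iloc : locally_integrable [set: R] (F \_ Rpos).
  exact: (integrable_locally measurable_Rpos i_F).
(* By Lebesgue differentiation [F] is almost everywhere the derivative of its primitive, which is
   identically 0 by [cum]. *)
have := FTC1Ny i_y iloc; apply: filterS; first exact: (ae_filter_ringOfSetsType mu).
move=> t [_ h1] tp; move: h1; rewrite patchE mem_set// => <-.
rewrite (_ : (fun x => \int[mu]_(t in _) _) = cst 0) ?derive1_cst//.
by apply/funext => x; exact: cum.
Qed.

End Moments.

(** Chu-Vandermonde applied to [poch (a + l) p] leaves sums over [l] of the kind of
    [sum_bin_ffact]. *)
Lemma sum_bin_poch {F : comNzRingType} (a y : F) (n p : nat) :
  \sum_(l < n.+1) 'C(n, l)%:R * y ^+ l * poch (a + l%:R) p =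
  \sum_(j < p.+1) ('C(p, j) * n ^_ j)%:R * poch (a + j%:R) (p - j) * y ^+ j * (1 + y) ^+ (n - j).
Proof.
transitivity (\sum_(j < p.+1) 'C(p, j)%:R * poch (a + j%:R) (p - j) *
    \sum_(l < n.+1) ('C(n, l) * l ^_ j)%:R * y ^+ l); last first.
  by apply: eq_bigr => j _; rewrite sum_bin_ffact natrM; ring.
under [RHS]eq_bigr do rewrite mulr_sumr.
rewrite exchange_big/=; apply: eq_bigr => l _.
rewrite poch_vandermonde mulr_sumr; apply: eq_bigr => j _.
by rewrite !natrM; ring.
Qed.

(** * Orthogonality, completeness and expansions in the real space L^2(m_xi) *)

Section LaguerreBasis.
Context {R : realType}.
Variable xi : R.
Hypothesis xi_gt0 : 0 < xi.
Local Notation mu := (@lebesgue_measure R).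
Local Notation ible f := (mu.-integrable Rpos (EFin \o f)).
Local Notation a := (2 * xi).
Local Notation w := (lweight xi).
Implicit Types (f g : R -> R) (Phi : nat -> R) (t : R) (k l m n p : nat).

Let a0 : 0 < a. Proof. by rewrite mulr_gt0. Qed.

Let an0 n : 0 < n%:R + a. Proof. by rewrite ltr_wpDl. Qed.

Definition lnorm n : R := rGamma (n%:R + a) / n`!%:R.

Lemma lnorm_gt0 n : 0 < lnorm n.
Proof. by rewrite divr_gt0 ?rGamma_gt0// ltr0n fact_gt0. Qed.

(** The Laguerre coefficients in binomial form, which is what [sum_bin_poch] accepts; [lnorm n] will
    be the squared norm of [lag n]. *)
Definition lcoef n l : R := lnorm n * 'C(n, l)%:R * (-1) ^+ l / rGamma (l%:R + a).

Definition lag n t : R := \sum_(l < n.+1) lcoef n l * t ^+ l.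

Lemma LaguerreE n t : Laguerre xi n t = (lag n t)%:C.
Proof.
rewrite /Laguerre /lag rmorph_sum; apply: eq_bigr => -[l /= ln] _.
have e k : Gamma (k%:R + 2 * xi%:C) = (rGamma (k%:R + a))%:C.
  by rewrite -Gamma_real rmorphD rmorphM !rmorph_nat.
rewrite !e rmorphM rmorphXn/=; congr (_ * _).
rewrite -(rmorph_nat (real_complex R) (n - l)`!) -(rmorph_nat (real_complex R) l`!).
rewrite -[-1 : R[i]](rmorphN1 (real_complex R)) -[(_ ^+ l : R[i])]rmorphXn.
rewrite -rmorphM -!fmorphV -!rmorphM; congr (_%:C).
rewrite /lcoef /lnorm -(bin_fact (ln : (l <= n)%N)) !natrM.
have := rGamma_gt0 (an0 l); set G := rGamma (l%:R + a) => G0.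
have C0 : 'C(n, l)%:R != 0 :> R by rewrite pnatr_eq0 -lt0n bin_gt0.
have f1 : (n - l)`!%:R != 0 :> R by rewrite pnatr_eq0 -lt0n fact_gt0.
have f2 : l`!%:R != 0 :> R by rewrite pnatr_eq0 -lt0n fact_gt0.
by field; rewrite C0 f1 f2 gt_eqF.
Qed.

Lemma ible_monomial k : ible (fun t => t ^+ k * w t).
Proof.
apply: eq_ible (integrable_powR_expR (an0 k) ltr01) => t t0.
by rewrite /lweight mul1r mulrA powR_addn.
Qed.

Lemma Rint_monomial k : \int[mu]_(t in Rpos) (t ^+ k * w t) = rGamma (k%:R + a).
Proof.
apply: eq_Rintegral => t /set_mem; rewrite RposE => t0.
by rewrite /lweight mulrA powR_addn.
Qed.

Let expR2 t : expR (- (2 * t)) = expR (- t) * expR (- t).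
Proof. by rewrite -expRD; congr expR; ring. Qed.

Lemma Rint_exp_monomial k :
  \int[mu]_(t in Rpos) (expR (- t) * (t ^+ k * w t)) =
  2 `^ (- (k%:R + a)) * rGamma (k%:R + a).
Proof.
rewrite -Rintegral_powR_exp2//.
apply: eq_Rintegral => t /set_mem; rewrite RposE => t0.
by rewrite /lweight expR2 -powR_addn//; ring.
Qed.

Definition rL2 f := measurable_fun Rpos f /\ ible (fun t => f t ^+ 2 * w t).

Lemma rL2D f g : rL2 f -> rL2 g -> rL2 (fun t => f t + g t).
Proof.
move=> [mf i_f] [mg ig]; split; first exact: measurable_funD.
apply: (integrable_le measurable_Rpos _ _ (ibleD (ibleZ 2 i_f) (ibleZ 2 ig))).
  apply: measurable_funM; last exact: measurable_lweight.
  by apply: measurable_funX; exact: measurable_funD.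
move=> t _; have w0 := lweight_ge0 xi t.
move: (w t) w0 => W w0; rewrite /= (ger0_norm (mulr_ge0 (sqr_ge0 _) w0)) !mulrA -mulrDl ler_wpM2r//.
by have := sqr_ge0 (f t - g t); nra.
Qed.

Lemma rL2Z (x : R) f : rL2 f -> rL2 (fun t => x * f t).
Proof.
move=> [mf i_f]; split; first exact: measurable_funM.
by apply: eq_ible (ibleZ (x ^+ 2) i_f) => t _; move: (w t) => W; rewrite exprMn mulrA.
Qed.

Lemma rL2B f g : rL2 f -> rL2 g -> rL2 (fun t => f t - g t).
Proof.
move=> i_f ig; have := rL2D i_f (rL2Z (-1) ig).
by under eq_fun do rewrite mulN1r.
Qed.

Lemma rL20 : rL2 (fun=> 0).
Proof.
split=> //; apply: eq_ible (integrable0 mu Rpos) => t _.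
by rewrite expr0n mul0r.
Qed.

Lemma rL2_sum (I : Type) (r : seq I) (F : I -> R -> R) :
  (forall i, rL2 (F i)) -> rL2 (fun t => \sum_(i <- r) F i t).
Proof.
move=> iF; elim: r => [|i r IHr].
  by under eq_fun do rewrite big_nil; exact: rL20.
by under eq_fun do rewrite big_cons; exact: rL2D.
Qed.

Lemma rL2_monomial k : rL2 (fun t => t ^+ k).
Proof.
split; first exact: measurable_funX.
by apply: eq_ible (ible_monomial (k * 2)) => t _; rewrite exprM.
Qed.

Lemma rL2_lag n : rL2 (lag n).
Proof. by apply: rL2_sum => l; apply: rL2Z; exact: rL2_monomial. Qed.

Lemma rL2_le f g : rL2 g -> measurable_fun Rpos f ->
  (forall t, 0 < t -> `|f t| <= `|g t|) -> rL2 f.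
Proof.
move=> [mg ig] mf fg; split => //.
apply: (integrable_le measurable_Rpos _ _ ig).
  by apply: measurable_funM; [exact: measurable_funX|exact: measurable_lweight].
move=> t; rewrite RposE => t0; have w0 := lweight_ge0 xi t.
rewrite (ger0_norm (mulr_ge0 (sqr_ge0 _) w0)) ler_wpM2r//.
rewrite -(real_normK (num_real (f t))) -(real_normK (num_real (g t))).
by rewrite lerXn2r ?nnegrE ?fg.
Qed.

Lemma rL2_mul f g : rL2 f -> rL2 g ->
  [/\ ible (fun t => `|f t| * `|g t| * w t), ible (fun t => f t * g t * w t) &
  (\int[mu]_(t in Rpos) (`|f t| * `|g t| * w t)) ^+ 2 <=
  (\int[mu]_(t in Rpos) (f t ^+ 2 * w t)) * (\int[mu]_(t in Rpos) (g t ^+ 2 * w t))].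
Proof.
move=> [mf i_f] [mg ig].
have [i1 CS] := Rintegral_cauchy_schwarz measurable_Rpos mf mg (measurable_lweight xi)
  (fun t _ => lweight_ge0 xi t) i_f ig.
split => //; apply: (integrable_le measurable_Rpos _ _ i1).
  by apply: measurable_funM; [exact: measurable_funM|exact: measurable_lweight].
by move=> t _; rewrite (normrM _ (w t)) normrM (ger0_norm (lweight_ge0 _ _)).
Qed.

Definition ip f g : R := \int[mu]_(t in Rpos) (f t * g t * w t).

Lemma ipC f g : ip f g = ip g f.
Proof. by apply: eq_Rintegral => t _; rewrite [f t * _]mulrC. Qed.

Lemma ipDl f1 f2 g : rL2 f1 -> rL2 f2 -> rL2 g ->
  ip (fun t => f1 t + f2 t) g = ip f1 g + ip f2 g.
Proof.
move=> i1 i2 ig; have [_ j1 _] := rL2_mul i1 ig; have [_ j2 _] := rL2_mul i2 ig.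
rewrite -(RintegralD measurable_Rpos j1 j2).
by apply: eq_Rintegral => t _; rewrite !mulrDl.
Qed.

Lemma ipZl x f g : rL2 f -> rL2 g -> ip (fun t => x * f t) g = x * ip f g.
Proof.
move=> i1 ig; have [_ j1 _] := rL2_mul i1 ig.
rewrite -(RintegralZl _ measurable_Rpos j1).
by apply: eq_Rintegral => t _; rewrite !mulrA.
Qed.

Lemma ipBl f1 f2 g : rL2 f1 -> rL2 f2 -> rL2 g ->
  ip (fun t => f1 t - f2 t) g = ip f1 g - ip f2 g.
Proof.
move=> i1 i2 ig; rewrite -mulN1r -ipZl// -ipDl//; last exact: rL2Z.
by apply: eq_Rintegral => t _; rewrite mulN1r.
Qed.

Lemma ip_suml (I : Type) (r : seq I) (F : I -> R -> R) g :
  (forall i, rL2 (F i)) -> rL2 g ->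
  ip (fun t => \sum_(i <- r) F i t) g = \sum_(i <- r) ip (F i) g.
Proof.
move=> iF ig; elim: r => [|i r IHr].
  rewrite big_nil /ip (@eq_Rintegral _ _ _ mu _ (cst 0)) ?/Rintegral ?integral0// => t _.
  by rewrite big_nil !mul0r.
rewrite big_cons -IHr -ipDl//; last exact: rL2_sum.
by apply: eq_Rintegral => t _; rewrite big_cons.
Qed.

Lemma ip_ge0 f : 0 <= ip f f.
Proof.
apply: Rintegral_ge0 => t _; rewrite -expr2; exact: (mulr_ge0 (sqr_ge0 _) (lweight_ge0 _ _)).
Qed.

Lemma ip_sqr f : ip f f = \int[mu]_(t in Rpos) (f t ^+ 2 * w t).
Proof. by []. Qed.

(* y = 1 and y = 1/2 give the moments of lag n with respect to the measures m_xi
   and e^(-t) m_xi. *)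
Lemma lag_poch_sum n p (y : R) :
  \sum_(l < n.+1) lcoef n l * y ^+ l * rGamma ((p + l)%:R + a) =
  lnorm n * \sum_(j < p.+1) ('C(p, j) * n ^_ j)%:R * poch (a + j%:R) (p - j) *
    (- y) ^+ j * (1 - y) ^+ (n - j).
Proof.
rewrite -sum_bin_poch mulr_sumr; apply: eq_bigr => l _.
rewrite natrD -addrA rGamma_poch// /lcoef [a + _]addrC.
rewrite -[- y]mulN1r exprMn; have := rGamma_gt0 (an0 l).
by move: (rGamma _) (poch _ _) ((-1) ^+ l) => G P s G0; field; rewrite gt_eqF.
Qed.

(** At [y = 1] the factor [0 ^+ (n - j)] singles out [j = n]; for [p < n] the binomial coefficient
    makes the result 0, which is orthogonality to lower degrees. *)
Lemma ip_monomial_lag p n :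
  ip (fun t => t ^+ p) (lag n) =
  lnorm n * (('C(p, n) * n`!)%:R * poch (a + n%:R) (p - n) * (-1) ^+ n).
Proof.
rewrite ipC ip_suml; last first.
- exact: rL2_monomial.
- by move=> l; apply: rL2Z; exact: rL2_monomial.
transitivity (\sum_(l < n.+1) lcoef n l * 1 ^+ l * rGamma ((p + l)%:R + a)).
  apply: eq_bigr => l _; rewrite ipZl; [|exact: rL2_monomial..].
  rewrite expr1n mulr1 -Rint_monomial; congr (_ * _).
  by apply: eq_Rintegral => t _; rewrite exprD [t ^+ l * _]mulrC.
rewrite lag_poch_sum subrr; congr (_ * _).
(* For [j > n] the truncated exponent [n - j] is 0, so [0 ^+ 0 = 1], and it is the falling factorial
   that vanishes. *)
have z (j : nat) : j != n -> ('C(p, j) * n ^_ j)%:R * poch (a + j%:R) (p - j) *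
    (-1) ^+ j * 0 ^+ (n - j) = 0 :> R.
  rewrite neq_ltn => /orP[jn|nj]; first by rewrite expr0n subn_eq0 leqNgt jn mulr0.
  by rewrite (ffact_small nj) muln0 !mul0r.
have [np|pn] := leqP n p.
  rewrite (bigD1 (Ordinal (np : (n < p.+1)%N)))//= big1 ?addr0.
    by rewrite subnn expr0 mulr1 ffactnn.
  by move=> [j /= jp] jn; apply: z; apply: contra jn => /eqP jn; apply/eqP/val_inj.
rewrite bin_small// mul0n !mul0r big1// => -[j /= jp] _; apply: z.
by rewrite neq_ltn (leq_trans _ pn)// ltnS.
Qed.

(** Expand the polynomial of smaller degree [k]: monomials of degree below [n] are orthogonal to
    [lag n], so only a leading term with [k = n] contributes. *)
Lemma ip_lag k n : ip (lag k) (lag n) = if k == n then lnorm n else 0.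
Proof.
wlog kn : k n / (k <= n)%N.
  move=> H; have [/H//|nk] := leqP k n; rewrite ipC H 1?ltnW// eq_sym.
  by case: eqVneq => // ->.
rewrite ip_suml; last first.
- exact: rL2_lag.
- by move=> l; apply: rL2Z; exact: rL2_monomial.
have e l : ip (fun t => lcoef k l * t ^+ l) (lag n) =
    lcoef k l * (lnorm n * (('C(l, n) * n`!)%:R * poch (a + n%:R) (l - n) * (-1) ^+ n)).
  by rewrite ipZl ?ip_monomial_lag//; [exact: rL2_monomial|exact: rL2_lag].
have [kE|nkn] := eqVneq k n; last first.
  apply: big1 => l _; rewrite e bin_small ?mul0n ?mul0r ?mulr0//.
  by rewrite (leq_ltn_trans (_ : l <= k)%N) ?ltn_neqAle ?nkn// -ltnS.
subst k; rewrite big_ord_recr/= big1 ?add0r; last first.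
  by move=> l _; rewrite e bin_small// mul0n !mul0r !mulr0.
rewrite e binn mul1n subnn poch0 mulr1 /lcoef binn mulr1.
have f0 : n`!%:R != 0 :> R by rewrite pnatr_eq0 -lt0n fact_gt0.
have -> : rGamma (n%:R + a) = lnorm n * n`!%:R by rewrite /lnorm divfK.
have s0 : (-1) ^+ n * (-1) ^+ n = 1 :> R by rewrite -exprMn mulrNN mulr1 expr1n.
have := lnorm_gt0 n; move: (lnorm n) => L L0.
transitivity (L * ((-1) ^+ n * (-1) ^+ n)); last by rewrite s0 mulr1.
by field; rewrite f0 gt_eqF.
Qed.

Lemma lcoef_nn_neq0 n : lcoef n n != 0.
Proof.
rewrite /lcoef binn mulr1; apply: mulf_neq0.
  by apply: mulf_neq0; rewrite ?signr_eq0// gt_eqF// lnorm_gt0.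
by rewrite invr_eq0 gt_eqF// rGamma_gt0.
Qed.

(** The integrals carry no weight because [F] will be [f] times the weight. The leading coefficients
    are nonzero, so the moments of [F] vanish by strong induction on the degree. *)
Lemma lag_orthogonal_ae_zero (F : R -> R) (d : R) : 0 < d ->
  ible (fun t => F t * expR (d * t)) ->
  (forall n, \int[mu]_(t in Rpos) (F t * lag n t) = 0) ->
  {ae mu, forall t, Rpos t -> F t = 0}.
Proof.
move=> d0 iF Fl; apply: (moments_determine d0 iF).
have iFk k : ible (fun t => F t * t ^+ k).
  have mF : measurable_fun Rpos F.
    apply: (eq_measurable_fun (fun t => F t * expR (d * t) * expR (- d * t))).
      by move=> t _; rewrite -mulrA -expRD mulNr subrr expR0 mulr1.
    apply: measurable_funM; first exact: integrable_measurable iF.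
    by apply: measurableT_comp => //; exact: measurable_funM.
  apply: (integrable_le measurable_Rpos _ _ (ibleZ (k`!%:R / d ^+ k) (integrable_norm iF))).
    by apply: measurable_funM => //; exact: measurable_funX.
  move=> t; rewrite RposE => t0 /=; have t1 := ltW t0.
  rewrite !normrM (ger0_norm (expR_ge0 _)) (ger0_norm (exprn_ge0 k t1)).
  rewrite [leRHS]mulrCA ler_wpM2l//; exact: expn_le_expR.
elim/ltn_ind => k IHk.
have iz l : ible (fun t => lcoef k l * (F t * t ^+ l)) by exact: ibleZ.
have s (r : seq nat) : ible (fun t => \sum_(l <- r) lcoef k l * (F t * t ^+ l)) /\
   \int[mu]_(t in Rpos) (\sum_(l <- r) lcoef k l * (F t * t ^+ l)) =
   \sum_(l <- r) lcoef k l * (\int[mu]_(t in Rpos) (F t * t ^+ l)).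
  elim: r => [|l r [i1 IHr]].
    rewrite big_nil; split.
      by apply: eq_ible (integrable0 mu Rpos) => t _; rewrite big_nil.
    rewrite (@eq_Rintegral _ _ _ mu _ (cst 0)) ?/Rintegral ?integral0// => t _.
    by rewrite big_nil.
  split; first by apply: eq_ible (ibleD (iz l) i1) => t _; rewrite big_cons.
  rewrite big_cons -IHr -(RintegralZl _ measurable_Rpos (iFk l)).
  rewrite -(RintegralD measurable_Rpos (iz l) i1).
  by apply: eq_Rintegral => t _; rewrite big_cons.
have := Fl k.
have -> : \int[mu]_(t in Rpos) (F t * lag k t) =
    \sum_(l <- iota 0 k.+1) lcoef k l * (\int[mu]_(t in Rpos) (F t * t ^+ l)).
  rewrite -(s (iota 0 k.+1)).2; apply: eq_Rintegral => t _.
  rewrite /lag mulr_sumr -(big_mkord xpredT (fun l => F t * (lcoef k l * t ^+ l))).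
  by rewrite /index_iota subn0; apply: eq_bigr => l _; rewrite mulrCA.
rewrite -[iota 0 k.+1]/(index_iota 0 k.+1) big_nat_recr//= big1_seq ?add0r; last first.
  by move=> l; rewrite mem_index_iota => /andP[_ /andP[_ lk]]; rewrite IHk ?mulr0.
by move/eqP; rewrite mulf_eq0 (negbTE (lcoef_nn_neq0 k)) => /eqP.
Qed.

(** The square of [e^(t/4)] leaves [e^(-t/2)] of the weight. Cauchy-Schwarz then gives the product
    of any [f] in L^2 with the weight an exponential moment of rate 1/4. *)
Lemma rL2_expR4 : rL2 (fun t => expR (4^-1 * t)).
Proof.
split; first by apply: measurableT_comp => //; exact: measurable_funM.
have h2 : 0 < 2^-1 :> R by rewrite invr_gt0.
apply: eq_ible (integrable_powR_expR a0 h2) => t _.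
have -> : expR (- (2^-1 * t)) = expR (4^-1 * t) ^+ 2 * expR (- t).
  by rewrite expr2 -!expRD; congr expR; field.
by rewrite /lweight; ring.
Qed.

Lemma rL2_orthogonal_ae_zero f : rL2 f -> (forall n, ip f (lag n) = 0) ->
  {ae mu, forall t, Rpos t -> f t = 0}.
Proof.
move=> i_f fl; have h4 : 0 < 4^-1 :> R by rewrite invr_gt0.
have : {ae mu, forall t, Rpos t -> f t * w t = 0}.
  apply: (lag_orthogonal_ae_zero h4).
    have [_ i1 _] := rL2_mul i_f rL2_expR4.
    by apply: eq_ible i1 => t _; rewrite mulrAC.
  by move=> n; rewrite -[RHS](fl n); apply: eq_Rintegral => t _; rewrite mulrAC.
apply: filterS; first exact: (ae_filter_ringOfSetsType mu).
move=> t h tp; move/eqP: (h tp); rewrite mulf_eq0 => /orP[/eqP//|].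
by rewrite gt_eqF// lweight_gt0// -RposE.
Qed.

Lemma ae_zero_ip f g : measurable_fun Rpos f -> measurable_fun Rpos g ->
  {ae mu, forall t, Rpos t -> f t = 0} -> ip f g = 0.
Proof.
move=> mf mg f0; rewrite /ip /Rintegral.
rewrite (@ae_eq_integral _ _ _ mu Rpos (cst 0%E)) ?integral0//.
- apply/measurable_EFinP; apply: measurable_funM; last exact: measurable_lweight.
  exact: measurable_funM.
- move: f0; apply: filterS; first exact: (ae_filter_ringOfSetsType mu).
  by move=> t h tp; rewrite h// !mul0r.
Qed.

Definition lsum Phi N t : R := \sum_(n < N) Phi n * lag n t.

Lemma rL2_lsum Phi N : rL2 (lsum Phi N).
Proof. by apply: rL2_sum => n; apply: rL2Z; exact: rL2_lag. Qed.

Lemma ip_lsum_lag Phi N k : ip (lsum Phi N) (lag k) = if (k < N)%N then Phi k * lnorm k else 0.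
Proof.
rewrite ip_suml; last first.
- exact: rL2_lag.
- by move=> n; apply: rL2Z; exact: rL2_lag.
have e (n : nat) : ip (fun t => Phi n * lag n t) (lag k) = if n == k then Phi k * lnorm k else 0.
  rewrite ipZl; [|exact: rL2_lag..]; rewrite ip_lag.
  by case: eqVneq => [->|]; rewrite ?mulr0.
case: ltnP => [kN|Nk].
  rewrite (bigD1 (Ordinal kN))//= e eqxx big1 ?addr0// => n nk; rewrite e.
  by case: eqP => // nk'; move: nk; rewrite -val_eqE/= nk' eqxx.
by apply: big1 => n _; rewrite e ltn_eqF// (leq_trans _ Nk).
Qed.

Lemma ip_lsum f Phi N : rL2 f ->
  ip f (lsum Phi N) = \sum_(n < N) Phi n * ip f (lag n).
Proof.
move=> i_f; rewrite ipC ip_suml//; last by move=> n; apply: rL2Z; exact: rL2_lag.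
by apply: eq_bigr => n _; rewrite ipZl//; [rewrite ipC|exact: rL2_lag].
Qed.

Lemma ip_lsum_sub Phi m n : (m <= n)%N ->
  ip (fun t => lsum Phi n t - lsum Phi m t) (fun t => lsum Phi n t - lsum Phi m t) =
  \sum_(m <= k < n) Phi k ^+ 2 * lnorm k.
Proof.
(* Setting the coefficients below [m] to 0 turns the difference of partial sums into a partial
   sum. *)
move=> mn; pose Psi k := if (m <= k)%N then Phi k else 0.
have e : (fun t => lsum Phi n t - lsum Phi m t) = lsum Psi n.
  apply/funext => t; rewrite /lsum -!(big_mkord xpredT (fun k => _ k * lag k t)).
  rewrite (big_cat_nat (leq0n m) mn)//= addrAC subrr add0r.
  rewrite [RHS](big_cat_nat (leq0n m) mn)//= [X in _ = X + _]big1_seq ?add0r; last first.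
    move=> k; rewrite mem_index_iota => /andP[_ /andP[_ km]].
    by rewrite /Psi leqNgt km mul0r.
  by apply: eq_big_nat => k /andP[mk _]; rewrite /Psi mk.
rewrite e ip_lsum; last exact: rL2_lsum.
transitivity (\sum_(k < n) Psi k ^+ 2 * lnorm k).
  by apply: eq_bigr => k _; rewrite ip_lsum_lag ltn_ord mulrA.
rewrite -(big_mkord xpredT (fun k => Psi k ^+ 2 * lnorm k)).
rewrite (big_cat_nat (leq0n m) mn)//= big1_seq ?add0r; last first.
  move=> k; rewrite mem_index_iota => /andP[_ /andP[_ km]].
  by rewrite /Psi leqNgt km expr0n mul0r.
by apply: eq_big_nat => k /andP[mk _]; rewrite /Psi mk.
Qed.

Lemma ip_subl f g : rL2 f -> rL2 g ->
  ip (fun t => f t - g t) (fun t => f t - g t) = ip f f - 2 * ip f g + ip g g.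
Proof.
move=> i_f ig; have ifg := rL2B i_f ig.
by rewrite ipBl// [ip f _]ipC [ip g _]ipC !ipBl// [ip g f]ipC; ring.
Qed.

Definition coef f n : R := ip f (lag n) / lnorm n.

Lemma bessel_inequality f N : rL2 f ->
  \sum_(n < N) coef f n ^+ 2 * lnorm n <= ip f f.
Proof.
move=> i_f; have i_s := rL2_lsum (coef f) N.
have := ip_ge0 (fun t => f t - lsum (coef f) N t).
rewrite ip_subl// ip_lsum// ip_lsum//.
have e1 : \sum_(n < N) coef f n * ip f (lag n) = \sum_(n < N) coef f n ^+ 2 * lnorm n.
  by apply: eq_bigr => n _; rewrite expr2 -mulrA /coef divfK// gt_eqF ?lnorm_gt0.
have e2 : \sum_(n < N) coef f n * ip (lsum (coef f) N) (lag n) =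
    \sum_(n < N) coef f n ^+ 2 * lnorm n.
  by apply: eq_bigr => n _; rewrite ip_lsum_lag ltn_ord mulrA.
by rewrite e1 e2; lra.
Qed.

Definition rexpansion f Phi :=
  (fun N => ip (fun t => f t - lsum Phi N t) (fun t => f t - lsum Phi N t)) @ \oo --> (0 : R).

(** Multiplication by the square root of the weight carries the partial sums into unweighted L^2,
    where [L2_complete] applies. The limit is divided by it again, the weight being positive on the
    half-line. *)
Lemma riesz_fischer Phi (M : R) : (forall N, \sum_(n < N) Phi n ^+ 2 * lnorm n <= M) ->
  exists f, rL2 f /\ rexpansion f Phi.
Proof.
move=> bM; pose s t := Num.sqrt (w t).
have s2 t : s t ^+ 2 = w t by rewrite sqr_sqrtr// lweight_ge0.
have s0 t : 0 < t -> 0 < s t by move=> t0; rewrite sqrtr_gt0 lweight_gt0.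
have ms : measurable_fun Rpos s.
  apply: continuous_measurable_Rpos => t t0.
  by apply: continuous_comp; [exact: continuous_lweight|exact: sqrt_continuous].
pose u n t := lsum Phi n t * s t.
have mu_ n : measurable_fun Rpos (u n).
  by apply: measurable_funM => //; have [] := rL2_lsum Phi n.
have cS : cvgn (series (fun n => Phi n ^+ 2 * lnorm n)).
  apply: nondecreasing_is_cvgn.
    by apply: nondecreasing_series => n _ _; rewrite mulr_ge0 ?sqr_ge0 ?(ltW (lnorm_gt0 _)).
  by exists M => _ [N _ <-]; rewrite /series/= big_mkord.
have uE m n : (\int[mu]_(t in Rpos) ((u m t - u n t) ^+ 2)%:E =
    (ip (fun t => lsum Phi m t - lsum Phi n t) (fun t => lsum Phi m t - lsum Phi n t))%:E)%E.
  have [_ i1] := rL2B (rL2_lsum Phi m) (rL2_lsum Phi n).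
  rewrite ip_sqr -(EFin_Rintegral measurable_Rpos i1).
  by apply: eq_integral => t _; rewrite /u -mulrBl exprMn s2.
have cu (e : R) : 0 < e -> exists N, forall m n, (N <= m)%N -> (N <= n)%N ->
    (\int[mu]_(t in Rpos) ((u m t - u n t) ^+ 2)%:E <= e%:E)%E.
  move=> e0; have e2 : 0 < e / 2 by rewrite divr_gt0.
  have /cvgrPdist_le/(_ _ e2)[N _ HN] := cS.
  exists N; suff H m n : (N <= m)%N -> (m <= n)%N ->
      ip (fun t => lsum Phi n t - lsum Phi m t) (fun t => lsum Phi n t - lsum Phi m t) <= e.
    move=> m n Nm Nn; rewrite uE lee_fin; have [mn|/ltnW nm] := leqP m n; last exact: H.
    rewrite (le_trans _ (H m n Nm mn))// le_eqVlt; apply/orP; left; apply/eqP.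
    by apply: eq_Rintegral => t _; congr (_ * _); ring.
  move=> Nm mn; rewrite ip_lsum_sub//.
  have -> : \sum_(m <= k < n) Phi k ^+ 2 * lnorm k =
      series (fun n => Phi n ^+ 2 * lnorm n) n - series (fun n => Phi n ^+ 2 * lnorm n) m.
    by rewrite /series/= (big_cat_nat (leq0n m) mn)//= addrAC subrr add0r.
  have := HN n (leq_trans Nm mn); have := HN m Nm.
  move: (series _ n) (series _ m) (limn _) => x y l /=.
  rewrite !ler_norml => /andP[h1 h2] /andP[h3 h4]; lra.
have [v [mv Hv]] := L2_complete measurable_Rpos mu_ cu.
pose f t := v t / s t.
have ms' : measurable_fun Rpos (fun t => (s t)^-1).
  apply: continuous_measurable_Rpos => t t0; apply: cvgV; first by rewrite gt_eqF ?s0.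
  by apply: continuous_comp; [exact: continuous_lweight|exact: sqrt_continuous].
have mf : measurable_fun Rpos f by exact: measurable_funM.
have vE N t : 0 < t -> (v t - u N t) ^+ 2 = (f t - lsum Phi N t) ^+ 2 * w t.
  move=> t0; rewrite -s2 -exprMn /f /u mulrBl divfK// gt_eqF// s0//.
have Hf (e : R) : 0 < e -> exists N, forall n, (N <= n)%N ->
    rL2 (fun t => f t - lsum Phi n t) /\
    ip (fun t => f t - lsum Phi n t) (fun t => f t - lsum Phi n t) <= e.
  move=> e0; have [N HN] := Hv e e0; exists N => n /HN.
  have mfs : measurable_fun Rpos (fun t => f t - lsum Phi n t).
    by apply: measurable_funB => //; have [] := rL2_lsum Phi n.
  have -> : (\int[mu]_(t in Rpos) ((v t - u n t) ^+ 2)%:E =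
             \int[mu]_(t in Rpos) ((f t - lsum Phi n t) ^+ 2 * w t)%:E)%E.
    by apply: eq_integral => t /set_mem; rewrite RposE => /(vE n) ->.
  move=> le_e; have i1 : ible (fun t => (f t - lsum Phi n t) ^+ 2 * w t).
    apply/(integrable_ge0P mu).
    - apply: measurable_funM; last exact: measurable_lweight.
      exact: measurable_funX.
    - by move=> t _; exact: (mulr_ge0 (sqr_ge0 _) (lweight_ge0 _ _)).
    - exact: le_lt_trans le_e (ltry _).
  by split => //; rewrite -lee_fin ip_sqr -(EFin_Rintegral measurable_Rpos i1).
exists f; split.
  have [N /(_ N (leqnn N))[i1 _]] := Hf 1 ltr01.
  have := rL2D i1 (rL2_lsum Phi N).
  by under eq_fun do rewrite subrK.
apply/cvgrPdist_le => e e0; have [N HN] := Hf e e0.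
exists N => // n /= /HN[_ h].
by rewrite sub0r normrN ger0_norm ?ip_ge0.
Qed.

(** The absolute values stay inside the integral because the remainders of the kernel operator are
    bounded by such integrals with [g = 1 + t]. *)
Lemma rexpansion_cvg f Phi g : rL2 f -> rexpansion f Phi -> rL2 g ->
  (fun N => \int[mu]_(t in Rpos) (`|f t - lsum Phi N t| * `|g t| * w t)) @ \oo --> (0 : R).
Proof.
move=> i_f ef ig; apply/cvgrPdist_le => e e0.
have g0 : 0 <= ip g g by exact: ip_ge0.
have d0 : 0 < e ^+ 2 / (1 + ip g g) by rewrite divr_gt0 ?exprn_gt0// ltr_pwDl.
have /cvgrPdist_le/(_ _ d0) := ef; apply: filterS => N.
rewrite !sub0r !normrN !ger0_norm ?ip_ge0//; last first.
  apply: Rintegral_ge0 => t _; apply: mulr_ge0; last exact: lweight_ge0.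
  exact: mulr_ge0.
have [_ _] := rL2_mul (rL2B i_f (rL2_lsum Phi N)) ig.
set I := (X in X ^+ 2 <= _ -> _) => CS h; rewrite -!ip_sqr in CS.
have I0 : 0 <= I.
  apply: Rintegral_ge0 => t _; apply: mulr_ge0; last exact: lweight_ge0.
  exact: mulr_ge0.
have e1 := ltW e0; rewrite -(@ler_pXn2r _ 2)//.
apply: (le_trans CS); apply: (@le_trans _ _ (e ^+ 2 / (1 + ip g g) * ip g g)).
  by rewrite ler_wpM2r.
rewrite mulrAC ler_pdivrMr ?ltr_pwDl// ler_wpM2l ?sqr_ge0//.
by rewrite lerDr.
Qed.

Lemma rexpansion_ip f Phi g : rL2 f -> rexpansion f Phi -> rL2 g ->
  (fun N => ip (lsum Phi N) g) @ \oo --> ip f g.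
Proof.
move=> i_f ef ig; apply/cvgrPdist_le => e e0.
have /cvgrPdist_le/(_ _ e0) := rexpansion_cvg i_f ef ig; apply: filterS => N.
have [i1 i2 _] := rL2_mul (rL2B i_f (rL2_lsum Phi N)) ig.
rewrite sub0r normrN [X in X <= _ -> _]ger0_norm; last first.
  apply: Rintegral_ge0 => t _; apply: mulr_ge0; last exact: lweight_ge0.
  exact: mulr_ge0.
apply: le_trans; rewrite -ipBl//; last exact: rL2_lsum.
apply: (le_trans (le_normr_Rintegral measurable_Rpos i2)).
rewrite le_eqVlt; apply/orP; left; apply/eqP; apply: eq_Rintegral => t _.
by rewrite (normrM _ (w t)) normrM (ger0_norm (lweight_ge0 _ _)).
Qed.

Lemma rexpansion_coef f Phi k : rL2 f -> rexpansion f Phi -> ip f (lag k) = Phi k * lnorm k.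
Proof.
move=> i_f ef; apply: (cvgn_uniq (rexpansion_ip i_f ef (rL2_lag k))).
apply: cvg_near_cst; exists k.+1 => // N /= kN.
by rewrite ip_lsum_lag kN.
Qed.

(** Bessel's inequality lets Riesz-Fischer produce a function [g] with the coefficients of [f]; then
    [f - g] is orthogonal to all [lag n], hence 0 almost everywhere. *)
Lemma rexpansion_exists f : rL2 f -> rexpansion f (coef f).
Proof.
move=> i_f; have [g [ig eg]] := riesz_fischer (fun N => bessel_inequality N i_f).
have ifg := rL2B i_f ig.
have fg0 : {ae mu, forall t, Rpos t -> f t - g t = 0}.
  apply: rL2_orthogonal_ae_zero => // n; rewrite ipBl//; last exact: rL2_lag.
  by rewrite (rexpansion_coef n ig eg) /coef divfK ?subrr// gt_eqF ?lnorm_gt0.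
rewrite /rexpansion (_ : (fun N => _) = (fun N =>
  ip (fun t => g t - lsum (coef f) N t) (fun t => g t - lsum (coef f) N t))) //.
apply/funext => N.
have iz h : rL2 h -> ip (fun t => f t - g t) h = 0.
  by move=> ih; apply: ae_zero_ip => //; [have [] := ifg|have [] := ih].
have i1 := rL2B ig (rL2_lsum (coef f) N).
have e : (fun t => f t - lsum (coef f) N t) =
    (fun t => (g t - lsum (coef f) N t) + (f t - g t)).
  by apply/funext => t; ring.
rewrite e ipDl//; last exact: rL2D.
by rewrite iz ?addr0; [rewrite ipC ipDl// iz// addr0|exact: rL2D].
Qed.

End LaguerreBasis.

(** Regrouping by [p = j + i] relates the exponent [p] in [kernel_entry] to the two indices in
    [matA], where [i] is the hypergeometric one. *)
Lemma sum_triangle {V : nmodType} (f : nat -> nat -> V) l :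
  \sum_(j < l.+1) \sum_(i < (l - j).+1) f j i = \sum_(p < l.+1) \sum_(j < p.+1) f j (p - j)%N.
Proof.
elim: l => [|l IHl]; first by rewrite !big_ord1.
rewrite big_ord_recr/= subnn big_ord1.
under eq_bigr => j _.
  have jl : (j <= l)%N by rewrite -ltnS.
  rewrite subSn// big_ord_recr/=.
  over.
rewrite big_split/= IHl [RHS]big_ord_recr/= -addrA; congr (_ + _).
rewrite [RHS]big_ord_recr/= subnn; congr (_ + _).
by apply: eq_bigr => j _; rewrite subSn// -ltnS.
Qed.

(** Times the factorial of [j], both sides are [p ^_ j * k ^_ j]. The exchange of [p] and [k] is
    what allows summing over [p] first. *)
Lemma bin_ffactC p k j : ('C(p, j) * k ^_ j = 'C(k, j) * p ^_ j)%N.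
Proof.
apply/eqP; rewrite -(@eqn_pmul2r j`!) ?fact_gt0//.
by rewrite mulnAC bin_ffact [X in _ == X]mulnAC bin_ffact mulnC.
Qed.

(** * The entries of A_q as scalar products *)

Section MatrixEntries.
Context {R : realType}.
Local Notation mu := (@lebesgue_measure R).
Local Notation ible f := (mu.-integrable Rpos (EFin \o f)).
Local Notation Re := (@complex.Re R).
Local Notation Im := (@complex.Im R).

Section RealPart.
Variable xi : R.
Hypothesis xi_gt0 : 0 < xi.
Local Notation a := (2 * xi).
Local Notation w := (lweight xi).

Let a0 : 0 < a. Proof. by rewrite mulr_gt0. Qed.
Let an0 n : 0 < n%:R + a. Proof. by rewrite ltr_wpDl. Qed.

Lemma rL2_exp (f : R -> R) : rL2 xi f -> rL2 xi (fun t => expR (- t) * f t).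
Proof.
move=> i_f; apply: (rL2_le i_f).
  apply: measurable_funM; last by have [] := i_f.
  exact: measurableT_comp.
move=> t t0; rewrite normrM ger0_norm ?expR_ge0// ler_piMl//.
by rewrite -[leRHS]expR0 ler_expR oppr_le0 ltW.
Qed.

(** Here [y = 1/2], so that [1 - y = y] and the powers of [y] merge into [2^-1 ^+ n], independent of
    [j]. *)
Lemma ip_exp_monomial_lag p n :
  ip xi (fun t => expR (- t) * t ^+ p) (lag xi n) =
  2 `^ (- (p%:R + a)) * (2^-1 ^+ n * (lnorm xi n *
    \sum_(j < p.+1) ('C(p, j) * n ^_ j)%:R * poch (a + j%:R) (p - j) * (-1) ^+ j)).
Proof.
have i1 := rL2_exp (rL2_monomial xi_gt0 p).
have i2 (l : nat) : rL2 xi (fun t => lcoef xi n l * t ^+ l).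
  by apply: rL2Z; exact: rL2_monomial.
rewrite ipC (ip_suml _ (fun l : 'I_n.+1 => i2 l) i1).
have e (l : nat) : ip xi (fun t => lcoef xi n l * t ^+ l) (fun t => expR (- t) * t ^+ p) =
    2 `^ (- (p%:R + a)) * (lcoef xi n l * 2^-1 ^+ l * rGamma ((p + l)%:R + a)).
  rewrite (ipZl _ (rL2_monomial xi_gt0 l) i1).
  have -> : ip xi (fun t => t ^+ l) (fun t => expR (- t) * t ^+ p) =
      2 `^ (- ((p + l)%:R + a)) * rGamma ((p + l)%:R + a).
    rewrite -Rint_exp_monomial//; apply: eq_Rintegral => t _.
    by rewrite exprD; ring.
  have -> : 2 `^ (- ((p + l)%:R + a)) = 2 `^ (- (p%:R + a)) * 2^-1 ^+ l.
    rewrite exprVn -powR_invn// -powRD; last by apply/implyP => _.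
    by congr (_ `^ _); rewrite natrD; ring.
  by ring.
under eq_bigr do rewrite e.
rewrite -mulr_sumr lag_poch_sum//; congr (_ * _).
rewrite [RHS]mulrCA; congr (_ * _); rewrite mulr_sumr; apply: eq_bigr => j _.
have [jn|nj] := leqP j n; last by rewrite (ffact_small nj) muln0 !mul0r mulr0.
have -> : 1 - 2^-1 = 2^-1 :> R by field.
have e2 : 2^-1 ^+ n = 2^-1 ^+ j * 2^-1 ^+ (n - j) :> R by rewrite -exprD subnKC.
by rewrite e2 -[- 2^-1]mulN1r exprMn; ring.
Qed.

(** After exchanging the sums, the one over [p] is [sum_bin_ffact] at [-1/2]. Its sign cancels the
    remaining [(-1) ^+ j], and the sum over [j] is Chu-Vandermonde for [poch (a + k) n]. *)
Lemma ip_exp_lag k n :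
  ip xi (fun t => expR (- t) * lag xi n t) (lag xi k) =
  rGamma ((k + n)%:R + a) / (k`!%:R * n`!%:R) * 2 `^ (- ((k + n)%:R + a)).
Proof.
have i1 p : rL2 xi (fun t => expR (- t) * t ^+ p) := rL2_exp (rL2_monomial xi_gt0 p).
have ik := rL2_lag xi_gt0 k.
have -> : ip xi (fun t => expR (- t) * lag xi n t) (lag xi k) =
    \sum_(p < n.+1) lcoef xi n p * ip xi (fun t => expR (- t) * t ^+ p) (lag xi k).
  transitivity (ip xi (fun t => \sum_(p < n.+1) lcoef xi n p * (expR (- t) * t ^+ p)) (lag xi k)).
    apply: eq_Rintegral => t _; congr (_ * _ * _).
    by rewrite /lag mulr_sumr; apply: eq_bigr => p _; rewrite mulrCA.
  rewrite ip_suml//; last by move=> p; apply: rL2Z; exact: i1.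
  by apply: eq_bigr => p _; rewrite ipZl.
under eq_bigr do rewrite ip_exp_monomial_lag.
pose c := 2 `^ (- a) * 2^-1 ^+ k * lnorm xi k * lnorm xi n.
have G0 m := rGamma_gt0 (an0 m).
have Gn0 m : rGamma (m%:R + a) != 0 by rewrite gt_eqF.
have pochG j m : (j <= m)%N -> poch (a + j%:R) (m - j) / rGamma (m%:R + a) = (rGamma (j%:R + a))^-1.
  move=> jm; have -> : rGamma (m%:R + a) = poch (a + j%:R) (m - j) * rGamma (j%:R + a).
    by rewrite -{1}(subnK jm) natrD -addrA (rGamma_poch _ (an0 j)) [a + _]addrC.
  rewrite invfM mulrA divff ?mul1r//; apply/prodf_neq0 => i _.
  by rewrite gt_eqF// -addrA ltr_wpDr// addr_ge0.
transitivity (c * \sum_(p < n.+1) \sum_(j < n.+1)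
    ((-1) ^+ j * 'C(k, j)%:R / rGamma (j%:R + a)) * (('C(n, p) * p ^_ j)%:R * (- 2^-1) ^+ p)).
  rewrite mulr_sumr; apply: eq_bigr => -[p /= pn] _.
  have -> : 2 `^ (- (p%:R + a)) = 2 `^ (- a) * 2^-1 ^+ p :> R.
    rewrite exprVn -powR_invn// -powRD; last by apply/implyP => _.
    by congr (_ `^ _); ring.
  rewrite -(big_mkord xpredT (fun j => (-1) ^+ j * 'C(k, j)%:R / rGamma (j%:R + a) *
    (('C(n, p) * p ^_ j)%:R * (- 2^-1) ^+ p))).
  rewrite (big_cat_nat (leq0n p.+1) pn)/= [X in _ = _ * (_ + X)]big1_seq ?addr0; last first.
    move=> j; rewrite mem_index_iota => /andP[_ /andP[pj _]].
    by rewrite (ffact_small pj) muln0 mul0r mulr0.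
  rewrite big_mkord !mulr_sumr; apply: eq_bigr => -[j /= jp] _.
  rewrite -(pochG j p jp) /c /lcoef bin_ffactC !natrM.
  rewrite -[- 2^-1]mulN1r exprMn.
  have := Gn0 p; move: (rGamma _) (poch _ _) (2 `^ _) ((-1) ^+ p) ((-1) ^+ j) => G P X s s' G1.
  by field.
rewrite exchange_big/=.
have h12 : 1 + - 2^-1 = 2^-1 :> R by field.
under eq_bigr => j _.
  rewrite -mulr_sumr sum_bin_ffact h12.
  over.
transitivity (c * (2^-1 ^+ n / rGamma (n%:R + a)) *
    \sum_(j < n.+1) ('C(n, j) * k ^_ j)%:R * poch (a + j%:R) (n - j)).
  rewrite -mulrA; congr (_ * _); rewrite mulr_sumr; apply: eq_bigr => -[j /= jn] _.
  rewrite -(pochG j n jn) bin_ffactC natrM -[- 2^-1]mulN1r exprMn.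
  have s0 : (-1) ^+ j * (-1) ^+ j = 1 :> R by rewrite -exprMn mulrNN mulr1 expr1n.
  have e2 : 2^-1 ^+ n = 2^-1 ^+ j * 2^-1 ^+ (n - j) :> R by rewrite -exprD subnKC.
  rewrite e2; ring: s0.
rewrite -poch_vandermonde /c /lnorm.
have -> : rGamma ((k + n)%:R + a) = poch (a + k%:R) n * rGamma (k%:R + a).
  by rewrite addnC natrD -addrA (rGamma_poch _ (an0 k)) [a + _]addrC.
have -> : 2 `^ (- ((k + n)%:R + a)) = 2 `^ (- a) * 2^-1 ^+ k * 2^-1 ^+ n :> R.
  rewrite -mulrA -exprD exprVn -powR_invn// -powRD; last by apply/implyP => _.
  by congr (_ `^ _); ring.
have f1 : k`!%:R != 0 :> R by rewrite pnatr_eq0 -lt0n fact_gt0.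
have f2 : n`!%:R != 0 :> R by rewrite pnatr_eq0 -lt0n fact_gt0.
have := Gn0 n; move: (rGamma (n%:R + a)) (rGamma (k%:R + a)) (poch _ _) (2 `^ _) => G1 G2 P X G10.
by field; rewrite f1 f2 G10.
Qed.

End RealPart.

Lemma poch_real (x : R) n : (poch x n)%:C = poch x%:C n.
Proof.
by rewrite /poch rmorph_prod; apply: eq_bigr => i _; rewrite rmorphD rmorph_nat.
Qed.

Lemma poch_opp_nat {F : comNzRingType} m i : poch (- m%:R : F) i = (-1) ^+ i * (m ^_ i)%:R.
Proof.
elim: i => [|i IHi]; first by rewrite poch0 expr0 ffactn0 mul1r.
rewrite pochSr IHi; have [im|mi] := leqP i m.
  by rewrite ffactnSr natrM natrB// exprS; ring.
by rewrite !ffact_small ?mulr0 ?mul0r// ltnW.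
Qed.

Section KernelPart.
Variable q : R[i].
Hypothesis q0 : 0 < Re q.
Local Notation xi := (Re q).
Local Notation a := (2 * xi).
Local Notation c := (2 * q).
Local Notation w := (lweight xi).

Let Re_c : Re c = a.
Proof. by rewrite -[2](rmorph_nat (real_complex R)) cReM/= mul0r subr0. Qed.

Let c0 : 0 < Re c. Proof. by rewrite Re_c mulr_gt0. Qed.
Let a0 : 0 < a. Proof. by rewrite mulr_gt0. Qed.
Let an0 n : 0 < n%:R + a. Proof. by rewrite ltr_wpDl. Qed.

Let eps := Gamma c / Gamma c.

(** Idempotence is what makes the two sides agree: the kernel brings one factor [eps], the entries
    of [matA] bring two, one from the explicit Gamma quotient and one from the hypergeometric
    function. *)
Let eps_idem : eps * eps = eps.
Proof.
rewrite /eps; have [->|G0] := eqVneq (Gamma c) 0; first by rewrite !mul0r.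
by rewrite divff// mulr1.
Qed.

Let Z (l p : nat) : R[i] := eps * 'C(l, p)%:R * poch (c + p%:R) (l - p) * (-1) ^+ p.
Let E (p k : nat) : R := ip xi (fun t => expR (- t) * t ^+ p) (lag xi k).

(** The scalar product of N_q(t^l) with [lag xi k], by [kernel_monomial_lag]. *)
Definition kernel_entry (k l : nat) : R[i] := \sum_(p < l.+1) Z l p * (E p k)%:C.

Let kernel_monomialE l t : kernel_monomial q l t =
  \sum_(p < l.+1) Z l p * (expR (- t) * t ^+ p)%:C.
Proof.
rewrite /kernel_monomial -/eps mulr_sumr; apply: eq_bigr => p _.
by rewrite /Z rmorphM rmorphXn rmorphN/= [(- _%:C) ^+ _]exprNn; ring.
Qed.

Lemma measurable_kernel_monomial l :
  measurable_fun Rpos (fun t => Re (kernel_monomial q l t)) /\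
  measurable_fun Rpos (fun t => Im (kernel_monomial q l t)).
Proof.
have m1 (z : R) (p : nat) : measurable_fun Rpos (fun t => z * (expR (- t) * t ^+ p)).
  apply: measurable_funM => //; have [] := rL2_exp (rL2_monomial q0 p) => //.
split.
  have -> : (fun t => Re (kernel_monomial q l t)) =
      (fun t => \sum_(p < l.+1) Re (Z l p) * (expR (- t) * t ^+ p)).
    apply/funext => t; rewrite kernel_monomialE cRe_sum; apply: eq_bigr => p _.
    by rewrite cReM/= mulr0 subr0.
  by apply: measurable_sum => p; exact: m1.
have -> : (fun t => Im (kernel_monomial q l t)) =
    (fun t => \sum_(p < l.+1) Im (Z l p) * (expR (- t) * t ^+ p)).
  apply/funext => t; rewrite kernel_monomialE cIm_sum; apply: eq_bigr => p _.
  by rewrite cImM/= mulr0 add0r.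
by apply: measurable_sum => p; exact: m1.
Qed.

Lemma kernel_monomial_lag k l :
  cintegrable (fun t => kernel_monomial q l t * (lag xi k t * w t)%:C) /\
  cint (fun t => kernel_monomial q l t * (lag xi k t * w t)%:C) = kernel_entry k l.
Proof.
have i1 (p : nat) : ible (fun t => expR (- t) * t ^+ p * lag xi k t * w t).
  by have [_ + _] := rL2_mul (rL2_exp (rL2_monomial q0 p)) (rL2_lag q0 k).
have e t : kernel_monomial q l t * (lag xi k t * w t)%:C =
    \sum_(p < l.+1) Z l p * (expR (- t) * t ^+ p * lag xi k t * w t)%:C.
  rewrite kernel_monomialE mulr_suml; apply: eq_bigr => p _.
  by rewrite -!mulrA -rmorphM/= -!mulrA.
have i2 (p : 'I_l.+1) : cintegrable (fun t => Z l p * (expR (- t) * t ^+ p * lag xi k t * w t)%:C).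
  by apply: cintegrableZ; apply: cintegrable_real.
split; first by apply: eq_cintegrable (cintegrable_sum (index_enum _) i2) => t _; rewrite e.
transitivity (cint (fun t => \sum_(p < l.+1) Z l p * (expR (- t) * t ^+ p * lag xi k t * w t)%:C)).
  by apply: eq_cint => t _; rewrite e.
rewrite cint_sum//; apply: eq_bigr => p _.
by rewrite cintZ ?cint_real//; exact: cintegrable_real.
Qed.

Let rG n : Gamma (n%:R + 2 * xi%:C) = (rGamma (n%:R + a))%:C.
Proof. by rewrite -Gamma_real rmorphD rmorphM !rmorph_nat. Qed.

Let rG0 n : (rGamma (n%:R + a))%:C != 0 :> R[i].
Proof. by rewrite fmorph_eq0 gt_eqF// rGamma_gt0. Qed.

(** The first parameter is the nonpositive integer [-(l - j)], so the series terminates; [eps] is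
    what is left of the Gamma quotient with complex arguments. *)
Let hyperE l j : (j <= l)%N ->
  hypergeom21 (- l%:R + j%:R) (2 * xi%:C + j%:R) (2 * q + j%:R) (2^-1) =
  \sum_(i < (l - j).+1) (-1) ^+ i * ((l - j) ^_ i)%:R *
    (poch (2 * xi%:C + j%:R) i * eps / poch (c + j%:R) i) * (2^-1 ^+ i / i`!%:R).
Proof.
move=> jl; have eA : - l%:R + j%:R = - (l - j)%:R :> R[i] by rewrite natrB//; ring.
rewrite /hypergeom21 (@csum_finite _ _ (l - j).+1) => [|i li]; last first.
  by rewrite -/(poch _ i) eA poch_opp_nat ffact_small// mulr0 !mul0r.
apply: eq_bigr => i _; rewrite -/(poch _ i) eA poch_opp_nat; congr (_ * _ * _).
have Rj : 0 < Re (c + j%:R) by rewrite addrC Re_natD ltr_wpDl.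
have Raj : 0 < Re (2 * xi%:C + j%:R).
  by rewrite addrC -[2](rmorph_nat (real_complex R)) Re_natD ltr_wpDl// cReM/= mulr0 subr0.
rewrite [_ + i%:R]addrC Gamma_poch// [c + j%:R + i%:R]addrC Gamma_poch//.
have -> : Gamma (2 * xi%:C + j%:R) = (rGamma (j%:R + a))%:C by rewrite addrC rG.
have -> : Gamma (c + j%:R) = poch c j * Gamma c by rewrite addrC Gamma_poch.
have pn0 : poch c j != 0 by exact: poch_neq0.
rewrite /eps !invfM; have := rG0 j.
move: (rGamma _)%:C (poch _ _)^-1 (poch (2 * xi%:C + j%:R) i) (Gamma c) (Gamma c)^-1.
move=> G P' P H H' G0; field.
by rewrite G0 pn0.
Qed.

(** The summand common to [kernel_entry] and [matA]: [j] is the index of the sum in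
    [ip_exp_monomial_lag], and [i] becomes the hypergeometric index, with [j + i = p] the exponent
    of the monomial. *)
Let kernel_term (l k j i : nat) : R[i] :=
  eps * poch (c + (j + i)%:R) (l - (j + i)) * ('C(l, j + i) * 'C(j + i, j))%:R / l`!%:R *
  (k ^_ j)%:R / k`!%:R * poch (2 * xi%:C + j%:R) i * (-1) ^+ i * 2^-1 ^+ (j + i).

Let kernel_entry_term k l :
  kernel_entry k l = (2 `^ (- (k%:R + a)) * rGamma (k%:R + a))%:C * l`!%:R *
    \sum_(p < l.+1) \sum_(j < p.+1) kernel_term l k j (p - j).
Proof.
rewrite mulr_sumr; apply: eq_bigr => -[p /= pl] _.
rewrite /E ip_exp_monomial_lag//.
have -> : 2 `^ (- (p%:R + a)) = 2 `^ (- (k%:R + a)) * 2 ^+ k * 2^-1 ^+ p.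
  rewrite exprVn -powR_invn// -powR_mulrn// -!powRD; last 2 first.
  - by apply/implyP => _.
  - by apply/implyP => _.
  by congr (_ `^ _); ring.
rewrite !mulr_sumr rmorph_sum mulr_sumr; apply: eq_bigr => -[j /= jp] _.
rewrite /kernel_term subnKC//.
have -> : (2 `^ (- (k%:R + a)) * 2 ^+ k * 2^-1 ^+ p * (2^-1 ^+ k * (lnorm xi k *
    (('C(p, j) * k ^_ j)%:R * poch (a + j%:R) (p - j) * (-1) ^+ j))))%:C =
  (2 `^ (- (k%:R + a)))%:C * 2 ^+ k * 2^-1 ^+ p * (2^-1 ^+ k * ((rGamma (k%:R + a))%:C / k`!%:R *
    ('C(p, j)%:R * (k ^_ j)%:R * poch (2 * xi%:C + j%:R) (p - j) * (-1) ^+ j))) :> R[i].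
  have -> : 2 * xi%:C + j%:R = (a + j%:R)%:C :> R[i] by rewrite rmorphD rmorphM !rmorph_nat.
  rewrite -poch_real /lnorm natrM.
  by rewrite !(rmorphM, rmorphXn, fmorphV, rmorph_nat, rmorphN, rmorph1).
have e2 : 2 ^+ k * 2^-1 ^+ k = 1 :> R[i].
  by rewrite -exprMn divff ?expr1n// pnatr_eq0.
have s2 : (-1) ^+ p = (-1) ^+ j * (-1) ^+ (p - j) :> R[i] by rewrite -exprD subnKC.
have s3 : (-1) ^+ j * (-1) ^+ j = 1 :> R[i] by rewrite -exprMn mulrNN mulr1 expr1n.
rewrite /Z s2 [(_ * rGamma _)%:C]rmorphM/= natrM.
have e1 : l`!%:R / l`!%:R = 1 :> R[i] by rewrite divff// pnatr_eq0 -lt0n fact_gt0.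
move: (2 ^+ k : R[i]) (2^-1 ^+ k : R[i]) e2 => A B e2.
move: ((-1) ^+ j : R[i]) s3 (l`!%:R : R[i]) (l`!%:R^-1 : R[i]) e1 => S s3 L L' e1.
move: (2^-1 ^+ p : R[i]) (k`!%:R^-1 : R[i]) => C K.
by ring: e1 e2 s3.
Qed.

(** [Gamma (l + c)] contains [poch c l], which splits at [j] and [j + i]: the first two blocks
    cancel denominators on the right, the third is the one in [kernel_term]. *)
Let kernel_term_match l k j i : (j <= l)%N -> (j <= k)%N -> (i <= l - j)%N ->
  kernel_term l k j i =
  Gamma (l%:R + c) * (2 ^- j /
    (j`!%:R * (l - j)`!%:R * (k - j)`!%:R * Gamma (j%:R + c))) *
  ((-1) ^+ i * ((l - j) ^_ i)%:R * (poch (2 * xi%:C + j%:R) i * eps / poch (c + j%:R) i) *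
     (2^-1 ^+ i / i`!%:R)).
Proof.
move=> jl jk ilj; have jil : (j + i <= l)%N by lia.
have nf m : m`!%:R != 0 :> R[i] by rewrite pnatr_eq0 -lt0n fact_gt0.
have b1 : ('C(l, j + i) * 'C(j + i, j))%:R / l`!%:R =
    ((l - j) ^_ i)%:R / (j`!%:R * i`!%:R * (l - j)`!%:R) :> R[i].
  apply/eqP; rewrite eqr_div ?mulf_neq0//; apply/eqP; rewrite -!natrM; congr (_%:R).
  have h1 := bin_fact jil; have h2 := bin_fact (leq_addr i j); have h3 := ffact_fact ilj.
  rewrite addKn in h2; rewrite -h1 -h2 -h3.
  have -> : (l - (j + i) = l - j - i)%N by lia.
  by ring.
have b2 : (k ^_ j)%:R / k`!%:R = ((k - j)`!%:R)^-1 :> R[i].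
  by rewrite -(ffact_fact jk) natrM invfM mulrA divff ?mul1r// pnatr_eq0 -lt0n ffact_gt0.
have pE : poch c l = poch c j * poch (c + j%:R) i * poch (c + (j + i)%:R) (l - (j + i)).
  by rewrite natrD addrA -mulrA -pochD -pochD; congr poch; lia.
have pj0 : poch c j != 0 by exact: poch_neq0.
have pi0 : poch (c + j%:R) i != 0.
  by apply: poch_neq0; rewrite addrC Re_natD ltr_wpDl.
transitivity (eps * poch (c + (j + i)%:R) (l - (j + i)) *
    (('C(l, j + i) * 'C(j + i, j))%:R / l`!%:R) * ((k ^_ j)%:R / k`!%:R) *
    poch (2 * xi%:C + j%:R) i * (-1) ^+ i * (2^-1 ^+ j * 2^-1 ^+ i)).
  by rewrite /kernel_term exprD; ring.
rewrite b1 b2 !Gamma_poch// pE /eps !invfM -[2 ^- j]exprVn.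
have := eps_idem; rewrite /eps.
have e1 : poch c j / poch c j = 1 by rewrite divff.
have e2 : poch (c + j%:R) i / poch (c + j%:R) i = 1 by rewrite divff.
move: (poch c j) (poch c j)^-1 e1 (poch (c + j%:R) i) (poch (c + j%:R) i)^-1 e2.
move=> p p' e1 r r' e2.
move: (Gamma c) (Gamma c)^-1 (poch (c + (j + i)%:R) _) (poch (2 * xi%:C + j%:R) i).
move: (j`!%:R^-1) (i`!%:R^-1) ((l - j)`!%:R^-1) ((k - j)`!%:R^-1) (2^-1 ^+ i) (2^-1 ^+ j).
move=> f1 f2 f3 f4 t1 t2 G G' P Q e3.
by ring: e1 e2 e3.
Qed.

(** Hence the entry is the scalar product of [(M +- N_q) L_n] with [L_k], the part from N_q being
    taken monomial by monomial. *)
Lemma matAE sgn k n :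
  matA sgn q k n = (ip xi (fun t => expR (- t) * lag xi n t) (lag xi k))%:C +
    (-1) ^+ sgn * \sum_(l < n.+1) (lcoef xi n l)%:C * kernel_entry k l.
Proof.
rewrite /matA ip_exp_lag//; congr (_ + _ * _).
  by rewrite rG rmorphM fmorph_div rmorphM !rmorph_nat.
rewrite !rG mulr_sumr; apply: eq_bigr => -[l /= ln] _.
rewrite kernel_entry_term -sum_triangle.
(* The terms with [k < j <= l] vanish through the falling factorial [k ^_ j], which explains the
   minimum in [matA]. *)
have -> : \sum_(j < l.+1) \sum_(i < (l - j).+1) kernel_term l k j i =
    \sum_(j < (minn l k).+1) \sum_(i < (l - j).+1) kernel_term l k j i.
  have lk : ((minn l k).+1 <= l.+1)%N by rewrite ltnS geq_minl.
  rewrite -!(big_mkord xpredT (fun j => \sum_(i < (l - j).+1) kernel_term l k j i)).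
  rewrite (big_cat_nat (leq0n _) lk)/= [X in _ + X]big1_seq ?addr0// => j.
  rewrite mem_index_iota => /andP[_ /andP[h1 h2]].
  apply: big1 => i _; rewrite /kernel_term (@ffact_small k j); last by lia.
  by rewrite mulr0 !mul0r.
have -> : \sum_(j < (minn l k).+1) \sum_(i < (l - j).+1) kernel_term l k j i =
    Gamma (l%:R + c) * \sum_(j < (minn l k).+1)
         2 ^- j / (j`!%:R * (l - j)`!%:R * (k - j)`!%:R * Gamma (j%:R + 2 * q)) *
         hypergeom21 (- l%:R + j%:R) (2 * xi%:C + j%:R) (2 * q + j%:R) (2^-1).
  rewrite mulr_sumr; apply: eq_bigr => -[j /= jlk] _.
  have jl : (j <= l)%N by lia.
  have jk : (j <= k)%N by lia.
  rewrite hyperE// mulrA mulr_sumr; apply: eq_bigr => -[i /= il] _.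
  by rewrite kernel_term_match.
set S := \sum_(j < _) _.
rewrite powRN /lcoef /lnorm !rmorphM !fmorphV/= rmorphXn rmorphN rmorph1 !rmorph_nat.
have bE : 'C(n, l)%:R / n`!%:R = ((n - l)`!%:R)^-1 * (l`!%:R)^-1 :> R[i].
  have C0 : 'C(n, l)%:R != 0 :> R[i] by rewrite pnatr_eq0 -lt0n bin_gt0.
  have L0 : l`!%:R != 0 :> R[i] by rewrite pnatr_eq0 -lt0n fact_gt0.
  have N0 : (n - l)`!%:R != 0 :> R[i] by rewrite pnatr_eq0 -lt0n fact_gt0.
  by rewrite -(bin_fact (ln : (l <= n)%N)) !natrM; field; rewrite C0 L0 N0.
have e1 : l`!%:R / l`!%:R = 1 :> R[i] by rewrite divff// pnatr_eq0 -lt0n fact_gt0.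
rewrite !invfM rG.
move: ('C(n, l)%:R : R[i]) (n`!%:R^-1 : R[i]) bE => C N bE.
move: (l`!%:R : R[i]) (l`!%:R^-1 : R[i]) bE e1 => L L' bE e1.
by ring: bE e1.
Qed.

End KernelPart.
End MatrixEntries.

(** * The operator N_q on L^2(m_xi) along Laguerre expansions *)

Section Operators.
Context {R : realType}.
Local Notation mu := (@lebesgue_measure R).
Local Notation ible f := (mu.-integrable Rpos (EFin \o f)).
Local Notation Re := (@complex.Re R).
Local Notation Im := (@complex.Im R).
Implicit Types (phi psi : R -> R[i]) (Phi : nat -> R[i]) (t s : R).

Lemma cseries_cvgD (u v : nat -> R[i]) x y : cseries_cvg u x -> cseries_cvg v y ->
  cseries_cvg (fun n => u n + v n) (x + y).
Proof.
move=> cu cv; rewrite /cseries_cvg.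
have -> : series ((fun n => u n + v n) : nat -> R[i]^o) =
    (fun n => series (u : nat -> R[i]^o) n + series (v : nat -> R[i]^o) n).
  by apply/funext => n; rewrite /series/= big_split.
exact: (cvgD cu cv).
Qed.

Lemma cseries_cvgZ z (u : nat -> R[i]) x : cseries_cvg u x ->
  cseries_cvg (fun n => z * u n) (z * x).
Proof.
move=> cu; rewrite /cseries_cvg.
have -> : series ((fun n => z * u n) : nat -> R[i]^o) =
    (fun n => z * series (u : nat -> R[i]^o) n).
  by apply/funext => n; rewrite /series/= mulr_sumr.
exact: (cvgMl_tmp cu).
Qed.

Lemma cseries_cvg_finite (u : nat -> R[i]) n : (forall i, (n <= i)%N -> u i = 0) ->
  cseries_cvg u (\sum_(i < n) u i).
Proof.
move=> u0; apply: cvg_near_cst; exists n => // k /= nk.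
rewrite /series/= (big_cat_nat (leq0n n) nk)//= [X in _ + X]big1_seq ?addr0 ?big_mkord//.
by move=> i; rewrite mem_index_iota => /andP[_ /andP[/u0]].
Qed.

Lemma Re_normc_sqr (z : R[i]) : Re `|z| ^+ 2 = Re z ^+ 2 + Im z ^+ 2.
Proof. by rewrite normc_def/= sqr_sqrtr// addr_ge0 ?sqr_ge0. Qed.

Variable q : R[i].
Hypothesis q0 : 0 < Re q.
Local Notation xi := (Re q).
Local Notation c := (2 * q).
Local Notation w := (lweight xi).

Definition cL2 phi := rL2 xi (fun t => Re (phi t)) /\ rL2 xi (fun t => Im (phi t)).

Lemma L2norm2E phi : cL2 phi -> L2norm2 xi phi =
  (ip xi (fun t => Re (phi t)) (fun t => Re (phi t)) +
   ip xi (fun t => Im (phi t)) (fun t => Im (phi t)))%:E.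
Proof.
move=> [[mr ir] [mi ii]]; rewrite !ip_sqr -(RintegralD measurable_Rpos ir ii).
rewrite -(EFin_Rintegral measurable_Rpos (ibleD ir ii)) /L2norm2.
by apply: eq_integral => t _; rewrite Re_normc_sqr -mulrDl.
Qed.

Lemma inL2P phi : inL2 xi phi <-> cL2 phi.
Proof.
split=> [[mr mi nf]|[ir ii]]; last first.
  by split; [have [] := ir|have [] := ii|rewrite L2norm2E ?ltry].
pose g t := Re `|phi t| ^+ 2 * w t.
have gE t : g t = (Re (phi t) ^+ 2 + Im (phi t) ^+ 2) * w t by rewrite /g Re_normc_sqr.
have w0 t : 0 <= w t by exact: lweight_ge0.
have mg : measurable_fun Rpos g.
  apply: (eq_measurable_fun (fun t => (Re (phi t) ^+ 2 + Im (phi t) ^+ 2) * w t)).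
    by move=> t _; rewrite gE.
  apply: measurable_funM; last exact: measurable_lweight.
  by apply: measurable_funD; exact: measurable_funX.
have ig : ible g.
  apply/(integrable_ge0P mu mg) => // t _.
  by rewrite gE; apply: mulr_ge0 (w0 t); rewrite addr_ge0 ?sqr_ge0.
split; split=> //; apply: (integrable_le measurable_Rpos _ _ ig).
- by apply: measurable_funM; [exact: measurable_funX|exact: measurable_lweight].
- move=> t _; rewrite (ger0_norm (mulr_ge0 (sqr_ge0 _) (w0 t))) gE.
  by apply: (ler_wpM2r (w0 t)); rewrite lerDl sqr_ge0.
- by apply: measurable_funM; [exact: measurable_funX|exact: measurable_lweight].
- move=> t _; rewrite (ger0_norm (mulr_ge0 (sqr_ge0 _) (w0 t))) gE.
  by apply: (ler_wpM2r (w0 t)); rewrite lerDr sqr_ge0.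
Qed.

Definition lsumc Phi N t : R[i] := \sum_(n < N) Phi n * Laguerre xi n t.

Lemma Re_lsumc Phi N t : Re (lsumc Phi N t) = lsum xi (fun n => Re (Phi n)) N t.
Proof.
rewrite /lsumc cRe_sum; apply: eq_bigr => n _.
by rewrite LaguerreE// cReM/= mulr0 subr0.
Qed.

Lemma Im_lsumc Phi N t : Im (lsumc Phi N t) = lsum xi (fun n => Im (Phi n)) N t.
Proof.
rewrite /lsumc cIm_sum; apply: eq_bigr => n _.
by rewrite LaguerreE// cImM/= mulr0 add0r.
Qed.

Lemma cL2B phi psi : cL2 phi -> cL2 psi -> cL2 (fun t => phi t - psi t).
Proof.
move=> [p1 p2] [s1 s2]; split.
  have -> : (fun t => Re (phi t - psi t)) = (fun t => Re (phi t) - Re (psi t)).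
    by apply/funext => t; rewrite cReD cReN.
  exact: rL2B.
have -> : (fun t => Im (phi t - psi t)) = (fun t => Im (phi t) - Im (psi t)).
  by apply/funext => t; rewrite cImD cImN.
exact: rL2B.
Qed.

Lemma cL2_lsumc Phi N : cL2 (lsumc Phi N).
Proof.
split.
  by under eq_fun do rewrite Re_lsumc; exact: rL2_lsum.
by under eq_fun do rewrite Im_lsumc; exact: rL2_lsum.
Qed.

Definition cexpansion phi Phi :=
  rexpansion xi (fun t => Re (phi t)) (fun n => Re (Phi n)) /\
  rexpansion xi (fun t => Im (phi t)) (fun n => Im (Phi n)).

Lemma cexpansion_Laguerre phi Phi : cL2 phi -> cexpansion phi Phi ->
  Laguerre_expansion xi phi Phi.
Proof.
move=> ip2 [er ei]; rewrite /Laguerre_expansion.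
have e N : L2norm2 xi (fun t => phi t - \sum_(n < N) Phi n * Laguerre xi n t) =
    (ip xi (fun t => Re (phi t) - lsum xi (fun n => Re (Phi n)) N t)
           (fun t => Re (phi t) - lsum xi (fun n => Re (Phi n)) N t) +
     ip xi (fun t => Im (phi t) - lsum xi (fun n => Im (Phi n)) N t)
           (fun t => Im (phi t) - lsum xi (fun n => Im (Phi n)) N t))%:E.
  rewrite -[X in L2norm2 _ X]/(fun t => phi t - lsumc Phi N t) L2norm2E; last first.
    exact: cL2B (cL2_lsumc _ _).
  by congr (_ + _)%:E; apply: eq_Rintegral => t _;
    rewrite ?cReD ?cReN ?Re_lsumc ?cImD ?cImN ?Im_lsumc.
under eq_fun do rewrite e.
apply: cvg_EFin; first exact: nearW.
have := cvgD er ei; rewrite addr0; exact.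
Qed.

(** The square integrable function that bounds the kernel in each of its variables. *)
Definition lin t : R := 1 + t.

Lemma rL2_lin : rL2 xi lin.
Proof.
apply: rL2D => //; last exact: (rL2_monomial q0 1).
by have := rL2_monomial q0 0; under eq_fun do rewrite expr0.
Qed.

(** A weighted L^1 norm, finite on L^2(m_xi) by Cauchy-Schwarz with [lin], and the quantity through
    which N_q depends continuously on its argument. *)
Definition mass phi : R :=
  \int[mu]_(t in Rpos) (`|Re (phi t)| * `|lin t| * w t) +
  \int[mu]_(t in Rpos) (`|Im (phi t)| * `|lin t| * w t).

Lemma mass_cvg phi Phi : cL2 phi -> cexpansion phi Phi ->
  (fun N => mass (fun t => phi t - lsumc Phi N t)) @ \oo --> (0 : R).
Proof.
move=> [p1 p2] [er ei].
have e : (fun N => mass (fun t => phi t - lsumc Phi N t)) = (fun N =>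
    \int[mu]_(t in Rpos) (`|Re (phi t) - lsum xi (fun n => Re (Phi n)) N t| * `|lin t| * w t) +
    \int[mu]_(t in Rpos) (`|Im (phi t) - lsum xi (fun n => Im (Phi n)) N t| * `|lin t| * w t)).
  apply/funext => N; rewrite /mass; congr (_ + _); apply: eq_Rintegral => t _.
    by rewrite cReD cReN Re_lsumc.
  by rewrite cImD cImN Im_lsumc.
rewrite e -[0]addr0; apply: cvgD.
  exact: (rexpansion_cvg q0 p1 er rL2_lin).
exact: (rexpansion_cvg q0 p2 ei rL2_lin).
Qed.

Lemma opNE psi t : 0 < t ->
  opN q psi t = cint (fun s => bessel_kernel c (s * t) * (psi s * mdens q s)).
Proof.
move=> t0; apply: eq_cint => s s0.
by rewrite BesselJE// mulrA.
Qed.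

(** The kernel is at most [B (1 + st) <= B (1 + s) (1 + t)]; the factor [1 + s] goes into [mass],
    and the 2 accounts for the complex density. *)
Lemma opN_bound : exists2 B, 0 <= B & forall psi t, cL2 psi -> 0 < t ->
  cintegrable (fun s => bessel_kernel c (s * t) * (psi s * mdens q s)) /\
  norm1c (opN q psi t) <= B * (1 + t) * mass psi.
Proof.
have c0 : 0 < Re c by rewrite -[2](rmorph_nat (real_complex R)) cReM/= mul0r subr0 mulr_gt0.
have [B B0 HB] := bessel_kernel_growth c0.
exists (B * 2); first by rewrite mulr_ge0.
move=> psi t [p1 p2] t0; pose g s := B * 2 * (1 + t) *
  (`|Re (psi s)| * `|lin s| * w s + `|Im (psi s)| * `|lin s| * w s).
have [i1 _ _] := rL2_mul p1 rL2_lin; have [i2 _ _] := rL2_mul p2 rL2_lin.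
have ig : ible g by apply: ibleZ; exact: ibleD.
have le_g s : 0 < s -> norm1c (bessel_kernel c (s * t) * (psi s * mdens q s)) <= g s.
  move=> s0; have st : 0 <= s * t by rewrite mulr_ge0 ?ltW.
  apply: (le_trans (norm1cM _ _)).
  have h1 := HB _ st.
  have h2 : norm1c (psi s * mdens q s) <= norm1c (psi s) * (2 * w s).
    apply: (le_trans (norm1cM _ _)); rewrite ler_wpM2l ?norm1c_ge0//.
    exact: norm1c_mdens.
  apply: (le_trans (ler_pM (norm1c_ge0 _) (norm1c_ge0 _) h1 h2)).
  rewrite /g (ger0_norm (_ : 0 <= lin s)); last by rewrite /lin addr_ge0// ltW.
  have -> : B * 2 * (1 + t) * (`|Re (psi s)| * lin s * w s + `|Im (psi s)| * lin s * w s) =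
      B * ((1 + t) * (1 + s)) * (norm1c (psi s) * (2 * w s)).
    by rewrite /norm1c /lin; move: (w s) => W; ring.
  apply: ler_wpM2r.
    by apply: mulr_ge0; [exact: norm1c_ge0|apply: mulr_ge0 => //; exact: lweight_ge0].
  apply: ler_wpM2l => //.
  by have := ltW s0; have := ltW t0; nra.
have mK1 : measurable_fun Rpos (fun s => Re (bessel_kernel c (s * t))).
  apply: (measurableT_comp (continuous_measurable_fun (continuous_bessel_kernel_Re c0))).
  exact: measurable_funM.
have mK2 : measurable_fun Rpos (fun s => Im (bessel_kernel c (s * t))).
  apply: (measurableT_comp (continuous_measurable_fun (continuous_bessel_kernel_Im c0))).
  exact: measurable_funM.
have m1 : measurable_fun Rpos (fun s => Re (psi s * mdens q s)).
  under eq_fun do rewrite cReM.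
  apply: measurable_funB; apply: measurable_funM; [by have [] := p1| |by have [] := p2|].
    exact: measurable_Re_mdens.
  exact: measurable_Im_mdens.
have m2 : measurable_fun Rpos (fun s => Im (psi s * mdens q s)).
  under eq_fun do rewrite cImM.
  apply: measurable_funD; apply: measurable_funM; [by have [] := p1| |by have [] := p2|].
    exact: measurable_Im_mdens.
  exact: measurable_Re_mdens.
have ci : cintegrable (fun s => bessel_kernel c (s * t) * (psi s * mdens q s)).
  apply: (cintegrable_le _ _ le_g ig).
    under eq_fun do rewrite cReM.
    by apply: measurable_funB; apply: measurable_funM.
  under eq_fun do rewrite cImM.
  by apply: measurable_funD; apply: measurable_funM.
split => //; rewrite opNE//; apply: (le_trans (norm1c_cint_le ci ig le_g)).
rewrite (RintegralZl _ measurable_Rpos (ibleD i1 i2)).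
by rewrite (RintegralD measurable_Rpos i1 i2).
Qed.

Lemma opNB phi psi t : cL2 phi -> cL2 psi -> 0 < t ->
  opN q (fun t => phi t - psi t) t = opN q phi t - opN q psi t.
Proof.
move=> h1 h2 t0; have [B _ HB] := opN_bound.
have [i1 _] := HB phi t h1 t0; have [i2 _] := HB psi t h2 t0.
rewrite !opNE// -mulN1r -cintZ// -cintD//; last exact: cintegrableZ.
by apply: eq_cint => s _; ring.
Qed.

Definition opN_lag n t : R[i] := \sum_(l < n.+1) (lcoef xi n l)%:C * kernel_monomial q l t.

Lemma opN_lsumc Phi N t : 0 < t -> opN q (lsumc Phi N) t = \sum_(n < N) Phi n * opN_lag n t.
Proof.
move=> t0; rewrite opNE//.
have im l := (bessel_kernel_monomial q0 l t0).1.
have il (n : nat) : cintegrable (fun s => \sum_(l < n.+1) (lcoef xi n l)%:C *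
    (bessel_kernel c (s * t) * (s%:C ^+ l * mdens q s))).
  by apply: cintegrable_sum => l; apply: cintegrableZ; exact: im.
transitivity (cint (fun s => \sum_(n < N) Phi n * \sum_(l < n.+1) (lcoef xi n l)%:C *
    (bessel_kernel c (s * t) * (s%:C ^+ l * mdens q s)))).
  apply: eq_cint => s s0; rewrite /lsumc mulr_suml mulr_sumr; apply: eq_bigr => n _.
  rewrite LaguerreE// /lag rmorph_sum -mulrA [LHS]mulrCA; congr (_ * _).
  rewrite mulr_suml mulr_sumr; apply: eq_bigr => l _.
  by rewrite rmorphM rmorphXn/=; ring.
rewrite cint_sum; last by move=> n; apply: cintegrableZ; exact: il.
apply: eq_bigr => n _; rewrite cintZ//; congr (_ * _).
rewrite cint_sum; last by move=> l; apply: cintegrableZ; exact: im.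
by apply: eq_bigr => l _; rewrite cintZ// (bessel_kernel_monomial q0 l t0).2.
Qed.

Lemma measurable_opN_lag n : measurable_fun Rpos (fun t => Re (opN_lag n t)) /\
  measurable_fun Rpos (fun t => Im (opN_lag n t)).
Proof.
split.
  apply: (eq_measurable_fun (fun t => \sum_(l < n.+1) lcoef xi n l * Re (kernel_monomial q l t))).
    by move=> t _; rewrite cRe_sum; apply: eq_bigr => l _; rewrite cReM/= mul0r subr0.
  apply: measurable_sum => l; apply: measurable_funM => //.
  by have [] := measurable_kernel_monomial q0 l.
apply: (eq_measurable_fun (fun t => \sum_(l < n.+1) lcoef xi n l * Im (kernel_monomial q l t))).
  by move=> t _; rewrite cIm_sum; apply: eq_bigr => l _; rewrite cImM/= mul0r addr0.
apply: measurable_sum => l; apply: measurable_funM => //.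
by have [] := measurable_kernel_monomial q0 l.
Qed.

Lemma measurable_opN_lsumc Phi N :
  measurable_fun Rpos (fun t => Re (opN q (lsumc Phi N) t)) /\
  measurable_fun Rpos (fun t => Im (opN q (lsumc Phi N) t)).
Proof.
split.
  apply: (eq_measurable_fun (fun t => \sum_(n < N)
      (Re (Phi n) * Re (opN_lag n t) - Im (Phi n) * Im (opN_lag n t)))).
    move=> t /set_mem; rewrite RposE => t0; rewrite opN_lsumc// cRe_sum.
    by apply: eq_bigr => n _; rewrite cReM.
  apply: measurable_sum => n; have [m1 m2] := measurable_opN_lag n.
  by apply: measurable_funB; exact: measurable_funM.
apply: (eq_measurable_fun (fun t => \sum_(n < N)
    (Re (Phi n) * Im (opN_lag n t) + Im (Phi n) * Re (opN_lag n t)))).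
  move=> t /set_mem; rewrite RposE => t0; rewrite opN_lsumc// cIm_sum.
  by apply: eq_bigr => n _; rewrite cImM.
apply: measurable_sum => n; have [m1 m2] := measurable_opN_lag n.
by apply: measurable_funD; exact: measurable_funM.
Qed.

Lemma cvg_norm1c (z_ : nat -> R[i]) z (b : nat -> R) :
  (forall n, norm1c (z - z_ n) <= b n) -> b @ \oo --> (0 : R) ->
  (fun n => Re (z_ n)) @ \oo --> Re z /\ (fun n => Im (z_ n)) @ \oo --> Im z.
Proof.
move=> zb b0; split; apply/cvgrPdist_le => e e0;
  have /cvgrPdist_le/(_ e e0) := b0; apply: filterS => n;
  rewrite sub0r normrN => h.
  rewrite (le_trans _ (le_trans (ler_norm _) h))// (le_trans _ (zb n))//.
  by rewrite /norm1c cReD cReN lerDl.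
rewrite (le_trans _ (le_trans (ler_norm _) h))// (le_trans _ (zb n))//.
by rewrite /norm1c cImD cImN lerDr.
Qed.

(** By linearity, [opN_bound] applies to the remainder of the expansion, whose [mass] tends to 0. *)
Lemma opN_expansion_cvg phi Phi t : cL2 phi -> cexpansion phi Phi -> 0 < t ->
  (fun N => Re (opN q (lsumc Phi N) t)) @ \oo --> Re (opN q phi t) /\
  (fun N => Im (opN q (lsumc Phi N) t)) @ \oo --> Im (opN q phi t).
Proof.
move=> h1 h2 t0; have [B B0 HB] := opN_bound.
apply: (@cvg_norm1c _ _ (fun N => B * (1 + t) * mass (fun t => phi t - lsumc Phi N t))).
  move=> N; rewrite -opNB//; last exact: cL2_lsumc.
  by apply: (HB _ _ _ t0).2; exact: cL2B (cL2_lsumc _ _).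
by rewrite -(mulr0 (B * (1 + t))); apply: cvgMl_tmp; exact: mass_cvg.
Qed.

(** N_q phi is a pointwise limit of its values on partial sums, which are explicit measurable
    functions. *)
Lemma measurable_opN phi Phi : cL2 phi -> cexpansion phi Phi ->
  measurable_fun Rpos (fun t => Re (opN q phi t)) /\
  measurable_fun Rpos (fun t => Im (opN q phi t)).
Proof.
move=> h1 h2; split.
  apply: (@measurable_fun_cvg _ _ _ _ (fun N t => Re (opN q (lsumc Phi N) t))).
    by move=> N; have [] := measurable_opN_lsumc Phi N.
  by move=> t; rewrite RposE => t0; have [] := opN_expansion_cvg h1 h2 t0.
apply: (@measurable_fun_cvg _ _ _ _ (fun N t => Im (opN q (lsumc Phi N) t))).
  by move=> N; have [] := measurable_opN_lsumc Phi N.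
by move=> t; rewrite RposE => t0; have [] := opN_expansion_cvg h1 h2 t0.
Qed.

End Operators.

(** * From the operator equation to the infinite system *)

Section System.
Context {R : realType}.
Local Notation mu := (@lebesgue_measure R).
Local Notation ible f := (mu.-integrable Rpos (EFin \o f)).
Local Notation Re := (@complex.Re R).
Local Notation Im := (@complex.Im R).
Implicit Types (phi psi : R -> R[i]) (Phi : nat -> R[i]) (t s : R).
Variable q : R[i].
Hypothesis q0 : 0 < Re q.
Local Notation xi := (Re q).
Local Notation w := (lweight xi).

Lemma cL2D phi psi : cL2 q phi -> cL2 q psi -> cL2 q (fun t => phi t + psi t).
Proof.
move=> [p1 p2] [s1 s2]; split.
  by under eq_fun do rewrite cReD; exact: rL2D.
by under eq_fun do rewrite cImD; exact: rL2D.
Qed.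

Lemma cL2Z z phi : cL2 q phi -> cL2 q (fun t => z * phi t).
Proof.
move=> [p1 p2]; split.
  by under eq_fun do rewrite cReM; apply: rL2B; exact: rL2Z.
by under eq_fun do rewrite cImM; apply: rL2D; exact: rL2Z.
Qed.

Lemma cL2_opM phi : cL2 q phi -> cL2 q (opM phi).
Proof.
move=> [p1 p2]; split; rewrite /opM.
  by under eq_fun do rewrite cReM/= mul0r subr0; exact: rL2_exp.
by under eq_fun do rewrite cImM/= mul0r addr0; exact: rL2_exp.
Qed.

Lemma cL2_opN psi : cL2 q psi ->
  measurable_fun Rpos (fun t => Re (opN q psi t)) ->
  measurable_fun Rpos (fun t => Im (opN q psi t)) -> cL2 q (opN q psi).
Proof.
move=> h mr mi; have [B B0 HB] := opN_bound q0.
have il : rL2 xi (fun t => B * mass q psi * lin t) by apply: rL2Z; exact: rL2_lin.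
have le_l t : 0 < t -> norm1c (opN q psi t) <= `|B * mass q psi * lin t|.
  move=> t0; apply: (le_trans (HB _ _ h t0).2); apply: le_trans (ler_norm _).
  by rewrite /lin mulrAC.
split; apply: (rL2_le il) => // t t0; apply: le_trans (le_l t t0).
  by rewrite /norm1c lerDl.
by rewrite /norm1c lerDr.
Qed.

Lemma cL2_opN_expansion phi Phi : cL2 q phi -> cexpansion q phi Phi -> cL2 q (opN q phi).
Proof. by move=> h1 h2; have [] := measurable_opN q0 h1 h2; exact: cL2_opN. Qed.

(** The second argument is real, so the scalar product needs no conjugation. *)
Definition cip phi (f : R -> R) : R[i] :=
  ip xi (fun t => Re (phi t)) f +i* ip xi (fun t => Im (phi t)) f.

Lemma cip_cint phi f : cL2 q phi -> rL2 xi f ->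
  cintegrable (fun t => phi t * (f t * w t)%:C) /\
  cint (fun t => phi t * (f t * w t)%:C) = cip phi f.
Proof.
move=> [p1 p2] i_f; have [_ i1 _] := rL2_mul p1 i_f; have [_ i2 _] := rL2_mul p2 i_f.
have er t : Re (phi t * (f t * w t)%:C) = Re (phi t) * f t * w t.
  by rewrite cReM/= mulr0 subr0 mulrA.
have ei t : Im (phi t * (f t * w t)%:C) = Im (phi t) * f t * w t.
  by rewrite cImM/= mulr0 add0r mulrA.
split; last by congr (_ +i* _); apply: eq_Rintegral => t _.
by split; [apply: eq_ible i1|apply: eq_ible i2] => t _; rewrite ?er ?ei.
Qed.

Lemma cipD phi psi f : cL2 q phi -> cL2 q psi -> rL2 xi f ->
  cip (fun t => phi t + psi t) f = cip phi f + cip psi f.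
Proof.
move=> h1 h2 i_f; have [i1 e1] := cip_cint h1 i_f; have [i2 e2] := cip_cint h2 i_f.
rewrite -e1 -e2 -(cip_cint (cL2D h1 h2) i_f).2 -cintD//.
by apply: eq_cint => t _; rewrite mulrDl.
Qed.

Lemma cipZ z phi f : cL2 q phi -> rL2 xi f -> cip (fun t => z * phi t) f = z * cip phi f.
Proof.
move=> h1 i_f; have [i1 e1] := cip_cint h1 i_f.
rewrite -e1 -(cip_cint (cL2Z z h1) i_f).2 -cintZ//.
by apply: eq_cint => t _; rewrite mulrA.
Qed.

Lemma cip_eq0 phi : cL2 q phi -> (forall n, cip phi (lag xi n) = 0) -> ae_zero phi.
Proof.
move=> [p1 p2] h.
have z1 : {ae mu, forall t, Rpos t -> Re (phi t) = 0}.
  by apply: (rL2_orthogonal_ae_zero q0 p1) => n; have /(congr1 Re) := h n.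
have z2 : {ae mu, forall t, Rpos t -> Im (phi t) = 0}.
  by apply: (rL2_orthogonal_ae_zero q0 p2) => n; have /(congr1 Im) := h n.
apply: (@filterS2 _ _ (ae_filter_ringOfSetsType mu) _ _ _ _ z1 z2) => t h1 h2 t0.
by apply: eq_complexP; [exact: h1|exact: h2].
Qed.

Lemma ae_zero_cip phi f : cL2 q phi -> measurable_fun Rpos f -> ae_zero phi -> cip phi f = 0.
Proof.
move=> [[m1 _] [m2 _]] mf z; apply: eq_complexP => /=.
  by apply: ae_zero_ip => //; apply: (@filterS _ _ (ae_filter_ringOfSetsType mu) _ _ _ z) => t h /h ->.
by apply: ae_zero_ip => //; apply: (@filterS _ _ (ae_filter_ringOfSetsType mu) _ _ _ z) => t h /h ->.
Qed.

Lemma cip_expansion_lag phi Phi k : cL2 q phi -> cexpansion q phi Phi ->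
  cip phi (lag xi k) = (lnorm xi k)%:C * Phi k.
Proof.
move=> [p1 p2] [e1 e2]; rewrite /cip (rexpansion_coef q0 k p1 e1) (rexpansion_coef q0 k p2 e2).
by case: (Phi k) => x y; apply: eq_complexP => /=; ring.
Qed.

(** Multiplication by [e^(- t)] is symmetric: moved onto [lag xi k], it gives a fixed [g] in L^2,
    and the scalar product with [g] is continuous along the expansion. *)
Lemma cip_opM_series phi Phi k : cL2 q phi -> cexpansion q phi Phi ->
  cseries_cvg (fun n => (ip xi (fun t => expR (- t) * lag xi n t) (lag xi k))%:C * Phi n)
    (cip (opM phi) (lag xi k)).
Proof.
move=> [p1 p2] [e1 e2]; pose g t := expR (- t) * lag xi k t.
have ig : rL2 xi g by apply: rL2_exp; exact: rL2_lag.
have key (f : R -> R) (F : nat -> R) : rL2 xi f -> rexpansion xi f F ->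
    series (fun n => ip xi (fun t => expR (- t) * lag xi n t) (lag xi k) * F n) @ \oo -->
    ip xi (fun t => expR (- t) * f t) (lag xi k).
  move=> i_f ef; have c := rexpansion_ip q0 i_f ef ig.
  have -> : ip xi (fun t => expR (- t) * f t) (lag xi k) = ip xi f g.
    by apply: eq_Rintegral => t _; rewrite /g; move: (w t) => W; ring.
  have -> // : series (fun n => ip xi (fun t => expR (- t) * lag xi n t) (lag xi k) * F n) =
     (fun N => ip xi (lsum xi F N) g).
  apply/funext => N; rewrite /series/= big_mkord ip_suml//; last first.
    by move=> n; apply: rL2Z; exact: rL2_lag.
  apply: eq_bigr => n _; rewrite ipZl//; last exact: rL2_lag.
  rewrite mulrC; congr (_ * _); apply: eq_Rintegral => t _.
  by rewrite /g; move: (w t) => W; ring.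
apply: cseries_cvgP.
  under eq_fun do rewrite cReM/= mul0r subr0.
  have -> : Re (cip (opM phi) (lag xi k)) = ip xi (fun t => expR (- t) * Re (phi t)) (lag xi k).
    by apply: eq_Rintegral => t _; rewrite /opM cReM/= mul0r subr0.
  exact: key.
under eq_fun do rewrite cImM/= mul0r addr0.
have -> : Im (cip (opM phi) (lag xi k)) = ip xi (fun t => expR (- t) * Im (phi t)) (lag xi k).
  by apply: eq_Rintegral => t _; rewrite /opM cImM/= mul0r addr0.
exact: key.
Qed.

Lemma cip_opN_lsumc Phi N k : cip (opN q (lsumc q Phi N)) (lag xi k) =
  \sum_(n < N) Phi n * \sum_(l < n.+1) (lcoef xi n l)%:C * kernel_entry q k l.
Proof.
have h : cL2 q (opN q (lsumc q Phi N)).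
  by have [] := measurable_opN_lsumc q0 Phi N; apply: cL2_opN; exact: cL2_lsumc.
have il (n : nat) : cintegrable (fun t => \sum_(l < n.+1) (lcoef xi n l)%:C *
    (kernel_monomial q l t * (lag xi k t * w t)%:C)).
  by apply: cintegrable_sum => l; apply: cintegrableZ; exact: (kernel_monomial_lag q0 k l).1.
rewrite -(cip_cint h (rL2_lag q0 k)).2.
transitivity (cint (fun t => \sum_(n < N) Phi n * \sum_(l < n.+1) (lcoef xi n l)%:C *
    (kernel_monomial q l t * (lag xi k t * w t)%:C))).
  apply: eq_cint => t t0; rewrite opN_lsumc// mulr_suml; apply: eq_bigr => n _.
  rewrite -mulrA /opN_lag mulr_suml; congr (_ * _); apply: eq_bigr => l _.
  by rewrite mulrA.
rewrite cint_sum; last by move=> n; apply: cintegrableZ; exact: il.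
apply: eq_bigr => n _; rewrite cintZ//; congr (_ * _).
rewrite cint_sum; last by move=> l; apply: cintegrableZ; exact: (kernel_monomial_lag q0 k l).1.
apply: eq_bigr => l _; rewrite cintZ; last exact: (kernel_monomial_lag q0 k l).1.
by rewrite (kernel_monomial_lag q0 k l).2.
Qed.

(** The pointwise bound on N_q of the remainder, integrated against [lag xi k], is the constant
    [B * C] times the [mass] of the remainder, which tends to 0. *)
Lemma cip_opN_series phi Phi k : cL2 q phi -> cexpansion q phi Phi ->
  cseries_cvg (fun n => Phi n * \sum_(l < n.+1) (lcoef xi n l)%:C * kernel_entry q k l)
    (cip (opN q phi) (lag xi k)).
Proof.
move=> h1 h2; have [B B0 HB] := opN_bound q0.
pose d N t := phi t - lsumc q Phi N t.
have hd N : cL2 q (d N) by exact: cL2B (cL2_lsumc _ _ _).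
have hN N : cL2 q (opN q (lsumc q Phi N)).
  by have [] := measurable_opN_lsumc q0 Phi N; apply: cL2_opN; exact: cL2_lsumc.
have hphi := cL2_opN_expansion h1 h2; have ik := rL2_lag q0 k.
have [iL _ _] := rL2_mul (rL2_lin q0) ik.
pose C := \int[mu]_(t in Rpos) (`|lin t| * `|lag xi k t| * w t).
have := @cvg_norm1c R (fun N => cip (opN q (lsumc q Phi N)) (lag xi k))
  (cip (opN q phi) (lag xi k)) (fun N => B * mass q (d N) * C).
move=> /(_ _ _)[].
- move=> N; pose g t := B * mass q (d N) * (`|lin t| * `|lag xi k t| * w t).
  have ig : ible g by exact: ibleZ.
  have hB : cL2 q (fun t => opN q phi t - opN q (lsumc q Phi N) t) by exact: cL2B.
  have -> : cip (opN q phi) (lag xi k) - cip (opN q (lsumc q Phi N)) (lag xi k) =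
      cip (fun t => opN q phi t - opN q (lsumc q Phi N) t) (lag xi k).
    rewrite -mulN1r -cipZ// -cipD//; last exact: cL2Z.
    by congr cip; apply/funext => t; rewrite mulN1r.
  have [i3 <-] := cip_cint hB ik.
  have -> : B * mass q (d N) * C = \int[mu]_(t in Rpos) g t.
    by rewrite /g (RintegralZl _ measurable_Rpos iL).
  apply: (norm1c_cint_le i3 ig) => t t0; rewrite -opNB//; last exact: cL2_lsumc.
  apply: (le_trans (norm1cM _ _)); rewrite norm1c_real (normrM _ (w t)).
  rewrite (ger0_norm (lweight_ge0 xi t)) /g.
  have -> : B * mass q (d N) * (`|lin t| * `|lag xi k t| * w t) =
      B * (1 + t) * mass q (d N) * (`|lag xi k t| * w t).
    rewrite ger0_norm; last by rewrite /lin addr_ge0// ltW.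
    by rewrite /lin; move: (w t) => W; ring.
  apply: ler_wpM2r; first by apply: mulr_ge0 => //; exact: lweight_ge0.
  exact: (HB _ _ (hd N) t0).2.
- have : (fun N => B * mass q (d N) * C) @ \oo --> B * 0 * C.
    by apply: cvgMr_tmp; apply: cvgMl_tmp; exact: mass_cvg.
  by rewrite mulr0 mul0r.
move=> c1 c2; rewrite /cseries_cvg.
have -> : series ((fun n => Phi n * \sum_(l < n.+1) (lcoef xi n l)%:C * kernel_entry q k l)
    : nat -> R[i]^o) = (fun N => cip (opN q (lsumc q Phi N)) (lag xi k)).
  by apply/funext => N; rewrite cip_opN_lsumc /series/= big_mkord.
exact: cvg_complexP.
Qed.

Lemma matA_series sgn phi Phi k : cL2 q phi -> cexpansion q phi Phi ->
  cseries_cvg (fun n => matA sgn q k n * Phi n)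
    (cip (fun t => opM phi t + (-1) ^+ sgn * opN q phi t) (lag xi k)).
Proof.
move=> h1 h2; have hN := cL2_opN_expansion h1 h2; have ik := rL2_lag q0 k.
rewrite cipD//; [|exact: cL2_opM|exact: cL2Z].
rewrite cipZ//.
have := cseries_cvgD (cip_opM_series (k := k) h1 h2) (cseries_cvgZ (z := (-1) ^+ sgn) (cip_opN_series (k := k) h1 h2)).
rewrite /cseries_cvg; set f := (X in series X) ; set g := (X in _ -> series X @ _ --> _).
suff -> : g = f by [].
apply/funext => n; rewrite /f /g matAE//; move: (ip _ _ _) (\sum_(l < _) _) => x y.
by ring.
Qed.

Lemma Gamma_lnorm k : Gamma (k%:R + 2 * xi%:C) / k`!%:R = (lnorm xi k)%:C.
Proof.
have -> : k%:R + 2 * xi%:C = (k%:R + 2 * xi)%:C.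
  by rewrite rmorphD rmorphM !rmorph_nat.
by rewrite /lnorm Gamma_real [RHS]rmorphM fmorphV rmorph_nat.
Qed.

Lemma matD_series Phi k : cseries_cvg (fun n => matD q k n * Phi n) ((lnorm xi k)%:C * Phi k).
Proof.
have := @cseries_cvg_finite R (fun n => matD q k n * Phi n) k.+1.
rewrite big_ord_recr/= big1 ?add0r; last first.
  by move=> i _; rewrite /matD gtn_eqF ?mulr0 ?mul0r.
rewrite /matD eqxx mulr1 Gamma_lnorm//; apply => i ki.
by rewrite ltn_eqF// mulr0 mul0r.
Qed.

End System.

(** * The two directions of the equivalence *)

Section Main.
Context {R : realType}.
Local Notation Re := (@complex.Re R).
Local Notation Im := (@complex.Im R).
Implicit Types (phi psi : R -> R[i]) (Phi : nat -> R[i]) (t s : R).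
Variable q : R[i].
Hypothesis q0 : 0 < Re q.
Local Notation xi := (Re q).

(** Bounded partial sums are the form in which the condition passes to the real and imaginary parts
    and to [riesz_fischer]. *)
Lemma weighted_l2P Phi : weighted_l2 xi Phi <->
  exists M : R, forall N,
    \sum_(n < N) (Re (Phi n) ^+ 2 + Im (Phi n) ^+ 2) * lnorm xi n <= M.
Proof.
pose u n := (Re (Phi n) ^+ 2 + Im (Phi n) ^+ 2) * lnorm xi n.
have u0 n : 0 <= u n.
  by rewrite mulr_ge0 ?addr_ge0 ?sqr_ge0// ltW// lnorm_gt0.
have uE n : Re (`|Phi n| ^+ 2 * (Gamma (n%:R + 2 * xi%:C) / n`!%:R)) = u n.
  by rewrite Gamma_lnorm// cReM mulr0 subr0 /u -Re_normc_sqr expr2 cReM normc_def/= mul0r subr0 expr2.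
have uS N : (\sum_(0 <= n < N) (u n)%:E = (\sum_(n < N) u n)%:E)%E.
  by rewrite big_mkord sumEFin.
rewrite /weighted_l2; under eq_eseriesr do rewrite uE.
split=> [fin|[M bM]].
  have s0 : (0 <= \sum_(0 <= n <oo) (u n)%:E)%E.
    by apply: nneseries_ge0 => n _ _; rewrite lee_fin.
  have sf : (\sum_(0 <= n <oo) (u n)%:E)%E \is a fin_num by rewrite ge0_fin_numE.
  exists (fine (\sum_(0 <= n <oo) (u n)%:E)%E) => N.
  rewrite -lee_fin fineK// -uS; apply: nneseries_lim_ge => n _ _.
  by rewrite lee_fin.
apply: (@le_lt_trans _ _ M%:E); last exact: ltry.
apply: lime_le; first by apply: is_cvg_nneseries => n _ _; rewrite lee_fin.
by apply: nearW => N; rewrite uS lee_fin.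
Qed.

Lemma op_eq_mulmv sgn phi Phi k : cL2 q phi -> cexpansion q phi Phi ->
  cip q (fun t => opM phi t + (-1) ^+ sgn * opN q phi t - phi t) (lag xi k) =
  cip q (fun t => opM phi t + (-1) ^+ sgn * opN q phi t) (lag xi k) - (lnorm xi k)%:C * Phi k.
Proof.
move=> h1 h2; have hN := cL2_opN_expansion q0 h1 h2; have ik := rL2_lag q0 k.
have hT : cL2 q (fun t => opM phi t + (-1) ^+ sgn * opN q phi t).
  by apply: cL2D => //; [exact: cL2_opM|exact: cL2Z].
rewrite -(cip_expansion_lag q0 k h1 h2) -[- cip _ _ _]mulN1r -cipZ// -cipD//; last exact: cL2Z.
by congr cip; apply/funext => t; rewrite mulN1r.
Qed.

Lemma cL2_op sgn phi Phi : cL2 q phi -> cexpansion q phi Phi ->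
  cL2 q (fun t => opM phi t + (-1) ^+ sgn * opN q phi t - phi t).
Proof.
move=> h1 h2; have hN := cL2_opN_expansion q0 h1 h2.
apply: cL2B => //; apply: cL2D => //; [exact: cL2_opM|exact: cL2Z].
Qed.

(** The [k]-th Laguerre scalar product of [(M +- N_q - I) phi] is the difference of the [k]-th rows
    of the two matrix products, which have the same sum [v k]; completeness then makes that function
    vanish almost everywhere. *)
Lemma op_sol_of_sys_sol sgn Phi : sys_sol sgn q Phi ->
  exists phi, op_sol sgn q phi /\ Laguerre_expansion xi phi Phi.
Proof.
move=> [[n Phin] /weighted_l2P[M bM] [v [Av Dv]]].
have le1 N : \sum_(n < N) Re (Phi n) ^+ 2 * lnorm xi n <= M.
  apply: (le_trans _ (bM N)); apply: ler_sum => i _.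
  by rewrite mulrDl lerDl mulr_ge0 ?sqr_ge0// ltW// lnorm_gt0.
have le2 N : \sum_(n < N) Im (Phi n) ^+ 2 * lnorm xi n <= M.
  apply: (le_trans _ (bM N)); apply: ler_sum => i _.
  by rewrite mulrDl lerDr mulr_ge0 ?sqr_ge0// ltW// lnorm_gt0.
have [f [i_f ef]] := riesz_fischer q0 (Phi := fun n => Re (Phi n)) le1.
have [g [ig eg]] := riesz_fischer q0 (Phi := fun n => Im (Phi n)) le2.
pose phi t : R[i] := f t +i* g t.
have h1 : cL2 q phi by [].
have h2 : cexpansion q phi Phi by [].
exists phi; split; last exact: cexpansion_Laguerre.
split; first exact/inL2P.
  move=> z; have := cip_expansion_lag q0 n h1 h2.
  rewrite ae_zero_cip//; last by have [] := rL2_lag q0 n.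
  move=> /esym/eqP; rewrite mulf_eq0 (negPf Phin) orbF fmorph_eq0.
  by rewrite gt_eqF// lnorm_gt0.
apply: (cip_eq0 q0); first exact: cL2_op h2.
move=> k; rewrite (op_eq_mulmv _ k h1 h2).
rewrite (cseries_cvg_unique (matA_series q0 (sgn := sgn) (k := k) h1 h2) (Av k)).
by rewrite (cseries_cvg_unique (Dv k) (matD_series (Phi := Phi) (k := k))) subrr.
Qed.

Lemma sys_sol_of_op_sol sgn phi : op_sol sgn q phi ->
  exists Phi, sys_sol sgn q Phi /\ Laguerre_expansion xi phi Phi.
Proof.
move=> [/inL2P h1 phi0 Tphi].
pose Phi n : R[i] := coef xi (fun t => Re (phi t)) n +i* coef xi (fun t => Im (phi t)) n.
have h2 : cexpansion q phi Phi by have [p1 p2] := h1; split; exact: rexpansion_exists.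
exists Phi; split; last exact: cexpansion_Laguerre.
split.
(* If all coefficients were 0, [phi] would be orthogonal to every [lag xi n], hence 0 almost
   everywhere. *)
- apply: contrapT => /forallNP Phi0; apply: phi0; apply: (cip_eq0 q0 h1) => n.
  rewrite (cip_expansion_lag q0 n h1 h2).
  by have /negP/negbNE/eqP -> := Phi0 n; rewrite mulr0.
- have [p1 p2] := h1; apply/weighted_l2P.
  exists (ip xi (fun t => Re (phi t)) (fun t => Re (phi t)) +
          ip xi (fun t => Im (phi t)) (fun t => Im (phi t))) => N.
  under eq_bigr do rewrite mulrDl.
  by rewrite big_split; apply: lerD; exact: bessel_inequality.
exists (fun k => (lnorm xi k)%:C * Phi k); split; last exact: matD_series.
move=> k; suff <- : cip q (fun t => opM phi t + (-1) ^+ sgn * opN q phi t) (lag xi k) =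
    (lnorm xi k)%:C * Phi k by exact: matA_series.
apply/eqP; rewrite -subr_eq0 -(op_eq_mulmv sgn k h1 h2) ae_zero_cip//.
  exact: cL2_op h2.
by have [] := rL2_lag q0 k.
Qed.

End Main.

Theorem theorem3p7 (R : realType) (q : R[i]) (sgn : bool)
    (xi_gt0 : 0 < complex.Re q) (q_neq_half : q != 2^-1) :
  [/\ (exists phi : R -> R[i], op_sol sgn q phi) <->
      (exists Phi : nat -> R[i], sys_sol sgn q Phi),
      (forall Phi : nat -> R[i], sys_sol sgn q Phi ->
         exists phi : R -> R[i],
           op_sol sgn q phi /\ Laguerre_expansion (complex.Re q) phi Phi) &
      (forall phi : R -> R[i], op_sol sgn q phi ->
         exists Phi : nat -> R[i],
           sys_sol sgn q Phi /\ Laguerre_expansion (complex.Re q) phi Phi)].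
Proof.
have H1 := @op_sol_of_sys_sol R q xi_gt0 sgn.
have H2 := @sys_sol_of_op_sol R q xi_gt0 sgn.
split => //; split=> [[phi /H2[Phi [h _]]]|[Phi /H1[phi [h _]]]].
  by exists Phi.
by exists phi.
Qed.
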